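(* Let $F$ be a finite field with $q$ elements and characteristic $p$, let $d\ge1$ and $A\in M_d(F[t])$, and consider the multiplication-by-$A$ map on $\mathbb{T}_F^d$ with Artin–Mazur zeta function $\zeta_A(z)$. Put $r(A)=\prod_\lambda\max\{1,|\lambda|_F\}$, where $\lambda$ ranges over the $d$ eigenvalues of $A$ (with multiplicity). Let $\mu_1,\ldots,\mu_M$ be the eigenvalues of $A$ (with multiplicity) that are roots of unity and $\eta_1,\ldots,\eta_N$ the eigenvalues of $A$ (with multiplicity) with $|\eta_j|_F=1$ that are not roots of unity. Let $m_i$ be the order of $\mu_i$ modulo $\mathfrak p$ ($1\le i\le M$) and $n_j$ the order of $\eta_j$ modulo $\mathfrak p$ ($1\le j\le N$). (a) If for every $j\in\{1,\ldots,N\}$ there exists $i\in\{1,\ldots,M\}$ with $m_i\mid n_j$, then $\zeta_A(z)$ is algebraic and $$\zeta_A(z)=(1-r(A)z)^{-1}\prod_{1\le\ell\le M}\ \prod_{1\le i_1<\cdots<i_\ell\le M}\left(1-(r(A)z)^{\operatorname{lcm}(m_{i_1},\ldots,m_{i_\ell})}\right)^{(-1)^{\ell+1}/\operatorname{lcm}(m_{i_1},\ldots,m_{i_\ell})}.$$ (b) Otherwise, i.e. if there exists $j\in\{1,\ldots,N\}$ such that $m_i\nmid n_j$ for every $i\in\{1,\ldots,M\}$, then both $\sum_{k\ge1}N_k(A)z^k$ and $\zeta_A(z)$ converge in the open disk $\{z\in\mathbb{C}:|z|<1/r(A)\}$ and both admit the circle of radius $1/r(A)$ as a natural boundary; consequently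 $\zeta_A(z)$ is transcendental.
   Context: $\mathbb{R}_F=F((1/t))$ carries the absolute value $|x|_F=q^{-v(x)}$, where $v(0)=\infty$ and $v\big(\sum_{i\le m}a_it^i\big)=-m$ if $a_m\neq0$; $|\cdot|_F$ is extended uniquely to a fixed algebraic closure of $\mathbb{R}_F$, where eigenvalues are taken. $\mathbb{T}_F=F((1/t))/F[t]$ is a compact abelian group, and $A$ acts on $\mathbb{T}_F^d$ by matrix multiplication. For a self-map $f$ of a topological space, $N_k(f)$ is the number of isolated fixed points of $f^k$; when all $N_k(f)$ are finite (as they are for $A$), the Artin–Mazur zeta function is $\zeta_f(z)=\exp\big(\sum_{k\ge1}\frac{N_k(f)}{k}z^k\big)$. For $\alpha$ algebraic over $\mathbb{R}_F$ with $|\alpha|_F=1$, the order of $\alpha$ modulo $\mathfrak p$ is the smallest positive integer $n$ with $|\alpha^n-1|_F<1$. Empty products equal $1$ (e.g. if $M=0$). A natural boundary for a function on a disk means the function cannot be analytically continued to a neighborhood of any point of the boundary circle. *)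

(* Defs.v *)
From HB Require Import structures.
From mathcomp Require Import all_boot all_order all_algebra finmap.
From mathcomp Require Import all_classical all_reals all_analysis.
From mathcomp Require Import complex zify.

Set Implicit Arguments.
Unset Strict Implicit.
Unset Printing Implicit Defensive.

Import Order.TTheory GRing.Theory Num.Theory numFieldNormedType.Exports.

Local Open Scope classical_set_scope.
Local Open Scope ring_scope.

Definition bounded_above (F : fieldType) : pred (int -> F) :=
  fun f => `[< exists m : int, forall i, m < i -> f i = 0 >].

(* F((1/t)): formal sums of c_i t^i over i <= m, for some m; lcoef x i is the
   coefficient of t^i. *)
Record laurent (F : fieldType) := Laurent {
  lcoef : int -> F ;
  lcoefP : lcoef \in @bounded_above F }.

Section LaurentZmod.
Variable F : fieldType.

Fact bounded_above_zmod : zmod_closed (@bounded_above F).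
Proof.
split=> [|f g].
  by rewrite unfold_in; apply/asboolP; exists 0.
rewrite !unfold_in => /asboolP[m hm] /asboolP[n hn]; apply/asboolP.
exists (Num.max m n) => i; rewrite gt_max => /andP[mi ni].
by rewrite /= !fctE hm // hn // subrr.
Qed.

HB.instance Definition _ := GRing.isZmodClosed.Build (int -> F) (@bounded_above F)
  bounded_above_zmod.
HB.instance Definition _ := [isSub for @lcoef F].
HB.instance Definition _ := [Choice of laurent F by <:].
HB.instance Definition _ := [SubChoice_isSubZmodule of laurent F by <:].

End LaurentZmod.

Section LaurentField.
Variable F : fieldType.
Implicit Types (x y z : laurent F) (m n : int) (f g : int -> F).

Lemma laurentP x y : lcoef x =1 lcoef y -> x = y.
Proof. by move=> /funext; exact: val_inj. Qed.

Lemma lcoefD x y i : lcoef (x + y) i = lcoef x i + lcoef y i.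
Proof. by []. Qed.

(* fsbigop sums over the finite support. *)
Definition conv f g : int -> F :=
  fun k => \sum_(i \in [set: int]) f i * g (k - i).

Let below m f := forall i, m < i -> f i = 0.

(* f in reverse order from degree m down, as a polynomial in 1/t *)
Let rpoly m N f : {poly F} := \poly_(i < N) f (m - i%:Z).

Let convE m n f g (j N : nat) : below m f -> below n g -> (j < N)%N ->
  conv f g (m + n - j%:Z) = (rpoly m N f * rpoly n N g)`_j.
Proof.
move=> fm gn jN; rewrite coefM /conv.
rewrite (@fsbigE _ _ _ _ _ [seq m - l%:Z | l <- iota 0 j.+1]) //.
- rewrite big_mkcond big_map -[iota 0 j.+1]/(index_iota 0 j.+1) big_mkord.
  apply: eq_bigr => l _; rewrite in_setT !coef_poly.
  have lj := ltn_ord l; rewrite !ifT; [|lia|lia].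
  by congr (_ * g _); rewrite -subzn; lia.
- by rewrite map_inj_uniq ?iota_uniq //; move=> a b; lia.
- move=> i _ /mapP iN.
  have [mi|im] := ltP m i; first by rewrite fm ?mul0r.
  have [nji|jni] := ltP n (m + n - j%:Z - i); first by rewrite gn ?mulr0.
  case: iN; exists (absz (m - i)%R); last by lia.
  by rewrite mem_iota; lia.
Qed.

Let conv_below m n f g : below m f -> below n g -> below (m + n) (conv f g).
Proof.
move=> fm gn k mnk; apply: fsbig1 => i _.
have [mi|im] := ltP m i; first by rewrite fm ?mul0r.
by rewrite [g _]gn ?mulr0 //; lia.
Qed.

Let lcoef_below x : exists m, below m (lcoef x).
Proof. by have := lcoefP x; rewrite unfold_in => /asboolP. Qed.

Let belowW m n f : (m <= n) -> below m f -> below n f.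
Proof. by move=> mn fm i ni; apply: fm; exact: le_lt_trans ni. Qed.

Fact conv_bounded x y : conv (lcoef x) (lcoef y) \in @bounded_above F.
Proof.
have [[m xm] [n yn]] := (lcoef_below x, lcoef_below y).
by rewrite unfold_in; apply/asboolP; exists (m + n); exact: conv_below.
Qed.

Definition lmul x y : laurent F := Laurent (conv_bounded x y).

Fact lone_bounded : (fun i : int => (i == 0)%:R : F) \in @bounded_above F.
Proof.
rewrite unfold_in; apply/asboolP; exists 0 => i i0.
by rewrite gt_eqF.
Qed.

Definition lone : laurent F := Laurent lone_bounded.

Let below1 : below 0 (lcoef lone).
Proof. by move=> i i0 /=; rewrite gt_eqF. Qed.

Let conv_eq m f g : below m f -> below m g ->
  (forall j : nat, f (m - j%:Z) = g (m - j%:Z)) -> f =1 g.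
Proof.
move=> fm gm fg i; have [mi|im] := ltP m i; first by rewrite fm ?gm.
by have := fg (absz (m - i)%R); rewrite (_ : m - _ = i) //; lia.
Qed.

Let rpoly_coef m N f i : (i < N)%N -> (rpoly m N f)`_i = f (m - i%:Z).
Proof. by move=> iN; rewrite coef_poly iN. Qed.

Fact lmulC : commutative lmul.
Proof.
move=> x y; apply: laurentP.
have [[m xm] [n yn]] := (lcoef_below x, lcoef_below y).
apply: (@conv_eq (m + n)); [exact: conv_below| |move=> j /=].
  by rewrite addrC; exact: conv_below.
by rewrite (convE xm yn (ltnSn j)) mulrC (addrC m) (convE yn xm (ltnSn j)).
Qed.

Fact lmulA : associative lmul.
Proof.
move=> x y z; apply: laurentP.
have [[m xm] [[n yn] [p zp]]] := (lcoef_below x, (lcoef_below y, lcoef_below z)).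
apply: (@conv_eq (m + n + p)) => [||j /=].
- by rewrite -addrA; do 2!apply: conv_below => //.
- by do 2!apply: conv_below => //.
rewrite (convE (conv_below xm yn) zp (ltnSn j)) -(addrA m n p).
rewrite (convE xm (conv_below yn zp) (ltnSn j)).
transitivity (rpoly m j.+1 (lcoef x) *
  (rpoly n j.+1 (lcoef y) * rpoly p j.+1 (lcoef z)))`_j.
  rewrite !coefM; apply: eq_bigr => i _; congr (_ * _).
  have ij : (j - i < j.+1)%N by lia.
  by rewrite rpoly_coef // (convE yn zp ij).
rewrite mulrA [in LHS]coefM [in RHS]coefM; apply: eq_bigr => i _.
have ij := ltn_ord i.
by congr (_ * _); rewrite rpoly_coef // (convE xm yn ij).
Qed.

Fact lmul1 : left_id lone lmul.
Proof.
move=> x; apply: laurentP; have [m xm] := lcoef_below x.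
apply: (@conv_eq m) => [|//|j /=]; first by rewrite -[m]add0r; exact: conv_below.
rewrite -[m in LHS]add0r (convE below1 xm (ltnSn j)).
rewrite coefM big_ord_recl /= big1 ?addr0 => [|i _].
  by rewrite !rpoly_coef ?subn0 //= mul1r.
rewrite rpoly_coef /=; last by rewrite /bump /=; have := ltn_ord i; lia.
by rewrite mul0r.
Qed.

Fact lmulDl : left_distributive lmul +%R.
Proof.
move=> x y z; apply: laurentP.
have [[m0 xm] [[n0 yn] [p zp]]] := (lcoef_below x, (lcoef_below y, lcoef_below z)).
set m := Num.max m0 n0.
have {}xm : below m (lcoef x) by apply: belowW xm; rewrite le_max lexx.
have {}yn : below m (lcoef y) by apply: belowW yn; rewrite le_max lexx orbT.
have xy : below m (lcoef (x + y)) by move=> i mi; rewrite lcoefD xm ?yn ?addr0.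
apply: (@conv_eq (m + p)) => [||j]; first exact: conv_below.
  by move=> i mi; rewrite lcoefD /= !(@conv_below m p) ?addr0.
rewrite lcoefD /= !(convE _ zp (ltnSn j)) // -coefD -mulrDl; congr ((_ * _ : {poly F})`_j).
by apply/polyP => i; rewrite coefD !coef_poly; case: ifP => _; rewrite ?addr0 ?lcoefD.
Qed.

Fact lone_neq0 : lone != 0.
Proof.
apply/eqP => /(congr1 (fun x => lcoef x 0)) /= /eqP.
by rewrite oner_eq0.
Qed.

HB.instance Definition _ := GRing.Zmodule_isComNzRing.Build (laurent F)
  lmulA lmulC lmul1 lmulDl lone_neq0.

Lemma lcoefM x y k :
  lcoef (x * y) k = \sum_(i \in [set: int]) lcoef x i * lcoef y (k - i).
Proof. by []. Qed.

Lemma lcoef1 k : lcoef 1 k = (k == 0)%:R. Proof. by []. Qed.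

(* m is the degree of x in t *)
Definition has_ldeg x m := lcoef x m != 0 /\ forall i, m < i -> lcoef x i = 0.

Lemma has_ldeg_ex x : x != 0 -> exists m, has_ldeg x m.
Proof.
move=> x0; have [m xm] := lcoef_below x.
have [k xk] : exists k, lcoef x k != 0.
  apply: contrapT => /forallNP xk; move/eqP: x0; apply; apply: laurentP => i.
  by apply/eqP/negPn/negP; exact: xk.
pose P (j : nat) := lcoef x (m - j%:Z) != 0.
have Pex : exists j, P j.
  exists (absz (m - k)%R); rewrite /P (_ : m - _ = k) //.
  have [mk|km] := ltP m k; last by lia.
  by rewrite xm ?eqxx in xk.
have [j Pj jmin] := ex_minnP Pex.
exists (m - j%:Z); split=> // i mi.
have [/xm//|im] := ltP m i.
apply/eqP/negPn/negP => xi.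
have : (j <= absz (m - i)%R)%N; last by lia.
by apply: jmin; rewrite /P (_ : m - _ = i) //; lia.
Qed.

Let inv_seq (a : nat -> F) := fix inv_seq (n : nat) : seq F := if n is k.+1 then
  let s := inv_seq k in
  rcons s (- (a 0%N)^-1 * \sum_(l < k.+1) a l.+1 * nth 0 s (k - l)%N)
  else [:: (a 0%N)^-1].

Let size_inv_seq a (n : nat) : size (inv_seq a n) = n.+1.
Proof. by elim: n => //= n ih; rewrite size_rcons ih. Qed.

Let nth_inv_seq a (n k : nat) : (k <= n)%N -> nth 0 (inv_seq a n) k = nth 0 (inv_seq a k) k.
Proof.
elim: n => [|n ih]; first by rewrite leqn0 => /eqP->.
rewrite leq_eqVlt => /orP[/eqP->//|kn].
by rewrite [in LHS]/= nth_rcons size_inv_seq kn ih.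
Qed.

Let inv_seqP a (n : nat) : a 0%N != 0 ->
  \sum_(l < n.+1) a l * nth 0 (inv_seq a (n - l)) (n - l) = (n == 0%N)%:R.
Proof.
move=> a0; case: n => [|n]; first by rewrite big_ord1 /= mulfV.
rewrite big_ord_recl subn0 /= nth_rcons size_inv_seq ltnn eqxx.
rewrite mulrA mulrN mulfV // mulN1r addrC; apply/eqP; rewrite subr_eq0; apply/eqP.
apply: eq_bigr => l _; congr (_ * _); rewrite /bump /= add1n subSS.
by rewrite [RHS]nth_inv_seq // leq_subr.
Qed.

Lemma laurent_inv_ex x : x != 0 -> exists y, y * x = 1.
Proof.
move=> /has_ldeg_ex[m [xm0 xm]].
pose a (l : nat) := lcoef x (m - l%:Z).
pose b (l : nat) := nth 0 (inv_seq a l) l.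
pose g (i : int) : F := if i <= - m then b (absz (- m - i)%R) else 0.
have gm : below (- m) g by move=> i mi; rewrite /g leNgt mi.
have gb : g \in @bounded_above F by rewrite unfold_in; apply/asboolP; exists (- m).
exists (Laurent gb); rewrite mulrC; apply: laurentP.
apply: (@conv_eq 0) => [||j]; last 2 first.
- exact: below1.
- rewrite lcoef1 -[0 in LHS](subrr m) [LHS](convE xm gm (ltnSn j)) coefM.
  transitivity (\sum_(l < j.+1) a l * b (j - l)%N).
    apply: eq_bigr => l _; have lj := ltn_ord l.
    rewrite !rpoly_coef; [|lia|lia].
    congr (_ * _); rewrite /= /g ifT; last by lia.
    by congr b; lia.
  by rewrite inv_seqP ?/a ?subr0 // sub0r oppr_eq0 eqz_nat.
- by have := conv_below xm gm; rewrite subrr.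
Qed.

Definition linv x : laurent F :=
  if pselect (exists y, y * x = 1) is left h then sval (cid h) else 0.

Fact lmulVx x : x != 0 -> linv x * x = 1.
Proof.
move=> x0; rewrite /linv; case: pselect => [h|]; first by case: cid.
by case; exact: laurent_inv_ex.
Qed.

Fact linv0 : linv 0 = 0.
Proof.
rewrite /linv; case: pselect => // h; exfalso.
by case: h => y /esym/eqP; rewrite mulr0 oner_eq0.
Qed.

HB.instance Definition _ := GRing.ComNzRing_isField.Build (laurent F) lmulVx linv0.

Fact polyL_bounded (p : {poly F}) :
  (fun i : int => if i is Posz n then p`_n else 0) \in @bounded_above F.
Proof.
rewrite unfold_in; apply/asboolP; exists (size p)%:Z => -[n|n]//= pn.
by rewrite nth_default //; lia.
Qed.

Definition polyL (p : {poly F}) : laurent F := Laurent (polyL_bounded p).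

Fact polyL_zmod_morphism : zmod_morphism polyL.
Proof.
by move=> p q; apply: laurentP => -[n|n] /=; rewrite !fctE /= ?coefB ?subr0.
Qed.

Fact polyL_monoid_morphism : monoid_morphism polyL.
Proof.
split=> [|p q]; first by apply: laurentP => -[n|n]; rewrite lcoef1 /= ?coef1 ?eqz_nat.
apply: laurentP => k; rewrite lcoefM.
rewrite (@fsbigE _ _ _ _ _ [seq l%:Z | l <- if k is Posz n then iota 0 n.+1 else [::]]) //.
- rewrite big_mkcond big_map; case: k => [n|n]; last by rewrite big_nil.
  rewrite -[iota 0 n.+1]/(index_iota 0 n.+1) big_mkord [LHS]coefM.
  apply: eq_bigr => l _; rewrite in_setT.
  by have lj := ltn_ord l; rewrite (_ : n%:Z - l%:Z = (n - l)%N%:Z) //; lia.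
- by rewrite map_inj_uniq; [case: k => // n; exact: iota_uniq|move=> a b []].
- move=> [i|i] _; last by rewrite mul0r.
  case: k => [n|n] ik; last by rewrite (_ : Negz n - Posz i = Negz (n + i)%N) ?mulr0 //; lia.
  have [ni|ni] := leqP i n; first by rewrite map_f ?mem_iota // in ik.
  by rewrite (_ : n%:Z - i%:Z = Negz (i - n.+1)) ?mulr0 //; lia.
Qed.

HB.instance Definition _ := GRing.isZmodMorphism.Build _ _ polyL polyL_zmod_morphism.
HB.instance Definition _ := GRing.isMonoidMorphism.Build _ _ polyL polyL_monoid_morphism.

End LaurentField.

Definition ldeg (F : fieldType) (x : laurent F) : int :=
  xget 0 [set m | has_ldeg x m].

Lemma ldegP (F : fieldType) (x : laurent F) : x != 0 -> has_ldeg x (ldeg x).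
Proof. by move=> /has_ldeg_ex; exact: xgetPex. Qed.

(* |x|_F = q ^ (- v x), where v x = - ldeg x for x != 0. *)
Definition absF {R : numFieldType} (F : finFieldType) (x : laurent F) : R :=
  if x == 0 then 0 else #|F|%:R ^ ldeg x.

Section LaurentTopology.
Variable F : finFieldType.

(* The values of absF on F((1/t)) are rational, so the topology it defines can be
   given with rational radii, independently of a type of real numbers. *)
Definition laurent_open (U : set (laurent F)) := forall x, U x ->
  exists2 e : rat, 0 < e & forall y, absF (y - x) < e -> U y.

Fact laurent_openT : laurent_open setT.
Proof. by move=> x _; exists 1. Qed.

Fact laurent_openI : setI_closed laurent_open.
Proof.
move=> U V oU oV x [/oU[e e0 eU] /oV[e' e'0 eV]].
exists (Num.min e e'); first by rewrite lt_min e0.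
by move=> y; rewrite lt_min => /andP[/eU ? /eV ?].
Qed.

Fact laurent_open_bigU (I : Type) (U : I -> set (laurent F)) :
  (forall i, laurent_open (U i)) -> laurent_open (\bigcup_i U i).
Proof.
move=> oU x [i _ /(oU i)[e e0 eU]]; exists e => // y /eU ?.
by exists i.
Qed.

HB.instance Definition _ := isOpenTopological.Build (laurent F)
  laurent_openT laurent_openI laurent_open_bigU.

End LaurentTopology.

Section Torus.
Variable F : finFieldType.

Definition is_polyL : {pred laurent F} := fun x => `[< exists p, x = polyL p >].

Fact is_polyL_zmod : zmod_closed is_polyL.
Proof.
split=> [|x y]; rewrite !unfold_in.
  by apply/asboolP; exists 0; rewrite rmorph0.
move=> /asboolP[p ->] /asboolP[q ->]; apply/asboolP.
by exists (p - q); rewrite rmorphB.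
Qed.

HB.instance Definition _ := GRing.isZmodClosed.Build (laurent F) is_polyL is_polyL_zmod.

(* F((1/t)) / F[t] with the quotient topology. *)
Definition torus_quot := @Quotient.quot (laurent F) is_polyL.
Definition torus : Type := quotient_topology torus_quot.

HB.instance Definition _ := GRing.Zmodule.copy torus torus_quot.
HB.instance Definition _ := Topological.copy torus (quotient_topology torus_quot).

Definition to_torus (x : laurent F) : torus := \pi_torus_quot%qT x.
Definition of_torus (u : torus) : laurent F := repr (u : Quotient.quot is_polyL).

Definition torus_scale (p : {poly F}) (u : torus) : torus :=
  to_torus (polyL p * of_torus u).

Lemma to_torusP x y : to_torus x = to_torus y <-> exists p, x - y = polyL p.
Proof.
split=> [/eqP|xy].
  by rewrite -[_ == _]Quotient.idealrBE => /asboolP.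
by apply/eqP; rewrite -[_ == _]Quotient.idealrBE; apply/asboolP.
Qed.

Lemma of_torusK : cancel of_torus to_torus.
Proof. exact: reprK. Qed.

Lemma to_torusD x y : to_torus (x + y) = to_torus x + to_torus y.
Proof. exact: (raddfD \pi_(torus_quot)%qT). Qed.

Lemma torus_scale_to p x : torus_scale p (to_torus x) = to_torus (polyL p * x).
Proof.
apply/to_torusP.
have [q xq] := (to_torusP (of_torus (to_torus x)) x).1 (of_torusK _).
by exists (p * q); rewrite -mulrBr xq rmorphM.
Qed.

Fact torus_scaleA p q u :
  torus_scale p (torus_scale q u) = torus_scale (p * q) u.
Proof.
by rewrite -[u]of_torusK !torus_scale_to rmorphM mulrA.
Qed.

Fact torus_scale1 : left_id 1 torus_scale.
Proof. by move=> u; rewrite -[u]of_torusK torus_scale_to rmorph1 mul1r. Qed.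

Fact torus_scaleDr : right_distributive torus_scale +%R.
Proof.
move=> p u v; rewrite -[u]of_torusK -[v]of_torusK -to_torusD !torus_scale_to.
by rewrite mulrDr to_torusD.
Qed.

Fact torus_scaleDl u : {morph torus_scale^~ u : p q / p + q}.
Proof.
move=> p q; rewrite -[u]of_torusK !torus_scale_to.
by rewrite rmorphD mulrDl to_torusD.
Qed.

HB.instance Definition _ := GRing.Zmodule_isLmodule.Build {poly F} torus
  torus_scaleA torus_scale1 torus_scaleDr torus_scaleDl.

Definition torus_mulmx (d : nat) (A : 'M[{poly F}]_d) (u : 'cV[torus]_d) : 'cV[torus]_d :=
  \col_i \sum_j A i j *: u j 0.

End Torus.

Lemma to_torus_continuous (F : finFieldType) : continuous (@to_torus F).
Proof. exact: pi_continuous. Qed.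

Section Closure.
Variables (R : realType) (F : finFieldType) (K : closedFieldType).

Definition is_absolute_value (absK : K -> R) : Prop :=
  [/\ forall a, 0 <= absK a,
      forall a, absK a = 0 <-> a = 0,
      forall a b, absK (a * b) = absK a * absK b
    & forall a b, absK (a + b) <= absK a + absK b].

(* With multiplicity: the roots of the split characteristic polynomial. *)
Definition eigenvalues (d : nat) (B : 'M[K]_d) : seq K :=
  sval (closed_field_poly_normal (char_poly B)).

Definition is_root_of_unity (a : K) : bool :=
  `[< exists2 n : nat, (0 < n)%N & a ^+ n = 1 >].

(* The junk value 0 is not attained when absK is an absolute value extending
   absF, K is algebraic over F((1/t)) and absK a = 1. *)
Definition order_mod (absK : K -> R) (a : K) : nat :=
  if pselect (exists n, (0 < n)%N && (absK (a ^+ n - 1) < 1)) is left h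
  then ex_minn h else 0%N.

End Closure.

(* The topology of an abstract numFieldType is the one given by its norm; C is
   meant to be R[i], on which no topology is declared directly. *)
Section ComplexAnalysis.
Variable C : numFieldType.

Definition series_cvg (a : nat -> C) : Prop := cvgn (series a).

Definition series_sum (a : nat -> C) : C := limn (series a).

Definition open_disk (rho : C) : set C := [set z | `|z| < rho].

Definition analytic_at (g : C -> C) (w : C) : Prop :=
  exists a : nat -> C,
    \forall z \near w, series (fun k => a k * (z - w) ^+ k) @ \oo --> g z.

Definition continues_to (rho : C) (f : C -> C) (w : C) : Prop :=
  exists U : set C, exists g : C -> C,
    [/\ open U, U w, forall u, U u -> analytic_at g u
      & forall z, U z -> open_disk rho z -> g z = f z].

Definition natural_boundary (rho : C) (f : C -> C) : Prop :=
  forall w, `|w| = rho -> ~ continues_to rho f w.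

(* f is algebraic over C(z): P(z, f z) = 0 on D for some nonzero P in C[z][X]. *)
Definition algebraic_on (D : set C) (f : C -> C) : Prop :=
  exists2 P : {poly {poly C}}, P != 0 & forall z, D z -> P.[(f z)%:P].[z] = 0.

Definition transcendental_on (D : set C) (f : C -> C) : Prop :=
  ~ algebraic_on D f.

End ComplexAnalysis.

Section ComplexFunctions.
Local Open Scope complex_scope.
Variable R : realType.

Definition expC (z : R[i]) : R[i] :=
  (expR (complex.Re z))%:C * (cos (complex.Im z) +i* sin (complex.Im z)).

Definition modC (z : R[i]) : R := complex.Re `|z|.

(* The principal argument, in ]-pi, pi]. *)
Definition argC (z : R[i]) : R :=
  let t := acos (complex.Re z / modC z) in if 0 <= complex.Im z then t else - t.

(* The principal branch of z ^ a, for a real exponent a and z != 0. *)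
Definition powC (z : R[i]) (a : R) : R[i] :=
  (modC z `^ a)%:C * (cos (a * argC z) +i* sin (a * argC z)).

End ComplexFunctions.

Section ArtinMazur.
Local Open Scope complex_scope.
Variables (T : topologicalType) (f : T -> T).

(* This is 0 if there are infinitely many isolated fixed points. *)
Definition num_isolated_fix (k : nat) : nat :=
  #|` fset_set (isolated [set x | iter k f x = x])|.

Variable R : realType.

(* Both series start at exponent 1: the term of index k has exponent k.+1. *)
Definition fix_term (z : R[i]) (k : nat) : R[i] :=
  (num_isolated_fix k.+1)%:R * z ^+ k.+1.

Definition zeta_term (z : R[i]) (k : nat) : R[i] :=
  (num_isolated_fix k.+1)%:R / k.+1%:R * z ^+ k.+1.

Definition fix_series (z : R[i]) : R[i] := series_sum (fix_term z).

Definition artin_mazur_zeta (z : R[i]) : R[i] := expC (series_sum (zeta_term z)).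

End ArtinMazur.

(* Main.v *)
(* N_k is |det(A^k - 1)|_F, the number of points of the finite group
   ker(A^k - 1), and it is 0 when this determinant vanishes, because the kernel
   then has no isolated point. Over the eigenvalues this gives N_k = r^k a_k with
   a_k the product of the factors |l^k - 1| with |l| = 1. By the Frobenius map
   such a factor is 1 if the order n of l does not divide k, and
   |l^n - 1|^(p^v) with v = v_p(k) otherwise; it is 0 in the latter case exactly
   when l is a root of unity.

   (a) If each n_j is a multiple of some m_i, then a_k is the product over i of
   1 - [m_i | k]; expanding it by inclusion-exclusion writes log zeta as a
   combination of the series of -log(1 - (r z)^L).

   (b) Let xi be a root of unity of order p^e, e >= 1. Up to a bounded error, the
   sum of the a_k Re(xi^k) over k <= n lies between -n/p^e and -kappa n for some
   kappa > 0: replacing v_p(k) by min(v_p(k), e - 1) gives a periodic sequence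
   whose period T satisfies xi^T <> 1, hence bounded twisted sums, and this only
   changes, and decreases, the terms with p^e | k, where xi^k = 1. By Abel
   summation, as s -> 1, the real part of the counting series at s xi / r tends to
   -oo, while |zeta(s xi / r)| tends to 0 but stays above c (1 - s)^(1/p^e).
   Since p^e >= 2, a function analytic at xi / r, being Lipschitz there, cannot do
   this, and such points are dense in the circle; letting e grow excludes any
   polynomial relation P(z, zeta(z)) = 0. *)

Require Import Defs.
From HB Require Import structures.
From mathcomp Require Import all_boot all_order all_algebra finmap.
From mathcomp Require Import all_classical all_reals all_analysis.
From mathcomp Require Import perm finfield polyXY complex zify ring lra.

Set Implicit Arguments.
Unset Strict Implicit.
Unset Printing Implicit Defensive.

Import Order.TTheory GRing.Theory Num.Theory numFieldNormedType.Exports.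

Local Open Scope classical_set_scope.
Local Open Scope ring_scope.

(** * Fixed points on the torus *)

(** The twist by xi isolates the effect of large v_p(k): the corrections to the periodic model sit
    where xi^k = 1, all with the same sign, so they cannot cancel. They are at most 1 in size and
    have density 1/p^e, whence -n/p^e. The constant kappa comes from a single arithmetic progression
    of indices k, divisible by p^e and by the exceptional n_j but by no m_i. Such k exist because
    every order is prime to p, so that multiplying n_j by p^e creates no divisor m_i.

    The weights s^k and s^k/k both decrease in k, so one estimate of the partial sums serves the
    counting series and log zeta alike.

    For transcendence, a relation of degree less than p^e in zeta would give |zeta|^h = O(1 - s) for
    some h < p^e along the radius; together with |zeta|^(p^e) >= c (1 - s) this keeps |zeta| away
    from 0, against zeta -> 0. The case h = 1 also excludes an analytic continuation of zeta. *)

Section LaurentDegree.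
Variable F : finFieldType.
Implicit Types (x y : laurent F) (p : {poly F}).

Lemma lcoefB x y i : lcoef (x - y) i = lcoef x i - lcoef y i.
Proof. by []. Qed.

Lemma lcoef0 i : lcoef (0 : laurent F) i = 0.
Proof. by []. Qed.

Lemma has_ldeg_uniq x m n : has_ldeg x m -> has_ldeg x n -> m = n.
Proof.
move=> [xm xm'] [xn xn']; apply/eqP; rewrite eq_le !leNgt; apply/andP; split.
  by apply/negP => /xn'/eqP; rewrite (negPf xm).
by apply/negP => /xm'/eqP; rewrite (negPf xn).
Qed.

Lemma has_ldegE x m : has_ldeg x m -> ldeg x = m.
Proof.
move=> xm; apply: (has_ldeg_uniq _ xm); apply: ldegP.
by apply/eqP => x0; case: xm; rewrite x0 lcoef0 eqxx.
Qed.

(** With [lcoef_absF_lt], translates the balls of rational radius in [laurent_open] into the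
    vanishing of coefficients. *)
Lemma absF_lt_lcoef x i (e : rat) : e <= #|F|%:R ^ i ->
  absF x < e -> forall j, i <= j -> lcoef x j = 0.
Proof.
move=> ei; rewrite /absF; case: eqP => [->//|/eqP x0 xe j ij].
have [_ ->//] := ldegP x0.
apply: lt_le_trans ij; rewrite ltNge; apply/negP => ix.
have := lt_le_trans xe ei; rewrite ltNge => /negP; apply.
by apply: ler_weXz2l => //; rewrite ler1n ltnW ?card_finNzRing_gt1.
Qed.

Lemma lcoef_absF_lt x i (e : rat) : 0 < e -> #|F|%:R ^ i < e ->
  (forall j, i < j -> lcoef x j = 0) -> absF x < e.
Proof.
move=> e0 ie xi; rewrite /absF; case: eqP => [//|/eqP x0].
apply: le_lt_trans ie; apply: ler_weXz2l; first by rewrite ler1n ltnW ?card_finNzRing_gt1.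
by rewrite leNgt; apply/negP => /xi/eqP; have [/negPf->] := ldegP x0.
Qed.

Lemma polyL_neg p n : lcoef (polyL p) (Negz n) = 0.
Proof. by []. Qed.

Lemma polyL_inj : injective (@polyL F).
Proof.
move=> p q /(congr1 (@lcoef F)) pq; apply/polyP => i.
by have := congr1 (fun f => f i%:Z) pq.
Qed.

Lemma polyL_eq0 p : (polyL p == 0) = (p == 0).
Proof. by rewrite -(inj_eq polyL_inj) rmorph0. Qed.

Lemma has_ldeg_polyL p : p != 0 -> has_ldeg (polyL p) (size p).-1%:Z.
Proof.
move=> p0; split=> [/=|]; first by rewrite -lead_coefE lead_coef_eq0.
move=> [i|i] //= ip; apply: nth_default; move: ip; rewrite ltz_nat.
by case: (size p) => [|k].
Qed.

Lemma ldeg_polyL p : p != 0 -> ldeg (polyL p) = (size p).-1%:Z.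
Proof. by move=> p0; apply/has_ldegE/has_ldeg_polyL. Qed.

Lemma absF_polyL (R : numFieldType) p :
  absF (polyL p) = (if p == 0 then 0%N else (#|F| ^ (size p).-1)%N)%:R :> R.
Proof.
rewrite /absF polyL_eq0; case: eqP => [//|/eqP p0].
by rewrite ldeg_polyL // natrX.
Qed.

Lemma polyL_of_lcoef x : (forall n, lcoef x (Negz n) = 0) -> exists p, x = polyL p.
Proof.
move=> xn; have := lcoefP x; rewrite unfold_in => /asboolP[m xm].
exists (\poly_(i < `|m|.+1) lcoef x i%:Z); apply: laurentP => -[i|i]; last exact: xn.
rewrite /= coef_poly; case: ltnP => // mi; apply: xm; lia.
Qed.

(** The element t^-n, which tends to 0; multiplication by it shifts degrees down by n. *)
Definition ltinv (n : nat) : laurent F := (polyL 'X ^+ n)^-1.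

Lemma polyLX_neq0 : polyL ('X : {poly F}) != 0.
Proof. by rewrite polyL_eq0 polyX_eq0. Qed.

Lemma lcoefXM (x : laurent F) i : lcoef (polyL 'X * x) i = lcoef x (i - 1).
Proof.
rewrite lcoefM (@fsbigE _ _ _ _ _ [:: 1%:Z]) //.
- by rewrite big_mkcond big_seq1 in_setT /= coefX mul1r.
- by move=> [[|[|n]]|n] _ //= _; rewrite ?coefX mul0r.
Qed.

Lemma lcoefXnM (x : laurent F) n i : lcoef (polyL 'X ^+ n * x) i = lcoef x (i - n%:Z).
Proof.
elim: n i => [|n ih] i; first by rewrite expr0 mul1r subr0.
by rewrite exprS -mulrA lcoefXM ih; congr lcoef; lia.
Qed.

Lemma lcoef_ltinvM (x : laurent F) n i : lcoef (ltinv n * x) i = lcoef x (i + n%:Z).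
Proof.
have h : polyL 'X ^+ n * (ltinv n * x) = x.
  by rewrite mulrA mulfV ?mul1r // expf_neq0 // polyLX_neq0.
by rewrite -{2}h lcoefXnM; congr lcoef; lia.
Qed.

End LaurentDegree.

Section TorusTopology.
Variable F : finFieldType.
Implicit Types (x : laurent F) (u v : torus F).

Lemma torus_eq0 x : to_torus x = 0 <-> exists p, x = polyL p.
Proof.
rewrite -[in X in X <-> _](of_torusK 0) to_torusP.
(* The chosen representative of 0 is only known to be a polynomial. *)
have [p hp] : exists p, of_torus (0 : torus F) = polyL p.
  have := (to_torusP (of_torus (0 : torus F)) 0).1; rewrite of_torusK subr0; apply.
  by apply: (addrI (to_torus 0)); rewrite -to_torusD !addr0.
rewrite hp; split=> -[q]; first by move/eqP; rewrite subr_eq -rmorphD => /eqP->; eexists.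
by move=> ->; exists (q - p); rewrite rmorphB.
Qed.

(* The topological and the group structure of the torus carry different eqType
   instances, hence Leibniz inequality here and has_card below. *)
Lemma torus_T1 u v : u <> v -> exists2 V, nbhs u V & ~ V v.
Proof.
move=> uv; exists [set w | w <> v]; last by [].
apply: (@open_nbhs_nbhs (torus F)); split=> //.
suff : laurent_open [set x : laurent F | to_torus x <> v] by [].
move=> x /= xv.
have [n xn] : exists n, lcoef (x - of_torus v) (Negz n) != 0.
  apply: contrapT => /forallNP h; apply: xv.
  rewrite -(of_torusK v); apply/to_torusP; apply: polyL_of_lcoef => n.
  by apply/eqP; apply: contrapT => /negP; exact: h.
(* In this ball the coefficient of degree [Negz n] does not move, so the difference with
   [of_torus v] never becomes a polynomial. *)
exists (#|F|%:R ^ Negz n) => [|y xy].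
  by rewrite exprz_gt0 // ltr0n ltnW ?card_finNzRing_gt1.
move=> yv; move/negP: xn; apply; apply/eqP.
have [p hp] : exists p, y - of_torus v = polyL p.
  by apply/to_torusP; rewrite of_torusK.
have /(_ _ (lexx _)) := absF_lt_lcoef (lexx _) xy.
have -> : x - of_torus v = polyL p - (y - x) by rewrite -hp; ring.
by rewrite lcoefB polyL_neg => ->; rewrite subr0.
Qed.

(** A finite set in a T1 space is discrete: intersect the neighbourhoods of [x] that avoid the other
    points, each obtained from a coordinate where the two columns differ. *)
Lemma finite_isolated d (P : set 'cV[torus F]_d) : finite_set P -> isolated P = P.
Proof.
move=> /finite_fsetP[X PX]; apply/seteqP; split=> [|x Px]; first exact: isolatedS.
have sep (y : 'cV[torus F]_d) : exists V, nbhs x V /\ (x <> y -> ~ V y).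
  have [->|xy] := pselect (x = y); first by exists setT; split=> //; exact: filterT.
  have [i xyi] : exists i, x i 0 <> y i 0.
    apply: contrapT => /forallNP h; apply: xy; apply/matrixP => i j.
    by rewrite ord1; exact: contrapT (h i).
  have [V xV yV] := torus_T1 xyi.
  exists [set z : 'cV[torus F]_d | V (z i 0)]; split=> //.
  exists (fun i' j => if (i' == i) then V else setT) => [i' j|z /(_ i 0)].
    by rewrite ord1; case: eqP => [->//|_]; exact: filterT.
  by rewrite eqxx.
have [W hW] := choice sep.
split; first exact/mem_set.
exists (\bigcap_(y in P) W y).
  by rewrite PX; apply: filter_bigI => y _; have [] := hW y.
apply/seteqP; split=> [z [Wz Pz]|z ->] /=; last first.
  by split=> // y _; have [/nbhs_singleton] := hW y.
apply: contrapT => zx; have [_] := hW z; apply; first by move/esym.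
exact: Wz.
Qed.

End TorusTopology.

Section ColumnReduction.
Variable F : fieldType.

(** Euclid's algorithm on the first column, by induction on the total size of its entries. As long
    as two entries are nonzero, one can be replaced by its remainder modulo the other; a last
    nonzero entry is moved to row 0 by a transposition. *)
Lemma col_reduction n (B : 'M[{poly F}]_n.+1) :
  exists2 U, U \in unitmx & forall i, i != 0 -> (U *m B) i 0 = 0.
Proof.
have [s] := ubnP (\sum_(i < n.+1) size (B i 0%R))%N; elim: s B => // s ih B Bs.
have [[i [j [ij Bi Bj ltij]]]|h] := pselect (exists i j,
    [/\ i != j, B i 0 != 0, B j 0 != 0 & (size (B i 0%R) <= size (B j 0%R))%N]).
  pose q := B j 0 %/ B i 0; pose E := 1%:M - q *: delta_mx j i : 'M[{poly F}]_n.+1.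
  have EU : E \in unitmx.
    have /mulmx1_unit[]// : E *m (1%:M + q *: delta_mx j i) = 1%:M.
    rewrite mulmxBl mul1mx mulmxDr mulmx1 -scalemxAl -scalemxAr.
    by rewrite mul_delta_mx_cond (negPf ij) mulr0n !scaler0 addr0 addrK.
  have EB k : (E *m B) k 0 = if k == j then B j 0 %% B i 0 else B k 0.
    rewrite mulmxBl mul1mx -scalemxAl mxE [X in _ + X]mxE [X in _ - X]mxE.
    rewrite mxE (bigD1 i) //= big1 => [|l li]; last first.
      by rewrite mxE (negPf li) andbF mul0r.
    rewrite mxE eqxx andbT addr0.
    case: eqP => [->|_]; last by rewrite mul0r mulr0 subr0.
    by rewrite mul1r {1}(divp_eq (B j 0) (B i 0)) addrC addKr.
  have [|U UU UB] := ih (E *m B); last first.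
    by exists (U *m E) => [|k]; rewrite ?unitmx_mul ?UU // -mulmxA; exact: UB.
  move: Bs; rewrite ltnS; apply: leq_trans.
  rewrite (bigD1 j) //= [X in (_ < X)%N](bigD1 j) //= EB eqxx -addSn leq_add //.
    by apply: leq_trans ltij; rewrite ltn_modp.
  by apply: leq_sum => k /negPf kj; rewrite EB kj.
have [[i Bi]|h0] := pselect (exists i, B i 0 != 0); last first.
  exists 1%:M => [|i _]; rewrite ?unitmx1 // mul1mx.
  by apply: contrapT => /eqP Bi; apply: h0; exists i.
exists (tperm_mx i 0) => [|j j0]; first exact: unitmx_perm.
rewrite -[tperm_mx i 0 *m B]/(perm_mx _ *m B) -row_permE mxE.
apply: contrapT => /eqP Bj; apply: h.
have ji : tperm i 0 j != i.
  by rewrite -{2}(tpermR i 0) (inj_eq perm_inj).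
case: (leqP (size (B i 0%R)) (size (B (tperm i 0 j) 0%R))) => [h|/ltnW h].
  by exists i, (tperm i 0 j); rewrite eq_sym.
by exists (tperm i 0 j), i.
Qed.

End ColumnReduction.

Section TorusKernel.
Variable F : finFieldType.

Lemma torus_mulmxA d (A B : 'M[{poly F}]_d) (u : 'cV_d) :
  torus_mulmx (A *m B) u = torus_mulmx A (torus_mulmx B u).
Proof.
apply/matrixP => i k; rewrite !mxE.
under eq_bigr do rewrite mxE scaler_suml.
rewrite exchange_big /=; apply: eq_bigr => j _; rewrite mxE scaler_sumr.
by apply: eq_bigr => l _; rewrite scalerA.
Qed.

Lemma torus_mulmx1 d (u : 'cV_d) : torus_mulmx (1%:M : 'M[{poly F}]_d) u = u.
Proof.
apply/matrixP => i k; rewrite !mxE (bigD1 i) //= big1 => [|j ji].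
  by rewrite mxE eqxx scale1r addr0 ord1.
by rewrite mxE eq_sym (negPf ji) scale0r.
Qed.

Lemma torus_mulmxBl d (A B : 'M[{poly F}]_d) (u : 'cV_d) :
  torus_mulmx (A - B) u = torus_mulmx A u - torus_mulmx B u.
Proof.
apply/matrixP => i k; rewrite !mxE -sumrB; apply: eq_bigr => j _.
by rewrite !mxE scalerBl.
Qed.

Lemma torus_mulmx0 d (A : 'M[{poly F}]_d) : torus_mulmx A 0 = 0.
Proof.
apply/matrixP => i k; rewrite !mxE big1 // => j _.
by rewrite mxE scaler0.
Qed.

Lemma torus_mulmx_to d (A : 'M[{poly F}]_d) (w : 'cV[laurent F]_d) :
  torus_mulmx A (map_mx (@to_torus F) w) =
  map_mx (@to_torus F) (map_mx (@polyL F) A *m w).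
Proof.
apply/matrixP => i k; rewrite !mxE.
rewrite (big_morph (@to_torus F) (@to_torusD F) ((torus_eq0 0).2 _)); last first.
  by exists 0; rewrite rmorph0.
by apply: eq_bigr => j _; rewrite !mxE ord1 [LHS]torus_scale_to.
Qed.

Lemma iter_torus_mulmx d (A : 'M[{poly F}]_d) k (u : 'cV_d) :
  iter k (torus_mulmx A) u = torus_mulmx (A ^+ k) u.
Proof.
elim: k => [|k ih]; first by rewrite torus_mulmx1.
by rewrite iterS ih -torus_mulmxA exprS.
Qed.

Lemma torus_mulmx_unit d (U B : 'M[{poly F}]_d) (u : 'cV_d) : U \in unitmx ->
  torus_mulmx (U *m B) u = 0 <-> torus_mulmx B u = 0.
Proof.
move=> UU; rewrite torus_mulmxA; split=> [h|->]; last exact: torus_mulmx0.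
by rewrite -[LHS]torus_mulmx1 -(mulVmx UU) torus_mulmxA h torus_mulmx0.
Qed.

Lemma torus_divisible (p : {poly F}) (u : torus F) : p != 0 -> exists v, p *: v = u.
Proof.
move=> p0; exists (to_torus (of_torus u / polyL p)).
rewrite [LHS]torus_scale_to mulrCA mulfV ?polyL_eq0 // mulr1.
exact: of_torusK.
Qed.

Definition has_card (T : eqType) (P : set T) (n : nat) :=
  exists s : seq T, [/\ uniq s, size s = n & forall x, P x <-> x \in s].

(** The kernel is F[t]/p modulo F[t], with one representative v/p for each v of degree less than
    that of p. *)
Lemma torus_scalar_kernel (p : {poly F}) : p != 0 ->
  has_card [set u : torus F | p *: u = 0] (#|F| ^ (size p).-1)%N.
Proof.
move=> p0; pose e (v : 'rV[F]_(size p).-1) := to_torus (polyL (rVpoly v) / polyL p).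
have pL : polyL p != 0 by rewrite polyL_eq0.
exists [seq e v | v : 'rV[F]_(size p).-1]; split.
- rewrite map_inj_uniq ?enum_uniq // => v w /to_torusP[q].
  rewrite -mulrBl -rmorphB => /(canRL (divfK pL)); rewrite -rmorphM => /polyL_inj.
  move=> h; apply: (can_inj (@rVpolyK _ _)); apply/eqP; rewrite -subr_eq0 h.
  have [->|q0] := eqVneq q 0; first by rewrite mul0r.
  have : (size (rVpoly v - rVpoly w)%R <= (size p).-1)%N.
    rewrite (leq_trans (size_polyD _ _)) // geq_max size_polyN.
    by rewrite !size_poly.
  rewrite h size_mul // leqNgt => /negP; case.
  have : (0 < size p)%N by rewrite size_poly_gt0.
  have : (0 < size q)%N by rewrite size_poly_gt0.
  by case: (size q) (size p) => // k [|l] // _ _; rewrite addSn addnS /= ltnS leq_addl.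
- by rewrite size_map -cardE card_mx mul1n.
move=> u; split=> [pu|/mapP[v _ ->]] /=; last first.
  rewrite [LHS]torus_scale_to mulrCA mulfV // mulr1.
  by apply/torus_eq0; exists (rVpoly v).
have [q hq] : exists q, polyL p * of_torus u = polyL q.
  by apply/torus_eq0; rewrite -torus_scale_to of_torusK.
apply/mapP; exists (poly_rV (q %% p)); first by rewrite mem_enum.
rewrite /e poly_rV_K; last first.
  by have := ltn_modp q p; rewrite p0; case: (size p).
rewrite -[LHS]of_torusK; apply/to_torusP; exists (q %/ p).
apply: (mulIf pL); rewrite mulrBl divfK // -rmorphM mulrC hq -rmorphB.
by rewrite {1}(divp_eq q p) addrK.
Qed.

(* After column reduction B is block triangular with corner b, and b acts
   surjectively on the torus, so the count is multiplicative. *)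
Lemma torus_kernel_card d (B : 'M[{poly F}]_d) : \det B != 0 ->
  has_card [set u | torus_mulmx B u = 0] (#|F| ^ (size (\det B)).-1)%N.
Proof.
elim: d B => [|d ih] B.
  rewrite det_mx00 size_poly1 => _; exists [:: 0]; split=> // x; split=> _.
    by rewrite inE; apply/eqP/matrixP => -[].
  by apply/matrixP => -[].
have [U UU UB] := col_reduction B.
(* The determinant of [U] is a nonzero constant, so passing to [U *m B] changes neither the kernel
   nor the degree. *)
suff h : \det (U *m B) != 0 -> has_card [set u | torus_mulmx (U *m B) u = 0]
    (#|F| ^ (size (\det (U *m B))).-1)%N.
  move=> B0; have dU : \det U \is a GRing.unit by rewrite -unitmxE.
  have dU0 : \det U != 0 by apply: contraTneq dU => ->; rewrite unitr0.
  have [|s [us ss sP]] := h; first by rewrite det_mulmx mulf_neq0.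
  exists s; split=> // [|x]; last by rewrite -sP /= torus_mulmx_unit.
  rewrite ss det_mulmx size_mul //.
  by move: dU; rewrite poly_unitE => /andP[/eqP-> _].
move: (U *m B) UB => {}B UB {U UU}; move: B UB.
rewrite -[d.+1]/(1 + d)%N => B UB B0.
pose b := B 0 0; pose c := ursubmx B; pose B' := drsubmx B.
have dB : \det B = b * \det B'.
  rewrite -[B]submxK (_ : dlsubmx B = 0) ?det_ublock; last first.
    apply/matrixP => i j; rewrite !mxE ord1 -[RHS](UB (rshift 1 i)) //.
    by congr (B _ _); apply/val_inj.
  by rewrite det_mx11 !mxE; congr (B _ _ * _); apply/val_inj.
move: B0; rewrite dB mulf_eq0 negb_or => /andP[b0 B'0].
have [s1 [us1 ss1 s1P]] := torus_scalar_kernel b0.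
have [s2 [us2 ss2 s2P]] := ih _ B'0.
(* [g w] is a particular solution of the first equation for a given [w], so (u0, w) |-> (u0 + g w,
   w) maps ker b x ker B' onto ker B. *)
have [g hg] : exists g : 'cV[torus F]_d -> torus F,
    forall w, b *: g w = - \sum_j c 0 j *: w j 0.
  exists (fun w => xget 0 [set v | b *: v = - \sum_j c 0 j *: w j 0]) => w.
  apply: (@xgetPex _ 0 [set v | b *: v = - \sum_j c 0 j *: w j 0]).
  exact: torus_divisible.
have l00 : lshift d (0 : 'I_1) = 0 :> 'I_(1 + d) by exact/val_inj.
have kerE u0 w : torus_mulmx B (col_mx (const_mx u0) w) = 0 <->
    b *: u0 + \sum_j c 0 j *: w j 0 = 0 /\ torus_mulmx B' w = 0.
  have lE (i : 'I_(1 + d)) : torus_mulmx B (col_mx (const_mx u0) w) i 0 =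
      B i 0 *: u0 + \sum_j B i (rshift 1 j) *: w j 0.
    rewrite mxE big_split_ord big_ord1 /= col_mxEu mxE.
    rewrite l00.
    by congr (_ + _); apply: eq_bigr => j _; rewrite col_mxEd.
  have l0 : torus_mulmx B (col_mx (const_mx u0) w) 0 0 =
      b *: u0 + \sum_j c 0 j *: w j 0.
    rewrite lE; congr (_ + _); apply: eq_bigr => j _; rewrite !mxE.
    by rewrite l00.
  have lS i : torus_mulmx B (col_mx (const_mx u0) w) (rshift 1 i) 0 =
      torus_mulmx B' w i 0.
    rewrite lE UB // scale0r add0r mxE.
    by apply: eq_bigr => j _; rewrite !mxE.
  split=> [h|[h1 h2]].
    split; first by rewrite -l0 h mxE.
    by apply/matrixP => i k; rewrite ord1 -lS h !mxE.
  apply/matrixP => i k; rewrite ord1 [RHS]mxE.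
  case: (splitP i) => j ij; last by rewrite (_ : i = rshift 1 j) ?lS ?h2 ?mxE //; exact/val_inj.
  by rewrite (_ : i = 0) ?l0 //; apply/val_inj; rewrite /= ij ord1.
exists [seq col_mx (const_mx (u0 + g w)) w | u0 <- s1, w <- s2]; split.
- apply: allpairs_uniq => // -[u0 w] [u1 w'] _ _ /= /eq_col_mx[h ww].
  move: h; rewrite ww => /matrixP/(_ 0 0); rewrite !mxE => /addIr->.
  done.
- rewrite size_allpairs ss1 ss2 -expnD size_mul //; congr (_ ^ _)%N.
  have : (0 < size b)%N by rewrite size_poly_gt0.
  have : (0 < size (\det B'))%N by rewrite size_poly_gt0.
  by case: (size b) (size (\det B')) => // k [|l] // _ _; rewrite addSn addnS.
move=> x; split=> /=.
  have uE : usubmx x = const_mx (usubmx x 0 0).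
    by apply/matrixP => i j; rewrite [RHS]mxE !ord1.
  rewrite -[x]vsubmxK uE; move: (usubmx x 0 0) (dsubmx x) => u0 w.
  move=> /kerE[h1 h2]; apply/allpairsP; exists (u0 - g w, w); split=> /=.
  + by apply/s1P; rewrite /= scalerBr hg opprK.
  + exact/s2P.
  + by rewrite subrK.
move=> /allpairsP[[u0 w] /= [/s1P/= h1 /s2P/= h2 ->]]; apply/kerE; split=> //.
by rewrite scalerDr h1 hg add0r addNr.
Qed.

End TorusKernel.

Lemma exprzN_small (q : nat) (e : rat) : (1 < q)%N -> 0 < e ->
  exists n : nat, q%:R ^ (- n%:Z) < e.
Proof.
move=> q1 e0; have e0' : 0 <= e^-1 by rewrite invr_ge0 ltW.
exists (Num.bound e^-1); rewrite -exprz_inv -exprnP exprVn -[e]invrK ltf_pV2 ?invrK.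
- apply: lt_le_trans (archi_boundP e0') _.
  by rewrite -natrX ler_nat ltnW // ltn_expl.
- by rewrite posrE exprn_gt0 // ltr0n ltnW.
- by rewrite posrE invr_gt0.
Qed.

Lemma has_card_eq (T : choiceType) (P : set T) n : has_card P n -> (P #= `I_n)%card.
Proof.
move=> [s [us ss sP]].
have finP : finite_set P.
  by apply/finite_seqP; exists s; apply/seteqP; split=> x /sP.
have /finite_setP[m Pm] := finP; suff -> : n = m by [].
rewrite -(card_fset_set Pm) -ss.
suff -> : fset_set P = [fset x in s]%fset by rewrite card_fseq undup_id.
by apply/fsetP => x; rewrite in_fset_set // !inE; apply/idP/idP => [/set_mem/sP//|/sP/mem_set].
Qed.

Section FixedPoints.
Variable F : finFieldType.

(* If B v = 0 with v <> 0, the points t^-n v lie in the kernel and tend to 0. *)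
Lemma singular_no_isolated d (B : 'M[{poly F}]_d) : \det B = 0 ->
  isolated [set u : 'cV[torus F]_d | torus_mulmx B u = 0] = set0.
Proof.
move=> B0.
have [v v0 vB] : exists2 v : 'cV[laurent F]_d, v != 0 & map_mx (@polyL F) B *m v = 0.
  have /eqP/det0P[w w0 wB] : \det (map_mx (@polyL F) B)^T = 0.
    by rewrite det_tr det_map_mx B0 rmorph0.
  exists w^T; first by rewrite -(inj_eq trmx_inj) trmxK trmx0.
  by apply: trmx_inj; rewrite trmx_mul trmxK wB trmx0.
have [i vi] : exists i, v i 0 != 0.
  apply: contrapT => /forallNP h; move/negP: v0; apply; apply/eqP/matrixP => i j.
  by rewrite ord1 mxE; apply/eqP/negPn/negP; exact: h.
have [M hM] : exists M : nat, forall i j, M%:Z <= j -> lcoef (v i 0) j = 0.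
  have h l : exists m : nat, forall j, m%:Z <= j -> lcoef (v l 0) j = 0.
    have := lcoefP (v l 0); rewrite unfold_in => /asboolP[m hm].
    by exists `|m|.+1 => j mj; apply: hm; lia.
  have [m hm] := choice h.
  exists (\max_l m l)%N => l j; rewrite -[(_ <= j)]/(_%:Z <= j) => mj; apply: hm.
  by apply: le_trans mj; rewrite lez_nat; exact: leq_bigmax.
apply/seteqP; split=> // x [/set_mem xB [V xV]].
pose x' := map_mx (@of_torus F) x.
have xx' : x = map_mx (@to_torus F) x'.
  by apply/matrixP => l j; rewrite !mxE of_torusK.
have [W hW WV] := xV.
have [e e0 he] : exists2 e : rat, 0 < e &
    forall l (y : laurent F), absF (y - x' l 0) < e -> W l 0 (to_torus y).
  have h l : exists e : rat, 0 < e /\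
      forall y : laurent F, absF (y - x' l 0) < e -> W l 0 (to_torus y).
    have := @to_torus_continuous F (x' l 0) (W l 0).
    rewrite /x' mxE of_torusK => /(_ (hW l 0)).
    rewrite nbhsE => -[U [oU Ux] UW].
    have [e e0 eU] := (oU : laurent_open U) _ Ux.
    by exists e; split=> // y /eU/UW.
  have [e he] := choice h.
  exists (\big[Num.min/1]_l e l); first by apply: lt_bigmin => // l _; have [] := he l.
  move=> l y yx; have [_] := he l; apply.
  by apply: lt_le_trans yx _; exact: bigmin_le.
(* The entries of t^-n v then have degree below -N, hence absolute value below [e]. *)
have [N qN] := exprzN_small (card_finNzRing_gt1 F) e0; pose n := (M + N)%N.
pose y := map_mx (@to_torus F) (x' + ltinv F n *: v).
have lc l j : - N%:Z <= j -> lcoef ((ltinv F n *: v) l 0) j = 0.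
  by move=> lj; rewrite mxE lcoef_ltinvM hM // /n; lia.
have yV : V y.
  apply: WV => l j; rewrite ord1 mxE; apply: he.
  rewrite mxE [x' l 0 + _]addrC addrK.
  apply: (@lcoef_absF_lt _ _ (- N%:Z)) => // k /ltW; exact: lc.
have yB : torus_mulmx B y = 0.
  rewrite torus_mulmx_to mulmxDr -scalemxAr vB scaler0 addr0 -torus_mulmx_to -xx'.
  exact: xB.
move=> VB; have yx : y = x by have : [set x] y by rewrite -VB.
have /to_torusP[p] : to_torus ((x' + ltinv F n *: v) i 0) = to_torus (x' i 0).
  transitivity (y i 0); first by rewrite [RHS]mxE.
  by rewrite yx [in LHS]xx' mxE.
rewrite [(x' + _) i 0]mxE [x' i 0 + _]addrC addrK => hp.
(* An entry of t^-n v that is a polynomial has only negative degrees, so it is 0. *)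
move/negP: vi; apply; suff : (ltinv F n *: v) i 0 == 0.
  by rewrite mxE mulf_eq0 invr_eq0 expf_eq0 (negPf (polyLX_neq0 _)) andbF.
apply/eqP/laurentP => -[k|k]; last by rewrite hp.
by apply: lc; lia.
Qed.

Lemma num_isolated_fixE (R : numFieldType) d (A : 'M[{poly F}]_d) k :
  (num_isolated_fix (torus_mulmx A) k)%:R = absF (polyL (\det (A ^+ k - 1))) :> R.
Proof.
rewrite absF_polyL; congr _%:R; rewrite /num_isolated_fix.
have -> : [set x | iter k (torus_mulmx A) x = x] =
    [set u : 'cV[torus F]_d | torus_mulmx (A ^+ k - 1) u = 0].
  apply/seteqP; split=> x /=; rewrite iter_torus_mulmx torus_mulmxBl torus_mulmx1.
    by move=> ->; rewrite subrr.
  by move/eqP; rewrite subr_eq0 => /eqP.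
case: eqP => [d0|/eqP d0].
  by rewrite singular_no_isolated // fset_set0 cardfs0.
have /has_card_eq h := torus_kernel_card d0.
rewrite finite_isolated; first exact: card_fset_set.
by apply/finite_setP; eexists; exact: h.
Qed.

End FixedPoints.

Lemma expr_unbounded (R : realType) (x B : R) : 1 < x -> exists n, B < x ^+ n.
Proof.
move=> x1; have x10 : 0 < x - 1 by rewrite subr_gt0.
have [B0|B0] := leP B 0; first by exists 0; rewrite expr0 (le_lt_trans B0).
have h n : 1 + n%:R * (x - 1) <= x ^+ n.
  elim: n => [|n ih]; first by rewrite mul0r addr0 expr0.
  rewrite exprS; have : x * (1 + n%:R * (x - 1)) <= x * x ^+ n.
    by rewrite ler_wpM2l // ltW // (lt_trans _ x1).
  apply: le_trans; rewrite -natr1.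
  have n0 : (0 : R) <= n%:R by [].
  have : 0 <= n%:R * (x - 1) * (x - 1) by rewrite !mulr_ge0 // ltW.
  lra.
exists (Num.bound (B / (x - 1))); apply: lt_le_trans (h _).
have /archi_boundP : 0 <= B / (x - 1) by rewrite divr_ge0 // ltW.
by rewrite ltr_pdivrMr // => /lt_trans; apply; rewrite ltrDr.
Qed.

(** * The absolute value of K and orders modulo p *)

Section Valuation.
Variables (R : realType) (F : finFieldType) (K : closedFieldType).
Variables (iota : {rmorphism laurent F -> K}) (absK : K -> R).
Hypothesis absK_av : is_absolute_value absK.
Hypothesis absK_extends : forall x : laurent F, absK (iota x) = absF x.

Let phi : {rmorphism F -> K} := iota \o @polyL F \o polyC.

Lemma absK_ge0 a : 0 <= absK a. Proof. by have [] := absK_av. Qed.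

Lemma absKM : {morph absK : a b / a * b >-> a * b}.
Proof. by have [] := absK_av. Qed.

Lemma absK_eq0 a : (absK a == 0) = (a == 0).
Proof. by apply/eqP/eqP; have [_ h _ _] := absK_av; apply h. Qed.

Lemma absK0 : absK 0 = 0.
Proof. by apply/eqP; rewrite absK_eq0. Qed.

Lemma absK1 : absK 1 = 1.
Proof.
have h : absK 1 != 0 by rewrite absK_eq0 oner_eq0.
by apply: (mulfI h); rewrite -absKM !mulr1.
Qed.

Lemma absKX a n : absK (a ^+ n) = absK a ^+ n.
Proof. by elim: n => [|n ih]; rewrite ?absK1 // !exprS absKM ih. Qed.

Lemma absKV a : absK a^-1 = (absK a)^-1.
Proof.
have [->|a0] := eqVneq a 0; first by rewrite invr0 absK0 invr0.
have a0' : absK a != 0 by rewrite absK_eq0.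
by apply: (mulfI a0'); rewrite -absKM !mulfV ?absK1.
Qed.

Lemma absKN a : absK (- a) = absK a.
Proof.
rewrite -mulN1r absKM; suff -> : absK (- 1) = 1 by rewrite mul1r.
apply/eqP; rewrite -(@eqrXn2 _ 2) ?absK_ge0 ?ler01 //.
by rewrite -absKX sqrrN !expr1n absK1.
Qed.

Lemma absK_distC a b : absK (a - b) = absK (b - a).
Proof. by rewrite -absKN opprB. Qed.

Lemma absK_prod (I : Type) (s : seq I) (P : pred I) (g : I -> K) :
  absK (\prod_(i <- s | P i) g i) = \prod_(i <- s | P i) absK (g i).
Proof. exact: (big_morph _ absKM absK1). Qed.

Lemma pcharK : {p | prime p & p \in [pchar K]}.
Proof.
have [p pp pF] := finPcharP F; exists p => //.
exact: (rmorph_pchar phi).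
Qed.

(* The Frobenius trick: |a + b|^(p^n) = |a^(p^n) + b^(p^n)| is at most twice the
   maximum of |a|^(p^n) and |b|^(p^n), for every n. *)
Lemma absK_ultra a b : absK (a + b) <= Num.max (absK a) (absK b).
Proof.
set m := Num.max _ _; rewrite leNgt; apply/negP => mab.
have m0 : 0 <= m by rewrite le_max absK_ge0.
have [p pp pK] := pcharK.
have h n : absK (a + b) ^+ (p ^ n) <= 2 * m ^+ (p ^ n).
  rewrite -absKX (exprDn_pchar _ _ (n := (p ^ n)%N)); last first.
    by rewrite (eq_pnat _ (pcharf_eq pK)) pnatX pnat_id.
  have [_ _ _ tri] := absK_av; apply: (le_trans (tri _ _)).
  rewrite mulrDl !mul1r !absKX; apply: lerD; apply: lerXn2r;
    rewrite ?nnegrE ?absK_ge0 // le_max lexx ?orbT //.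
have {m0}[m0|m0] := ltP 0 m; last first.
  have m00 : m = 0 by apply/eqP; rewrite eq_le m0 le_max absK_ge0.
  by move: (h 0%N) mab; rewrite m00 expn0 !expr1 mulr0 leNgt => /negP.
have x1 : 1 < absK (a + b) / m by rewrite ltr_pdivlMr // mul1r.
have [n] := expr_unbounded 2 x1; rewrite ltNge => /negP; apply.
apply: (@le_trans _ _ ((absK (a + b) / m) ^+ (p ^ n))).
  apply: ler_weXn2l; first exact: ltW.
  by rewrite ltnW // ltn_expl // prime_gt1.
by rewrite expr_div_n ler_pdivrMr ?exprn_gt0.
Qed.

Lemma absK_sum_lt1 (I : Type) (s : seq I) (P : pred I) (g : I -> K) :
  (forall i, P i -> absK (g i) < 1) -> absK (\sum_(i <- s | P i) g i) < 1.
Proof.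
move=> h; elim/big_ind: _ => //; first by rewrite absK0 ltr01.
by move=> x y x1 y1; apply: le_lt_trans (absK_ultra _ _) _; rewrite gt_max x1.
Qed.

Lemma absK_sum_le1 (I : Type) (s : seq I) (P : pred I) (g : I -> K) :
  (forall i, P i -> absK (g i) <= 1) -> absK (\sum_(i <- s | P i) g i) <= 1.
Proof.
move=> h; elim/big_ind: _ => //; first by rewrite absK0 ler01.
by move=> x y x1 y1; apply: le_trans (absK_ultra _ _) _; rewrite ge_max x1.
Qed.

Lemma absK_add1 a b : absK a < 1 -> absK b = 1 -> absK (a + b) = 1.
Proof.
move=> a1 b1; apply/eqP; rewrite eq_le; apply/andP; split.
  by apply: le_trans (absK_ultra _ _) _; rewrite ge_max ltW //= b1.
have := absK_ultra (a + b) (- a); rewrite addrAC subrr add0r b1 absKN le_max.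
by rewrite [_ <= absK a]leNgt a1 orbF.
Qed.

Lemma absK_phi c : absK (phi c) = (c != 0)%:R.
Proof.
rewrite absK_extends absF_polyL polyC_eq0; case: eqVneq => //= c0.
by rewrite size_polyC c0 expn0.
Qed.

Lemma absK_nat p u : p \in [pchar K] -> ~~ (p %| u)%N -> absK u%:R = 1.
Proof.
move=> pK pu; have pF : p \in [pchar F] by rewrite -(fmorph_pchar phi).
by rewrite -(rmorph_nat phi) absK_phi -(dvdn_pcharf pF) pu.
Qed.

(** The residue field of F((1/t)) is F, the residue being the coefficient of degree 0. *)
Lemma absF_lead (c : laurent F) : absF c <= 1 :> R ->
  absF (c - polyL (lcoef c 0)%:P) < 1 :> R.
Proof.
have q1 : 1 < #|F|%:R :> R by rewrite ltr1n card_finNzRing_gt1.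
move=> c1; have cj j : 0 < j -> lcoef c j = 0.
  move=> j0; have [->|c0] := eqVneq c 0; first by [].
  have [_ ->//] := ldegP c0; apply: le_lt_trans j0; rewrite leNgt; apply/negP => d0.
  move: c1; rewrite /absF (negPf c0) leNgt => /negP; apply.
  by rewrite -(expr0z (#|F|%:R : R)) ltr_eXz2l.
rewrite {1}/absF; case: eqVneq => // e0.
rewrite -[X in _ < X](expr0z (#|F|%:R : R)) ltr_eXz2l // ltNge; apply/negP.
have [h _] := ldegP e0; rewrite le_eqVlt => /orP[/eqP d0|d0].
  by move: h; rewrite -d0 lcoefB /= coefC eqxx subrr eqxx.
move: h; rewrite lcoefB cj //=; case: (ldeg _) d0 => // -[|n] // _.
by rewrite /= coefC /= subrr eqxx.
Qed.

(* The residue field of K is algebraic over F: divide an equation for a by its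
   coefficient of largest absolute value and reduce. *)
Lemma algebraic_residue a : algebraicOver iota a -> absK a = 1 ->
  exists2 h : {poly F}, h != 0 & absK (map_poly phi h).[a] < 1.
Proof.
move=> [P P0 rPa] a1.
have sP : (0 < size P)%N by rewrite size_poly_gt0.
have [i0 i0P] : exists i0 : 'I_(size P), forall i : 'I_(size P),
    absK (iota P`_i) <= absK (iota P`_i0).
  pose j0 := Ordinal sP.
  pose g (i : 'I_(size P)) := absK (iota P`_i).
  case: (@Order.TotalTheory.arg_maxP _ _ _ j0 predT g) => // i _ hi.
  by exists i => j; exact: hi.
have y0 : P`_i0 != 0.
  apply: contraTneq P0 => y0; rewrite negbK -lead_coef_eq0 lead_coefE.
  have lP : ((size P).-1 < size P)%N by rewrite prednK.
  have := i0P (Ordinal lP); rewrite y0 !absK_extends {2}/absF eqxx => h.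
  rewrite -(fmorph_eq0 iota) -absK_eq0 absK_extends eq_le h.
  by rewrite -absK_extends absK_ge0.
pose c i := P`_i / P`_i0.
have c1 i : absF (c i) <= 1 :> R.
  rewrite -absK_extends rmorphM fmorphV absKM.
  have [iP|Pi] := ltnP i (size P); last by rewrite nth_default // rmorph0 absK0 mul0r ler01.
  have y1 : 0 < absK (iota P`_i0).
    by rewrite lt_neqAle absK_ge0 eq_sym absK_eq0 fmorph_eq0 y0.
  by rewrite absKV ler_pdivrMr // mul1r; exact: (i0P (Ordinal iP)).
pose h := \poly_(i < size P) lcoef (c i) 0.
exists h.
  apply/eqP => /(congr1 (fun q : {poly F} => q`_i0)); rewrite coef0 coef_poly ltn_ord.
  by rewrite /c divff //= => /eqP; rewrite oner_eq0.
have sum0 : \sum_(i < size P) iota (c i) * a ^+ i = 0.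
  have : \sum_(i < size P) iota P`_i * a ^+ i = 0.
    move/rootP: rPa; rewrite (@horner_coef_wide _ (size P)) ?size_map_poly //.
    by move=> {2}<-; apply: eq_bigr => i _; rewrite coef_map.
  move/(congr1 (fun z => (iota P`_i0)^-1 * z)); rewrite mulr0 mulr_sumr => {2}<-.
  by apply: eq_bigr => i _; rewrite /c rmorphM fmorphV mulrA [_^-1 * _]mulrC.
rewrite (@horner_coef_wide _ (size P)); last first.
  by rewrite size_map_poly size_poly.
rewrite -[X in absK X]subr0 -[X in _ - X]sum0 -sumrB; apply: absK_sum_lt1 => i _.
rewrite -mulrBl absKM absKX a1 expr1n mulr1 coef_map coef_poly ltn_ord.
rewrite absK_distC.
have -> : iota (c i) - phi (lcoef (c i) 0) = iota (c i - polyL (lcoef (c i) 0)%:P).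
  by rewrite rmorphB.
by rewrite absK_extends absF_lead.
Qed.

Let order := order_mod absK.

(** Pigeonhole: there are finitely many remainders modulo the [h] of [algebraic_residue], so [h]
    divides X^j - X^i for some i < j, and |a| = 1 allows a^i to be cancelled. *)
Lemma order_mod_ex a : algebraicOver iota a -> absK a = 1 ->
  exists n, (0 < n)%N && (absK (a ^+ n - 1) < 1).
Proof.
move=> alg_a a1; have [h h0 ha] := algebraic_residue alg_a a1.
pose g (i : 'I_(#|{: 'rV[F]_(size h)}|.+1)) : 'rV[F]_(size h) := poly_rV ('X^i %% h).
have /injectivePn[i [j ij gij]] : ~~ injectiveb g.
  apply/negP => /injectiveP/leq_card; rewrite card_ord.
  by rewrite ltnn.
wlog ltij : i j ij gij / (i < j)%N.
  move=> H; have [|ji|/val_inj] := ltngtP i j; first exact: H.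
    by apply: (H j i) => //; rewrite eq_sym.
  by move=> eij; rewrite eij eqxx in ij.
have mE : 'X^i %% h = 'X^j %% h.
  have sz (l : nat) : (size ('X^l %% h)%R <= size h)%N by rewrite ltnW // ltn_modp.
  by rewrite -(poly_rV_K (sz i)) -(poly_rV_K (sz j)) -[poly_rV _]/(g i) gij.
have [q hq] : exists q, 'X^j - 'X^i = q * h :> {poly F}.
  exists ('X^j %/ h - 'X^i %/ h).
  rewrite {1}(divp_eq 'X^j h) {1}(divp_eq 'X^i h) mE; ring.
exists (j - i)%N; rewrite subn_gt0 ltij /=.
have <- : absK (a ^+ j - a ^+ i) = absK (a ^+ (j - i) - 1).
  rewrite -{1}(subnK (ltnW ltij)) exprD -{2}[a ^+ i]mul1r -mulrBl absKM absKX a1.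
  by rewrite expr1n mulr1.
have -> : a ^+ j - a ^+ i = (map_poly phi q).[a] * (map_poly phi h).[a].
  by rewrite -hornerM -rmorphM -hq rmorphB /= !map_polyXn !hornerE.
rewrite absKM; apply: le_lt_trans ha; rewrite ler_piMl ?absK_ge0 //.
rewrite horner_coef; apply: absK_sum_le1 => l _.
by rewrite absKM absKX a1 expr1n mulr1 coef_map absK_phi lern1 leq_b1.
Qed.

Section Order.
Variable a : K.
Hypothesis alg_a : algebraicOver iota a.
Hypothesis a1 : absK a = 1.

Lemma order_modP : [/\ (0 < order a)%N, absK (a ^+ order a - 1) < 1 &
  forall n, (0 < n)%N -> absK (a ^+ n - 1) < 1 -> (order a <= n)%N].
Proof.
rewrite /order /order_mod; case: pselect => [h|]; last first.
  by case; exact: order_mod_ex.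
case: ex_minnP => n /andP[n0 an] nmin; split=> // m m0 am.
by apply: nmin; rewrite m0.
Qed.

Lemma order_mod_gt0 : (0 < order a)%N.
Proof. by have [] := order_modP. Qed.

Lemma absK_pow_sub1 n : absK (a ^+ n - 1) <= 1.
Proof.
apply: le_trans (absK_ultra _ _) _.
by rewrite absKN absKX a1 expr1n absK1 maxxx.
Qed.

(** Let s be the remainder of k modulo the order. Then a^k - 1 is a small term plus a^s - 1, which
    has absolute value 1 by minimality of the order. *)
Lemma order_mod_ndvd k : ~~ (order a %| k)%N -> absK (a ^+ k - 1) = 1.
Proof.
have [n0 an nmin] := order_modP; rewrite /dvdn -lt0n => s0.
have s1 : absK (a ^+ (k %% order a) - 1) = 1.
  apply/eqP; rewrite eq_le absK_pow_sub1 leNgt; apply/negP => /(nmin _ s0).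
  by rewrite leqNgt ltn_mod n0.
have -> : a ^+ k - 1 = a ^+ (k %% order a) * (a ^+ (k %/ order a * order a) - 1)
    + (a ^+ (k %% order a) - 1).
  by rewrite {1}(divn_eq k (order a)) exprD; ring.
apply: absK_add1 => //; rewrite absKM absKX a1 expr1n mul1r mulnC exprM.
rewrite subrX1 absKM; apply: le_lt_trans an; rewrite ler_piMr ?absK_ge0 //.
by apply: absK_sum_le1 => i _; rewrite !absKX a1 !expr1n.
Qed.

Variable p : nat.
Hypothesis pK : p \in [pchar K].

(** If the order were m p, then a^(m p) - 1 = (a^m - 1)^p would already make |a^m - 1| < 1. *)
Lemma order_mod_coprime : coprime p (order a).
Proof.
have pp := pcharf_prime pK; have [n0 an nmin] := order_modP.
rewrite prime_coprime //; apply/negP => /dvdnP[m hm].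
have m0 : (0 < m)%N by move: n0; rewrite hm muln_gt0 => /andP[].
have : (order a <= m)%N.
  apply: nmin => //; rewrite ltNge; apply/negP => am.
  move: an; rewrite ltNge => /negP; apply.
  have -> : a ^+ order a - 1 = (a ^+ m - 1) ^+ p.
    rewrite -(pFrobenius_autE pK) pFrobenius_autB_comm; last exact: mulrC.
    by rewrite !pFrobenius_autE expr1n -exprM -hm.
  by rewrite absKX exprn_ege1.
by rewrite hm leqNgt -{1}[m]muln1 ltn_mul2l m0 prime_gt1.
Qed.

(** Write k = n w p^v with n the order and w prime to p. Frobenius takes out p^v; with y = a^n, the
    quotient (y^w - 1)/(y - 1) = 1 + y + ... + y^(w-1) is congruent to w, so it has absolute value
    1. *)
Lemma order_mod_dvd k : (0 < k)%N -> (order a %| k)%N ->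
  absK (a ^+ k - 1) = absK (a ^+ order a - 1) ^+ (p ^ logn p k).
Proof.
move=> k0; have pp := pcharf_prime pK.
have [u] := pfactor_coprime pp k0; move: (logn p k) => v pu ->.
rewrite Gauss_dvdl; last by rewrite coprimeXr // coprime_sym order_mod_coprime.
move=> /dvdnP[w uE]; have {}pw : ~~ (p %| w)%N.
  by apply: contraL pu => pw; rewrite prime_coprime // negbK uE dvdn_mulr.
have -> : a ^+ (u * p ^ v) - 1 = (a ^+ u - 1) ^+ (p ^ v).
  have h : p.-nat (p ^ v)%N by rewrite pnatX pnat_id.
  have hK : [pchar K].-nat (p ^ v)%N by rewrite (eq_pnat _ (pcharf_eq pK)).
  by rewrite exprM -{1}(subrK 1 (a ^+ u)) exprDn_pchar // expr1n addrK.
rewrite absKX; congr (_ ^+ _); rewrite uE mulnC exprM; set y := a ^+ order a.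
rewrite subrX1 absKM -[RHS]mulr1; congr (_ * _).
have -> : \sum_(i < w) y ^+ i = \sum_(i < w) (y ^+ i - 1) + w%:R.
  by rewrite sumrB sumr_const card_ord subrK.
apply: absK_add1; last exact: (absK_nat pK).
apply: absK_sum_lt1 => i _; rewrite subrX1 absKM.
have [_ y1 _] := order_modP; apply: le_lt_trans y1.
rewrite ler_piMr ?absK_ge0 //; apply: absK_sum_le1 => j _.
by rewrite !absKX a1 !expr1n.
Qed.

End Order.

Lemma root_of_unity_abs a : is_root_of_unity a -> absK a = 1.
Proof.
move=> /asboolP[n n0 an]; apply/eqP.
by rewrite -(@eqrXn2 _ n) ?absK_ge0 ?ler01 // -absKX an absK1 expr1n.
Qed.

(** At a multiple k of the order with a^k = 1, [order_mod_dvd] makes a power of |a^order - 1|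
    vanish. *)
Lemma root_of_unity_order a : algebraicOver iota a -> is_root_of_unity a ->
  a ^+ order a = 1.
Proof.
move=> alg_a ra; have a1 := root_of_unity_abs ra.
move/asboolP: ra => [n n0 an]; have [p pp pK] := pcharK.
have h : (0 < n * order a)%N by rewrite muln_gt0 n0 order_mod_gt0.
have := order_mod_dvd alg_a a1 pK h (dvdn_mull _ (dvdnn _)).
rewrite exprM an expr1n subrr absK0 => /esym/eqP.
rewrite expf_eq0 => /andP[_]; rewrite absK_eq0 subr_eq0.
by move/eqP.
Qed.

End Valuation.

(** * Eigenvalues and the formula for the counts *)

Section Eigenvalues.
Variable K : closedFieldType.

Lemma char_poly_eigenvalues d (B : 'M[K]_d) :
  char_poly B = \prod_(l <- eigenvalues B) ('X - l%:P).
Proof.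
rewrite /eigenvalues; case: closed_field_poly_normal => s /= {1}->.
by rewrite (monicP (char_poly_monic B)) scale1r.
Qed.

Lemma det_sub_scalar d (B : 'M[K]_d) w :
  \det (w%:M - B) = \prod_(l <- eigenvalues B) (w - l).
Proof.
transitivity (char_poly B).[w]; last first.
  by rewrite char_poly_eigenvalues horner_prod; apply: eq_bigr => l _; rewrite hornerXsubC.
rewrite /char_poly -horner_evalE -det_map_mx; congr (\det _).
by apply/matrixP => i j; rewrite !mxE /= horner_evalE !hornerE hornerMn hornerX.
Qed.

Lemma size_eigenvalues d (B : 'M[K]_d) : size (eigenvalues B) = d.
Proof.
have := congr1 (fun q : {poly K} => size q) (char_poly_eigenvalues B).
by rewrite size_char_poly size_prod_XsubC => -[].
Qed.

(* Factor X^k - 1 into linear factors and evaluate at B. *)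
Lemma det_expr_sub1 d (B : 'M[K]_d.+1) k : (0 < k)%N ->
  \det (B ^+ k - 1) = \prod_(l <- eigenvalues B) (l ^+ k - 1).
Proof.
move=> k0; have [s hs] := closed_field_poly_normal ('X^k - 1 : {poly K}).
rewrite lead_coefXnsubC // scale1r in hs.
have -> : B ^+ k - 1 = \prod_(w <- s) (B - w%:M).
  transitivity (horner_mx B ('X^k - 1)).
    by rewrite rmorphB rmorphXn /= horner_mx_X rmorph1.
  rewrite hs rmorph_prod; apply: eq_bigr => w _.
  by rewrite rmorphB /= horner_mx_X horner_mx_C.
have hl (l : K) : l ^+ k - 1 = \prod_(w <- s) (l - w).
  have := congr1 (fun q : {poly K} => q.[l]) hs.
  rewrite !hornerE horner_prod => ->.
  by apply: eq_bigr => w _; rewrite hornerXsubC.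
rewrite (big_morph _ (@det_mulmx _ _) (@det1 _ _)).
under [RHS]eq_bigr do rewrite hl.
rewrite exchange_big /=; apply: eq_bigr => w _.
rewrite -opprB -scaleN1r detZ det_sub_scalar.
have -> : (-1) ^+ d.+1 = \prod_(l <- eigenvalues B) (-1 : K).
  by rewrite big_const_seq count_predT size_eigenvalues iter_mulr_1.
rewrite -big_split /=.
by apply: eq_bigr => l _; rewrite mulN1r opprB.
Qed.

End Eigenvalues.

Section Count.
Variables (R : realType) (F : finFieldType) (K : closedFieldType).
Variables (iota : {rmorphism laurent F -> K}) (absK : K -> R).
Hypothesis K_algebraic : forall a : K, algebraicOver iota a.
Hypothesis absK_av : is_absolute_value absK.
Hypothesis absK_extends : forall x : laurent F, absK (iota x) = absF x.

Lemma num_isolated_fix_eigenvalues d (A : 'M[{poly F}]_d.+1) k : (0 < k)%N ->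
  (num_isolated_fix (torus_mulmx A) k)%:R =
  \prod_(l <- eigenvalues (map_mx (iota \o @polyL F) A)) absK (l ^+ k - 1).
Proof.
move=> k0; rewrite num_isolated_fixE -absK_extends -absK_prod //.
rewrite -det_expr_sub1 //; congr absK.
rewrite -[iota _]/((iota \o @polyL F) _) -det_map_mx; congr (\det _).
by rewrite rmorphB rmorphXn rmorph1.
Qed.

Lemma num_isolated_fix_formula p d (A : 'M[{poly F}]_d.+1) k :
  p \in [pchar K] -> (0 < k)%N ->
  let lambda := eigenvalues (map_mx (iota \o @polyL F) A) in
  let r : R := \prod_(l <- lambda) Num.max 1 (absK l) in
  let mu := [seq l <- lambda | is_root_of_unity l] in
  let eta := [seq l <- lambda | (absK l == 1) && ~~ is_root_of_unity l] in
  let m (i : 'I_(size mu)) := order_mod absK mu`_i in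
  let n (j : 'I_(size eta)) := order_mod absK eta`_j in
  let c (j : 'I_(size eta)) := absK (eta`_j ^+ n j - 1) in
  (num_isolated_fix (torus_mulmx A) k)%:R = r ^+ k *
    ((\prod_i (~~ (m i %| k)%N)%:R) *
     \prod_j (if (n j %| k)%N then c j ^+ (p ^ logn p k) else 1)).
Proof.
move=> pK k0 lambda r mu eta m n c.
(* The contributions of one eigenvalue to the two products, equal to 1 if it is not of the relevant
   kind; all products then run over [lambda] and are compared termwise. *)
pose g1 l := if is_root_of_unity l then (~~ (order_mod absK l %| k)%N)%:R else 1 : R.
pose g2 l := if (absK l == 1) && ~~ is_root_of_unity l then
  if (order_mod absK l %| k)%N then
    absK (l ^+ order_mod absK l - 1) ^+ (p ^ logn p k) else 1 else 1.
have -> : \prod_i (~~ (m i %| k)%N)%:R = \prod_(l <- lambda) g1 l.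
  by rewrite /g1 -[RHS]big_mkcond -[RHS]big_filter [RHS](big_nth 0) big_mkord.
have -> : \prod_j (if (n j %| k)%N then c j ^+ (p ^ logn p k) else 1) =
    \prod_(l <- lambda) g2 l.
  by rewrite /g2 -[RHS]big_mkcond -[RHS]big_filter [RHS](big_nth 0) big_mkord.
rewrite num_isolated_fix_eigenvalues // -prodrXl -!big_split /=.
apply: eq_bigr => l _; rewrite /g1 /g2.
have [ru|nru] := boolP (is_root_of_unity l).
  have l1 := root_of_unity_abs absK_av ru.
  rewrite andbF mulr1 l1 maxxx expr1n mul1r.
  have [h|h] := boolP (_ %| k)%N; last by rewrite (order_mod_ndvd absK_av absK_extends).
  rewrite (order_mod_dvd absK_av absK_extends _ _ pK) //.
  rewrite (root_of_unity_order absK_av absK_extends) // subrr absK0 //.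
  by rewrite expr0n expn_eq0 eqn0Ngt prime_gt0 ?(pcharf_prime pK).
rewrite andbT mul1r.
have absN1 : absK (-1) = 1 by rewrite absKN // absK1.
(* Off the unit circle |l^k - 1| is the larger of 1 and |l|^k, which is the share of [l] in r^k. *)
have [l1|l1|l1] := ltgtP (absK l) 1.
- rewrite mulr1 expr1n (absK_add1 iota absK_av) //.
  by rewrite (absKX absK_av) exprn_ilt1 ?absK_ge0 // -lt0n.
- rewrite mulr1 -(absKX absK_av).
  have l0 : l ^+ k != 0.
    by rewrite expf_neq0 // -(absK_eq0 absK_av) gt_eqF // (lt_trans _ l1).
  have -> : l ^+ k - 1 = l ^+ k * (- (l ^+ k)^-1 + 1).
    by rewrite mulrDr mulrN mulfV // mulr1 addrC.
  rewrite (absKM absK_av) [X in _ * X](absK_add1 iota absK_av) ?absK1 ?mulr1 //.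
  rewrite absKN // (absKV absK_av) invf_lt1 (absKX absK_av) ?exprn_gt0 ?(lt_trans _ l1) //.
  by rewrite exprn_egt1 // -lt0n.
- rewrite l1 expr1n mul1r.
  have [h|h] := boolP (_ %| k)%N; last by rewrite (order_mod_ndvd absK_av absK_extends).
  by rewrite (order_mod_dvd absK_av absK_extends _ _ pK).
Qed.

End Count.

(** * The real-valued modulus of a complex number *)

Section Modulus.
Local Open Scope complex_scope.
Variable R : realType.
Implicit Types z w : R[i].

Lemma modCE z : `|z| = (modC z)%:C.
Proof. by case: z. Qed.

Lemma modC_ge0 z : 0 <= modC z.
Proof. by rewrite -lecR -modCE normr_ge0. Qed.

Lemma modC_real (x : R) : modC x%:C = `|x|.
Proof. by rewrite /modC normc_def /= expr0n addr0 sqrtr_sqr. Qed.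

Lemma modCM : {morph @modC R : z w / z * w}.
Proof. by move=> z w; apply: complexI; rewrite rmorphM -!modCE normrM. Qed.

Lemma modC1 : modC 1 = 1 :> R.
Proof. by rewrite /modC normr1. Qed.

Lemma modC0 : modC 0 = 0 :> R.
Proof. by rewrite /modC normr0. Qed.

Lemma modC_eq0 z : (modC z == 0) = (z == 0).
Proof. by rewrite -(inj_eq (@complexI R)) -modCE normr_eq0. Qed.

Lemma modCX z k : modC (z ^+ k) = modC z ^+ k.
Proof. by elim: k => [|k ih]; rewrite ?modC1 // !exprS modCM ih. Qed.

Lemma modCV z : modC z^-1 = (modC z)^-1.
Proof.
have [->|z0] := eqVneq z 0; first by rewrite invr0 modC0 invr0.
have z0' : modC z != 0 by rewrite modC_eq0.
by apply: (mulfI z0'); rewrite -modCM !mulfV ?modC1.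
Qed.

Lemma modCN z : modC (- z) = modC z.
Proof. by rewrite /modC normrN. Qed.

Lemma modC_dist z w : modC (z - w) = modC (w - z).
Proof. by rewrite -modCN opprB. Qed.

Lemma modCD z w : modC (z + w) <= modC z + modC w.
Proof. by rewrite -lecR rmorphD -!modCE ler_normD. Qed.

Lemma modC_sum (I : Type) (s : seq I) (P : pred I) (g : I -> R[i]) :
  modC (\sum_(i <- s | P i) g i) <= \sum_(i <- s | P i) modC (g i).
Proof.
elim/big_rec2: _ => [|i y z _ h]; first by rewrite modC0.
by apply: le_trans (modCD _ _) _; rewrite lerD2l.
Qed.

Lemma modC_sqr z : modC z ^+ 2 = complex.Re z ^+ 2 + complex.Im z ^+ 2.
Proof. by apply: complexI; rewrite add_Re2_Im2 modCE rmorphXn. Qed.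

Lemma Re_le_modC z : `|complex.Re z| <= modC z.
Proof. by rewrite -lecR -modCE normc_ge_Re. Qed.

Lemma Im_le_modC z : `|complex.Im z| <= modC z.
Proof.
rewrite -(@ler_pXn2r _ 2) ?nnegrE ?modC_ge0 // modC_sqr real_normK ?num_real //.
by rewrite lerDr sqr_ge0.
Qed.

Lemma modC_i : modC 'i = 1 :> R.
Proof. by rewrite /modC normc_def /= expr0n expr1n add0r sqrtr1. Qed.

Lemma modC_1sub_gt0 z : modC z < 1 -> 0 < modC (1 - z).
Proof. by have := modCD (1 - z) z; rewrite subrK modC1; lra. Qed.

Lemma modC_prim_root n z : n.-primitive_root z -> modC z = 1.
Proof.
move=> pz; apply/eqP; have n0 := prim_order_gt0 pz.
rewrite -(pexpr_eq1 n0) ?modC_ge0 // -modCX (prim_expr_order pz).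
by rewrite modC1.
Qed.

End Modulus.

(** Counts the multiples of Q in ]x, x + n]. With x = Q - s this counts the indices up to n that are
    congruent to s modulo Q. *)
Lemma sum_dvdn_shift Q x n : (0 < Q)%N ->
  (\sum_(k < n) (Q %| k.+1 + x) + x %/ Q = (n + x) %/ Q)%N.
Proof.
move=> Q0; elim: n => [|n ih]; first by rewrite big_ord0.
by rewrite big_ord_recr /= addnAC ih addSn divnS // addnC.
Qed.

(** * Partial sums twisted by roots of unity of order p^e *)

Section Abel.
Variable R : realDomainType.

(** Summation by parts. The bound is one-sided because the upper and lower estimates use different
    linear corrections of the sequence. *)
Lemma abel_le (b w : nat -> R) B n : (forall k, 0 <= w k) ->
  (forall k, w k.+1 <= w k) -> (forall n, \sum_(k < n) b k <= B) ->
  \sum_(k < n) b k * w k <= B * w 0%N.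
Proof.
move=> w0 wS bB.
have -> : \sum_(k < n) b k * w k = \sum_(k < n) (\sum_(i < k.+1) b i) * (w k - w k.+1)
    + (\sum_(k < n) b k) * w n.
  elim: n => [|n ih]; first by rewrite !big_ord0 mul0r addr0.
  by rewrite !big_ord_recr /= ih; ring.
apply: (@le_trans _ _ (\sum_(k < n) B * (w k - w k.+1) + B * w n)).
  apply: lerD; last exact: ler_wpM2r.
  by apply: ler_sum => k _; rewrite ler_wpM2r // subr_ge0.
(* The empty partial sum shows 0 <= B; what remains telescopes to [w 0]. *)
rewrite -mulr_sumr -mulrDr ler_wpM2l //; first by have := bB 0%N; rewrite big_ord0.
rewrite le_eqVlt; apply/orP; left; apply/eqP.
elim: n => [|n ih]; first by rewrite big_ord0 add0r.
by rewrite big_ord_recr /= -{}ih; ring.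
Qed.

End Abel.

Section PartialSums.
Local Open Scope complex_scope.
Variables (R : realType) (p M N : nat).
Variables (m : 'I_M -> nat) (n : 'I_N -> nat) (c : 'I_N -> R).

(* The normalized count N_k / r^k is gcoef k (logn p k). *)
Definition gcoef (k v : nat) : R := (\prod_i (~~ (m i %| k)%N)%:R) *
  \prod_j (if (n j %| k)%N then c j ^+ (p ^ v) else 1).

Hypothesis p_prime : prime p.
Hypothesis m_gt0 : forall i, (0 < m i)%N.
Hypothesis n_gt0 : forall j, (0 < n j)%N.
Hypothesis m_coprime : forall i, coprime p (m i).
Hypothesis n_coprime : forall j, coprime p (n j).
Hypothesis c_gt0 : forall j, 0 < c j.
Hypothesis c_lt1 : forall j, c j < 1.

(** Any positive common multiple of the orders that is prime to p would do. *)
Let L : nat := (\prod_i m i * \prod_j n j)%N.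

Let factor_le k v v' j : (v <= v')%N ->
  (if (n j %| k)%N then c j ^+ (p ^ v') else 1) <=
  (if (n j %| k)%N then c j ^+ (p ^ v) else 1).
Proof.
move=> vv'; case: ifP => // _; apply: ler_wiXn2l; rewrite ?ltW //.
by rewrite leq_pexp2l // prime_gt0.
Qed.

Let factor_gt0 k v j : 0 < (if (n j %| k)%N then c j ^+ (p ^ v) else 1).
Proof. by case: ifP => // _; rewrite exprn_gt0. Qed.

Let factor_le1 k v j : (if (n j %| k)%N then c j ^+ (p ^ v) else 1) <= 1.
Proof. by case: ifP => // _; rewrite exprn_ile1 // ltW. Qed.

Lemma gcoef_ge0 k v : 0 <= gcoef k v.
Proof. by apply: mulr_ge0; apply: prodr_ge0 => i _ //; rewrite ltW. Qed.

Let mprod_le1 k : \prod_i (~~ (m i %| k)%N)%:R <= 1 :> R.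
Proof. by apply: prodr_ile1 => i _; rewrite ler0n lern1 leq_b1. Qed.

Lemma gcoef_le1 k v : gcoef k v <= 1.
Proof.
apply: mulr_ile1; rewrite ?prodr_ge0 //; first by move=> j _; rewrite ltW.
by apply: prodr_ile1 => j _; rewrite ltW //=.
Qed.

Lemma gcoef_antitone k v v' : (v <= v')%N -> gcoef k v' <= gcoef k v.
Proof.
move=> vv'; rewrite ler_wpM2l ?prodr_ge0 //.
by apply: ler_prod => j _; rewrite ltW //= factor_le.
Qed.

Let dvd_mL i : (m i %| L)%N.
Proof. by rewrite /L (bigD1 i) //= -mulnA dvdn_mulr. Qed.

Let dvd_nL j : (n j %| L)%N.
Proof. by rewrite /L (bigD1 j) //= mulnCA dvdn_mulr. Qed.

Let L_gt0 : (0 < L)%N.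
Proof. by rewrite muln_gt0 !prodn_gt0. Qed.

Let L_coprime : coprime p L.
Proof.
by rewrite coprimeMr; apply/andP; split; elim/big_ind: _ => [|x y|i _] //;
  rewrite ?coprimen1 // coprimeMr => -> ->.
Qed.

Lemma gcoef_period k v x : gcoef (k + L * x) v = gcoef k v.
Proof.
congr (_ * _); apply: eq_bigr => i _.
  by rewrite dvdn_addl // dvdn_mulr.
by rewrite dvdn_addl // dvdn_mulr.
Qed.

Variable e' : nat.
Let e := e'.+1.
Variable xi : R[i].
Hypothesis xi_prim : (p ^ e).-primitive_root xi.

Let T := (L * p ^ e')%N.
(* gcoef with the valuation of k truncated at e': since logn p (gcdn k (p ^ e'))
   is the minimum of logn p k and e', this is T-periodic, and differs from the
   normalized count only at multiples of p^e, where xi^k = 1. *)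
Let hcoef k := gcoef k (logn p (gcdn k (p ^ e'))).

(** p^e does not divide T = L p^(e-1), because L is prime to p. *)
Let xiT : xi ^+ T != 1.
Proof.
rewrite -(prim_order_dvd xi_prim) /T /e expnS dvdn_pmul2r ?expn_gt0 ?prime_gt0 //.
by rewrite -prime_coprime.
Qed.

Let modC_xi k : modC (xi ^+ k) = 1.
Proof. by rewrite modCX (modC_prim_root xi_prim) expr1n. Qed.

Let hcoef_bounds k : 0 <= hcoef k <= 1.
Proof. by rewrite gcoef_ge0 gcoef_le1. Qed.

Let hcoefT k : hcoef (k + T) = hcoef k.
Proof.
rewrite /hcoef /T gcoef_period; congr (gcoef _ (logn _ _)).
by rewrite gcdnC addnC gcdnMDl gcdnC.
Qed.

Let S l : R[i] := \sum_(k < l) (hcoef k.+1)%:C * xi ^+ k.+1.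

Let S_add l l' : S (l + l') =
  S l + \sum_(k < l') (hcoef (l + k).+1)%:C * xi ^+ (l + k).+1.
Proof. by rewrite /S big_split_ord. Qed.

Let term_le k : modC ((hcoef k)%:C * xi ^+ k) <= 1.
Proof.
by rewrite modCM modC_xi mulr1 modC_real; have /andP[h0 h1] := hcoef_bounds k; rewrite ger0_norm.
Qed.

(* Multiplying by xi^T shifts the T-periodic sum, and xi^T <> 1. *)
Let S_bounded l : modC (S l) <= T%:R * 2 / modC (1 - xi ^+ T).
Proof.
have tail x l' : modC (\sum_(k < l') (hcoef (x + k).+1)%:C * xi ^+ (x + k).+1) <= l'%:R.
  apply: le_trans (modC_sum _ _ _) _.
  by rewrite -[l' in leRHS]card_ord -sumr_const ler_sum.
have d0 : 0 < modC (1 - xi ^+ T).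
  by rewrite lt_neqAle modC_ge0 eq_sym modC_eq0 subr_eq0 eq_sym xiT.
rewrite ler_pdivlMr // -modCM.
have -> : S l * (1 - xi ^+ T) = S T
    - \sum_(k < T) (hcoef (l + k).+1)%:C * xi ^+ (l + k).+1.
  have -> : S l * (1 - xi ^+ T) = S l - (S (T + l) - S T).
    rewrite S_add addrAC subrr add0r mulrBr mulr1 /S mulr_suml; congr (_ - _).
    apply: eq_bigr => k _; have -> : (T + k).+1 = (k.+1 + T)%N by rewrite addSn addnC.
    by rewrite hcoefT exprD mulrA.
  by rewrite addnC S_add; ring.
apply: le_trans (modCD _ _) _; rewrite modCN mulr_natr mulr2n.
by apply: lerD; [have := tail 0%N T; rewrite /S; under eq_bigr do rewrite add0n|exact: tail].
Qed.

Let logn_gcd_pow k : (0 < k)%N -> logn p (gcdn k (p ^ e')) = minn (logn p k) e'.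
Proof.
move=> k0; have pe0 : (0 < p ^ e')%N by rewrite expn_gt0 prime_gt0.
by rewrite logn_gcd // pfactorK.
Qed.

(** The correction to the periodic model. It is supported on the multiples of p^e, where xi^k = 1,
    which is why it enters [partialE] untwisted. *)
Let delta k := gcoef k (logn p k) - hcoef k.

Let deltaE k : (0 < k)%N -> ~~ (p ^ e %| k)%N -> delta k = 0.
Proof.
move=> k0; rewrite pfactor_dvdn // -ltnNge ltnS => ke.
by rewrite /delta /hcoef logn_gcd_pow // (minn_idPl ke) subrr.
Qed.

Let hcoef_dvd k : (0 < k)%N -> (p ^ e %| k)%N -> hcoef k = gcoef k e'.
Proof.
move=> k0; rewrite pfactor_dvdn // => ek.
by rewrite /hcoef logn_gcd_pow // (minn_idPr _) // ltnW.
Qed.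

(** A loss of at most 1 at each multiple of p^e is the origin of the exponent 1/p^e in the lower
    bound for |zeta|. *)
Let delta_ge k : (0 < k)%N -> - (p ^ e %| k)%N%:R <= delta k.
Proof.
move=> k0; have [ek|nek] := boolP (_ %| _)%N; last by rewrite deltaE ?oppr0.
have /andP[_ h1] := hcoef_bounds k.
by have := gcoef_ge0 k (logn p k); rewrite /delta /= mulr1n; lra.
Qed.

Let delta_le0 k : (0 < k)%N -> delta k <= 0.
Proof.
move=> k0; have [ek|nek] := boolP (p ^ e %| k)%N; last by rewrite deltaE.
rewrite /delta hcoef_dvd // subr_le0 gcoef_antitone //.
by move: ek; rewrite pfactor_dvdn // => /ltnW.
Qed.

Let partial l : R := \sum_(k < l) gcoef k.+1 (logn p k.+1) * complex.Re (xi ^+ k.+1).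

Let partialE l : partial l = complex.Re (S l) + \sum_(k < l) delta k.+1.
Proof.
rewrite /S raddf_sum -big_split /=; apply: eq_bigr => k _.
have -> : complex.Re ((hcoef k.+1)%:C * xi ^+ k.+1) = hcoef k.+1 * complex.Re (xi ^+ k.+1).
  by case: (xi ^+ _) => x y /=; rewrite mul0r subr0.
have [ek|nek] := boolP (p ^ e %| k.+1)%N.
  have /eqP -> : xi ^+ k.+1 == 1 by rewrite -(prim_order_dvd xi_prim).
  by rewrite /delta /=; ring.
by have := deltaE (ltn0Sn k) nek; rewrite /delta => /eqP; rewrite subr_eq0 => /eqP->; ring.
Qed.

Variable j0 : 'I_N.
Hypothesis j0P : forall i, ~~ (m i %| n j0)%N.

Let s := (n j0 * p ^ e)%N.
(** A lower bound for the loss at the indices of [delta_kappa]: the factor of [j0] falls from the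
    exponent p^(e-1) to p^e or beyond, while every other factor in [hcoef] is at least its value
    here. *)
Let kappa := (c j0 ^+ (p ^ e') - c j0 ^+ (p ^ e)) * \prod_(j | j != j0) c j ^+ (p ^ e').

Let kappa_gt0 : 0 < kappa.
Proof.
apply: mulr_gt0; last by apply: prodr_gt0 => j _; rewrite exprn_gt0.
rewrite subr_gt0 ltr_iXn2l // ltn_exp2l //; exact: prime_gt1.
Qed.

(* The k at stake are the s (1 + L t), divisible by n j0 but by no m i. *)
Let delta_kappa k : (0 < k)%N -> (s * L %| k + (s * L - s))%N -> delta k <= - kappa.
Proof.
move=> k0 /dvdnP[w kE].
have sL : (s <= s * L)%N by rewrite leq_pmulr.
have s0 : (0 < s)%N by rewrite muln_gt0 n_gt0 expn_gt0 prime_gt0.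
have w0 : (0 < w)%N.
  by case: w kE => // /eqP; rewrite mul0n addn_eq0 => /andP[/eqP k00]; rewrite k00 in k0.
have {}kE : k = (s + L * (w.-1 * s))%N.
  by case: w w0 kE => //= w _; nia.
have ek : (p ^ e %| k)%N by rewrite kE dvdn_add ?dvdn_mull // dvdn_mull.
(* [m i] divides L and is prime to p, so it would have to divide [n j0]. *)
have mk i : ~~ (m i %| k)%N.
  rewrite kE dvdn_addl; last by rewrite dvdn_mulr.
  rewrite /s Gauss_dvdl // coprimeXr //.
  by rewrite coprime_sym.
have njk : (n j0 %| k)%N.
  by rewrite kE dvdn_add //; [exact: dvdn_mulr|rewrite dvdn_mulr].
rewrite /delta hcoef_dvd // /gcoef.
have -> : \prod_i (~~ (m i %| k)%N)%:R = 1 :> R by rewrite big1 // => i _; rewrite mk.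
rewrite !mul1r (bigD1 j0) //= [X in _ - X](bigD1 j0) //= njk.
set X' := \prod_(j < N | j != j0) _; set Y' := \prod_(j < N | j != j0) _.
have ve : (e <= logn p k)%N by rewrite -pfactor_dvdn.
have XY : X' <= Y'.
  by apply: ler_prod => j _; rewrite ltW //= factor_le // ltnW.
have Y0 : \prod_(j | j != j0) c j ^+ (p ^ e') <= Y'.
  apply: ler_prod => j _; rewrite exprn_ge0 /= ?(ltW (c_gt0 j)) //.
  by case: ifP => // _; rewrite exprn_ile1 // ltW.
have X0 : 0 <= X' by apply: prodr_ge0 => j _; rewrite ltW.
have cc : c j0 ^+ (p ^ logn p k) <= c j0 ^+ (p ^ e).
  by apply: ler_wiXn2l; rewrite ?ltW // leq_pexp2l // prime_gt0.
have ce : c j0 ^+ (p ^ e) < c j0 ^+ (p ^ e').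
  by rewrite ltr_iXn2l // ltn_exp2l // prime_gt1.
have ck0 : 0 < c j0 ^+ (p ^ logn p k) by rewrite exprn_gt0.
rewrite /kappa; set P0 := \prod_(j < N | _) _ in Y0 *.
set x := c j0 ^+ (p ^ logn p k) in cc ck0 *.
set x1 := c j0 ^+ (p ^ e) in cc ce *; set x2 := c j0 ^+ (p ^ e') in ce *.
have h1 : x * X' <= x1 * Y' by apply: ler_pM => //; exact: ltW.
have h2 : (x2 - x1) * P0 <= (x2 - x1) * Y'.
  by rewrite ler_wpM2l // subr_ge0 ltW.
by lra.
Qed.

Lemma partial_sum_bounds : exists kap B : R, [/\ 0 < kap, 0 <= B &
  forall l, - (l%:R / (p ^ e)%:R) - B <= partial l <= - (kap * l%:R) + B].
Proof.
pose B0 : R := T%:R * 2 / modC (1 - xi ^+ T).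
have sL0 : (0 < s * L)%N by rewrite muln_gt0 L_gt0 andbT /s muln_gt0 n_gt0 expn_gt0 prime_gt0.
have B00 : 0 <= B0 by apply: le_trans (S_bounded 0); exact: modC_ge0.
(* At least [kappa] is lost at each k congruent to s modulo s L, hence the rate; the extra [kappa]
   in the constant absorbs the rounding in the number of such k. *)
exists (kappa / (s * L)%:R), (B0 + kappa); split.
- by rewrite divr_gt0 // ltr0n.
- by rewrite addr_ge0 // ltW.
move=> l; rewrite partialE.
have := le_trans (Re_le_modC (S l)) (S_bounded l); rewrite -/B0 ler_norml => /andP[S1 S2].
have k0 := kappa_gt0.
have h1 : - (l%:R / (p ^ e)%:R) <= \sum_(k < l) delta k.+1.
  apply: (@le_trans _ _ (\sum_(k < l) - (p ^ e %| k.+1)%N%:R)); last first.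
    by apply: ler_sum => k _; exact: delta_ge.
  have pe0 : (0 < p ^ e)%N by rewrite expn_gt0 prime_gt0.
  rewrite sumrN lerN2 ler_pdivlMr ?ltr0n // -natr_sum -natrM ler_nat.
  have := sum_dvdn_shift 0 l pe0; rewrite div0n !addn0 => h.
  suff -> : (\sum_(k < l) (p ^ e %| k.+1) = l %/ p ^ e)%N by exact: leq_divM.
  by rewrite -h; apply: eq_bigr => k _; rewrite addn0.
have h2 : \sum_(k < l) delta k.+1 <= - (kappa / (s * L)%:R * l%:R) + kappa.
  apply: (@le_trans _ _ (\sum_(k < l) - kappa * (s * L %| k.+1 + (s * L - s))%N%:R)).
    apply: ler_sum => k _; have [h|_] := boolP (_ %| _)%N; first by rewrite mulr1 delta_kappa.
    by rewrite mulr0 delta_le0.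
  rewrite -mulr_sumr -natr_sum; have := sum_dvdn_shift (s * L - s) l sL0.
  rewrite [X in (_ + X)%N]divn_small; last first.
    by rewrite ltn_subrL sL0 /s muln_gt0 n_gt0 expn_gt0 prime_gt0.
  rewrite addn0 => ->; set D := (_ %/ _)%N.
  have lD : (l <= (D + 1) * (s * L))%N.
    by rewrite addn1 ltnW // (leq_ltn_trans (leq_addr (s * L - s) l)) // ltn_ceil.
  have {}lD : l%:R / (s * L)%:R <= D%:R + 1 :> R.
    by rewrite ler_pdivrMr ?ltr0n // -[1]/1%:R -natrD -natrM ler_nat.
  have : kappa * (l%:R / (s * L)%:R) <= kappa * (D%:R + 1) by rewrite ler_wpM2l // ltW.
  have -> : kappa / (s * L)%:R * l%:R = kappa * (l%:R / (s * L)%:R) by rewrite mulrA mulrAC.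
  lra.
apply/andP; split; lra.
Qed.

End PartialSums.

(** * Complex series *)

Section NumFieldLimits.
Variable C : numFieldType.
Implicit Types (u a : nat -> C) (l w z : C).

(** R[i] carries its topology only as a [numFieldType]; this form of convergence can be restated
    with real radii, as [clim_modP] does. *)
Definition clim u l := forall e : C, 0 < e ->
  exists n0 : nat, forall n : nat, (n0 <= n)%N -> `|u n - l| < e.

Lemma climP u l : clim u l <-> u @ \oo --> l.
Proof.
split=> [h|/cvgrPdist_lt h].
  apply/cvgrPdist_lt => e /h[n0 hn]; exists n0 => // n /= /hn.
  by rewrite distrC.
by move=> e /h[n0 _ hn]; exists n0 => n /hn /=; rewrite distrC.
Qed.

Lemma clim_uniq u l l' : clim u l -> clim u l' -> l = l'.
Proof. by move=> /climP h /climP h'; exact: (cvg_unique _ h h'). Qed.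

Lemma series_climP a l : clim (series a) l -> series_cvg a /\ series_sum a = l.
Proof.
move=> /climP h; split; first by apply/cvg_ex; exists l.
exact: (cvg_lim _ h).
Qed.

Lemma series_cvg_clim a : series_cvg a -> clim (series a) (series_sum a).
Proof. by move=> h; apply/climP. Qed.

Lemma open_ball_sub (U : set C) w : open U -> U w ->
  exists2 d, 0 < d & forall z, `|z - w| < d -> U z.
Proof.
move=> oU Uw; have /nbhs_ballP[d d0 dU] : nbhs w U by apply: open_nbhs_nbhs.
by exists d => // z zw; apply: dU; rewrite -ball_normE /= distrC.
Qed.

Lemma analytic_at_clim (g : C -> C) w : analytic_at g w ->
  exists a, exists2 d, 0 < d &
    forall z, `|z - w| < d -> clim (series (fun k => a k * (z - w) ^+ k)) (g z).
Proof.
move=> [a /nbhs_ballP[d d0 h]]; exists a, d => // z zw; apply/climP/h.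
by rewrite -ball_normE /= distrC.
Qed.

End NumFieldLimits.

Section ComplexLimits.
Local Open Scope complex_scope.
Variable R : realType.
Implicit Types (u a : nat -> R[i]) (l w z : R[i]).

Lemma clim_modP u l : clim u l <-> forall e : R, 0 < e ->
  exists n0 : nat, forall n : nat, (n0 <= n)%N -> modC (u n - l) < e.
Proof.
split=> h e e0.
  have [|n0 hn] := h e%:C; first by rewrite ltcR.
  by exists n0 => n /hn; rewrite modCE ltcR.
have [k ek] : exists k, e = k%:C by apply/complex_realP/gtr0_real.
move: e0; rewrite ek ltcR => /h[n0 hn]; exists n0 => n /hn.
by rewrite modCE ltcR.
Qed.

Lemma clim_ReIm u l : (fun n => complex.Re (u n)) @ \oo --> complex.Re l ->
  (fun n => complex.Im (u n)) @ \oo --> complex.Im l -> clim u l.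
Proof.
move=> /cvgrPdist_lt hR /cvgrPdist_lt hI; apply/clim_modP => e e0.
have e2 : 0 < e / 2 by rewrite divr_gt0.
have [n1 _ h1] := hR _ e2; have [n2 _ h2] := hI _ e2.
exists (maxn n1 n2) => n; rewrite geq_max => /andP[/h1 /= r1 /h2 /= i1].
have -> : u n - l = (complex.Re (u n) - complex.Re l)%:C +
    (complex.Im (u n) - complex.Im l)%:C * 'i.
  case: (u n) l {hR hI h1 h2 r1 i1} => x y [x' y'].
  by apply/eqP; rewrite eq_complex /=; apply/andP; split; apply/eqP; ring.
apply: le_lt_trans (modCD _ _) _; rewrite modCM !modC_real modC_i.
by rewrite mulr1 distrC [X in _ + X]distrC; lra.
Qed.

Lemma real_series_geo_cvg (b : nat -> R) (B q : R) : 0 <= q -> q < 1 ->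
  (forall k, `|b k| <= B * q ^+ k) -> cvgn (series b).
Proof.
move=> q0 q1 h; apply: normed_cvg.
apply: (@series_le_cvg _ _ (geometric B q)) => [k|k|k|].
- exact: normr_ge0.
- by apply: le_trans (h k).
- exact: h.
- by apply: is_cvg_geometric_series; rewrite ger0_norm.
Qed.

(** Convergence is obtained from the real and imaginary parts; their limits are kept because the
    boundary estimates concern real parts. *)
Lemma complex_series_geo a (B q : R) : 0 <= q -> q < 1 ->
  (forall k, modC (a k) <= B * q ^+ k) -> series_cvg a /\
  series (fun k => complex.Re (a k)) @ \oo --> complex.Re (series_sum a) /\
  series (fun k => complex.Im (a k)) @ \oo --> complex.Im (series_sum a).
Proof.
move=> q0 q1 h.
have cR : cvgn (series (fun k => complex.Re (a k))).
  by apply: (real_series_geo_cvg q0 q1) => k; exact: le_trans (Re_le_modC _) (h k).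
have cI : cvgn (series (fun k => complex.Im (a k))).
  by apply: (real_series_geo_cvg q0 q1) => k; exact: le_trans (Im_le_modC _) (h k).
have eR : (fun n => complex.Re (series a n)) = series (fun k => complex.Re (a k)).
  by apply/funext => n; rewrite /series /= raddf_sum.
have eI : (fun n => complex.Im (series a n)) = series (fun k => complex.Im (a k)).
  by apply/funext => n; rewrite /series /= raddf_sum.
have hl : clim (series a) (limn (series (fun k => complex.Re (a k))) +i*
    limn (series (fun k => complex.Im (a k)))).
  by apply: clim_ReIm; rewrite ?eR ?eI.
have [ca ->] := series_climP hl; split=> //.
Qed.

(** Convergence at distance t from w bounds |a_k| t^k by some B. Within t/2 the terms of index k >=
    1 are at most B x^k with x = |z - w|/t <= 1/2, and the sum of these x^k is at most 2 x. *)
Lemma analytic_at_lipschitz (g : R[i] -> R[i]) w : analytic_at g w ->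
  exists B d : R, [/\ 0 < B, 0 < d &
    forall z, modC (z - w) < d -> modC (g z - g w) <= B * modC (z - w)].
Proof.
move=> /analytic_at_clim[a [d' d'0 ha]].
have [d dE] : exists d, d' = d%:C by apply/complex_realP/gtr0_real.
rewrite {}dE ltcR in d'0 ha; rename d'0 into d0.
pose t := d / 2; have t0 : 0 < t by rewrite divr_gt0.
have cz z : modC (z - w) < d -> clim (series (fun k => a k * (z - w) ^+ k)) (g z).
  by move=> zw; apply: ha; rewrite modCE ltcR.
have gw : g w = a 0%N.
  apply: (clim_uniq (cz w _)); first by rewrite subrr modC0.
  apply/clim_modP => e e0; exists 1%N => -[//|n] _.
  rewrite /series /= big_nat_recl //= big1 => [|i _].
    by rewrite subrr expr0 mulr1 addr0 subrr modC0.
  by rewrite subrr exprS mul0r mulr0.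
have [B B0 hB] : exists2 B, 0 < B & forall k, modC (a k) * t ^+ k <= B.
  have tw : modC (w + t%:C - w) < d.
    by rewrite addrAC subrr add0r modC_real gtr0_norm // /t; lra.
  have /clim_modP/(_ _ ltr01)[n0 hn] := cz _ tw.
  have termE k : modC (a k) * t ^+ k = modC (a k * (w + t%:C - w) ^+ k).
    by rewrite addrAC subrr add0r modCM modCX modC_real gtr0_norm.
  (* From [n0] on, a term is the difference of two partial sums that are within 1 of the limit. *)
  exists (2 + \sum_(k < n0) modC (a k) * t ^+ k) => [|k].
    rewrite ltr_pwDl // sumr_ge0 // => k _.
    by rewrite mulr_ge0 ?modC_ge0 // exprn_ge0 // ltW.
  have [n0k|kn0] := leqP n0 k; last first.
    rewrite (bigD1 (Ordinal kn0)) //= addrCA lerDl addr_ge0 // sumr_ge0 // => i _.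
    by rewrite mulr_ge0 ?modC_ge0 // exprn_ge0 // ltW.
  apply: (@le_trans _ _ 2); last first.
    rewrite lerDl sumr_ge0 // => i _.
    by rewrite mulr_ge0 ?modC_ge0 // exprn_ge0 // ltW.
  rewrite termE; set S := series _ in hn.
  have -> : a k * (w + t%:C - w) ^+ k = (S k.+1 - g (w + t%:C)) - (S k - g (w + t%:C)).
    by rewrite /S /series /= big_nat_recr //=; ring.
  apply: le_trans (modCD _ _) _; rewrite modCN.
  have := hn _ n0k; have := hn k.+1 (leqW n0k); lra.
exists (2 * B / t), (t / 2); split; [by rewrite divr_gt0 // mulr_gt0|by rewrite divr_gt0|].
move=> z zw; set x := modC (z - w) / t.
have x0 : 0 <= x by rewrite divr_ge0 ?modC_ge0 // ltW.
have x1 : x <= 2^-1 by rewrite ler_pdivrMr // mulrC ltW.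
have zd : modC (z - w) < d by apply: lt_trans zw _; rewrite /t; lra.
have -> : 2 * B / t * modC (z - w) = 2 * B * x by rewrite /x mulrAC mulrA.
have partial n : modC (series (fun k => a k * (z - w) ^+ k) n.+1 - g w) <= 2 * B * x.
  rewrite /series /= big_nat_recl //= expr0 mulr1 -gw addrAC subrr add0r.
  apply: le_trans (modC_sum _ _ _) _.
  apply: (@le_trans _ _ (\sum_(0 <= i < n) B * x ^+ i.+1)).
    apply: ler_sum => i _; rewrite modCM modCX.
    have -> : modC (z - w) = x * t by rewrite /x divfK // gt_eqF.
    by rewrite exprMn mulrCA mulrC ler_wpM2r ?exprn_ge0.
  rewrite -mulr_sumr -mulrA mulrCA (ler_wpM2l (ltW B0)) //.
  rewrite big_mkord; elim: n => [|n ih]; first by rewrite big_ord0 mulr_ge0.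
  rewrite big_ord_recl; under eq_bigr do rewrite exprS.
  rewrite -mulr_sumr expr1; have : x * (\sum_(i < n) x ^+ i.+1) <= x * (2 * x).
    by rewrite ler_wpM2l.
  have : x * (2 * x) <= 2^-1 * (2 * x) by rewrite ler_wpM2r // mulr_ge0.
  by lra.
apply/ler_addgt0Pr => e e0.
have /clim_modP/(_ _ e0)[n0 hn] := cz _ zd.
have := hn _ (leqnSn n0); have := partial n0.
set S := series _ _; have -> : g z - g w = (S - g w) - (S - g z) by ring.
by have := modCD (S - g w) (- (S - g z)); rewrite modCN; lra.
Qed.

End ComplexLimits.

(** * The logarithm series and its exponential *)

Section LogSeries.
Local Open Scope complex_scope.
Variable R : realType.
Implicit Types (w z : R[i]) (s x y : R).

(* The mean value theorem on [0, 1], applied to f minus the primitive of the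
   partial sum, whose derivative is close to that of f. *)
Lemma primitive_series_cvg (b : nat -> R) (f df : R -> R) (B q : R) :
  0 <= q -> q < 1 -> f 0 = 0 ->
  (forall s, 0 <= s <= 1 -> is_derive s 1 f (df s)) ->
  (forall n s, 0 <= s <= 1 -> `|\sum_(k < n) b k * s ^+ k - df s| <= B * q ^+ n) ->
  series (fun k => b k / k.+1%:R) @ \oo --> f 1.
Proof.
move=> q0 q1 f0 fdf hb.
pose P n : {poly R} := \sum_(k < n) (b k / k.+1%:R) *: 'X^(k.+1).
have Pd n s : (P n)^`().[s] = \sum_(k < n) b k * s ^+ k.
  rewrite /P linear_sum horner_sum; apply: eq_bigr => k _.
  rewrite /= derivZ derivXn hornerZ hornerMn hornerXn -[s ^+ _ *+ _]mulr_natr.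
  by rewrite mulrCA divfK ?pnatr_eq0 // mulrC.
have P0 n : (P n).[0] = 0.
  by rewrite /P horner_sum big1 // => k _; rewrite hornerZ hornerXn expr0n mulr0.
have P1 n : (P n).[1] = series (fun k => b k / k.+1%:R) n.
  rewrite /P horner_sum /series /= big_mkord; apply: eq_bigr => k _.
  by rewrite hornerZ hornerXn expr1n mulr1.
have close n : `|series (fun k => b k / k.+1%:R) n - f 1| <= B * q ^+ n.
  pose g := horner (P n) - f.
  have gd s : 0 <= s <= 1 -> is_derive s 1 g ((P n)^`().[s] - df s).
    by move=> /fdf fs; apply: is_deriveB.
  have [c c01] : exists2 c, c \in `]0, 1[ &
      g 1 - g 0 = ((P n)^`().[c] - df c) * (1 - 0).
    apply: (@MVT _ g (fun s => (P n)^`().[s] - df s)) => // [s|].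
      by rewrite in_itv /= => /andP[s0 s1]; apply: gd; rewrite !ltW.
    apply: derivable_within_continuous => s; rewrite in_itv /= => /gd.
    by move=> h; exact: ex_derive.
  rewrite /g !fctE P1 P0 f0 !subr0 mulr1 Pd => ->.
  by apply: hb; move: c01; rewrite in_itv /= => /andP[/ltW-> /ltW->].
apply/cvgrPdist_le => e e0; have e' : 0 < e / (`|B| + 1).
  by rewrite divr_gt0 // ltr_wpDl.
have /cvgrPdist_lt/(_ _ e')[n0 _ hn] : (fun n => q ^+ n) @ \oo --> (0 : R).
  by apply: cvg_expr; rewrite ger0_norm.
exists n0 => // n /hn /=; rewrite sub0r normrN ger0_norm ?exprn_ge0 // => qe.
rewrite distrC; apply: le_trans (close n) _.
apply: le_trans (ler_wpM2r _ (ler_norm B)) _; first by rewrite exprn_ge0.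
rewrite ltr_pdivlMr ?ltr_wpDl // in qe; apply: le_trans (ltW qe).
by rewrite mulrC ler_wpM2l ?exprn_ge0 // lerDl.
Qed.

(** Along the segment from 0 to w, -log(1 - s w) has the derivative w/(1 - s w) in the real variable
    s; this is the approximation that [primitive_series_cvg] asks for. *)
Lemma geometric_remainder w n s : modC w < 1 -> 0 <= s <= 1 ->
  modC (\sum_(k < n) w ^+ k.+1 * s%:C ^+ k - w / (1 - s%:C * w)) <=
  (1 - modC w)^-1 * modC w ^+ n.
Proof.
move=> w1 /andP[s0 s1].
have sw : modC (s%:C * w) <= modC w.
  by rewrite modCM modC_real ger0_norm // ler_piMl ?modC_ge0.
have d : 1 - modC w <= modC (1 - s%:C * w).
  have := modCD (1 - s%:C * w) (s%:C * w); rewrite subrK modC1; lra.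
have d0 : 1 - s%:C * w != 0 by rewrite -modC_eq0 gt_eqF // (lt_le_trans _ d) // subr_gt0.
have -> : \sum_(k < n) w ^+ k.+1 * s%:C ^+ k - w / (1 - s%:C * w) =
    - (w / (1 - s%:C * w)) * (s%:C * w) ^+ n.
  have -> : \sum_(k < n) w ^+ k.+1 * s%:C ^+ k =
      w / (1 - s%:C * w) * (1 - (s%:C * w) ^+ n).
    rewrite -[1 in X in _ * X](expr1n _ n) subrXX.
    rewrite mulrA mulfVK // mulr_sumr.
    by apply: eq_bigr => k _; rewrite expr1n mul1r exprMn exprS; ring.
  by ring.
rewrite modCM modCN modCM modCV modCX.
have m0 := modC_ge0 w.
apply: ler_pM => //.
- by rewrite mulr_ge0 // invr_ge0 modC_ge0.
- by rewrite exprn_ge0 // modC_ge0.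
- rewrite -[leRHS]mul1r; apply: ler_pM; rewrite ?invr_ge0 ?modC_ge0 //; first exact: ltW.
  by rewrite lef_pV2 // posrE ?(lt_le_trans _ d) ?subr_gt0.
- by apply: lerXn2r; rewrite ?nnegrE ?modC_ge0.
Qed.

(** |1 - s w|^2 for w = x + i y. *)
Let den x y s := (1 - s * x) ^+ 2 + (s * y) ^+ 2.

Let one_subE x y s : 1 - s%:C * (x +i* y) = (1 - s * x) +i* (- (s * y)).
Proof. by apply/eqP; rewrite eq_complex /=; apply/andP; split; apply/eqP; ring. Qed.

Let Re_frac x y s : complex.Re ((x +i* y) / (1 - s%:C * (x +i* y))) =
  (x * (1 - s * x) - s * y ^+ 2) / den x y s.
Proof. by rewrite /den one_subE /= sqrrN; ring. Qed.

Let Im_frac x y s : complex.Im ((x +i* y) / (1 - s%:C * (x +i* y))) = y / den x y s.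
Proof. by rewrite /den one_subE /= sqrrN; ring. Qed.

Let scale_real z s : complex.Re (z * s%:C) = complex.Re z * s /\
  complex.Im (z * s%:C) = complex.Im z * s.
Proof. by case: z => x y /=; split; ring. Qed.

Section Ray.
Variables x y : R.
Let w := x +i* y.
Hypothesis w1 : modC w < 1.

(** Keeps 1 - s w in the right half-plane, where its argument is an arctangent without a change of
    branch. *)
Let pos s : 0 <= s <= 1 -> 0 < 1 - s * x.
Proof.
move=> /andP[s0 s1]; have x1 : x < 1.
  by apply: le_lt_trans w1; apply: le_trans (Re_le_modC w); exact: ler_norm.
have [x0|x0] := leP 0 x; last by rewrite subr_gt0 (le_lt_trans _ ltr01) // mulr_ge0_le0 // ltW.
by rewrite subr_gt0 (le_lt_trans _ x1) // ler_piMl.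
Qed.

Let den_gt0 s : 0 <= s <= 1 -> 0 < den x y s.
Proof. by move=> /pos h; rewrite /den ltr_pwDl ?exprn_gt0 ?sqr_ge0. Qed.

Let remainder n s (p : {additive R[i] -> R}) : (forall z, `|p z| <= modC z) ->
  (forall z t, p (z * t%:C) = p z * t) -> 0 <= s <= 1 ->
  `|\sum_(k < n) p (w ^+ k.+1) * s ^+ k - p (w / (1 - s%:C * w))| <=
  (1 - modC w)^-1 * modC w ^+ n.
Proof.
move=> ple pZ s01; apply: le_trans (geometric_remainder n w1 s01).
apply: le_trans (ple _); rewrite raddfB raddf_sum.
by under [in leRHS]eq_bigr do rewrite -rmorphXn pZ.
Qed.

Let affine_d s : is_derive s 1 (fun t => 1 - t * x) (- x).
Proof.
have -> : (fun t => 1 - t * x) = cst 1 - x *: (@id R).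
  by apply/funext => t; rewrite !fctE /= mulrC.
by apply: is_derive_eq; rewrite sub0r /GRing.scale /= mulr1.
Qed.

Let den_d s : is_derive s 1 (den x y) (- 2 * (x * (1 - s * x) - s * y ^+ 2)).
Proof.
pose p : {poly R} := 1 - (2 * x) *: 'X + (x ^+ 2 + y ^+ 2) *: 'X^2.
have -> : den x y = horner p.
  apply/funext => t; rewrite /den /p !hornerE /=.
  by ring.
have -> : - 2 * (x * (1 - s * x) - s * y ^+ 2) = (deriv p).[s].
  rewrite /p !poly.derivE !hornerE /=.
  ring.
exact: is_derive_poly.
Qed.

(** The primitive is -ln |1 - s w|, written with the squared modulus so that no square root is
    differentiated. *)
Lemma log_series_Re_aux :
  series (fun k => complex.Re (w ^+ k.+1) / k.+1%:R) @ \oo --> - 2^-1 * ln (den x y 1).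
Proof.
pose f s := - 2^-1 * ln (den x y s).
pose df s := (x * (1 - s * x) - s * y ^+ 2) / den x y s.
apply: (@primitive_series_cvg _ f df (1 - modC w)^-1 (modC w)) => //; first exact: modC_ge0.
- by rewrite /f /den !mul0r subr0 expr1n expr0n addr0 ln1 mulr0.
- move=> s s01; have dd := den_d s; have d0 := den_gt0 s01.
  have dl := is_derive1_ln d0.
  have -> : f = (- 2^-1) *: (@ln R \o den x y) by apply/funext => t.
  apply: is_derive_eq; rewrite /GRing.scale /df /=; field.
  by rewrite gt_eqF.
- move=> n s s01; rewrite /df -Re_frac.
  apply: (remainder n _ _ s01) => [z|z t]; first exact: Re_le_modC.
  by have [] := scale_real z t.
Qed.

(** The primitive is -arg(1 - s w) = atan(s y / (1 - s x)). *)
Lemma log_series_Im_aux :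
  series (fun k => complex.Im (w ^+ k.+1) / k.+1%:R) @ \oo --> atan (y / (1 - x)).
Proof.
pose f s := atan (s * y / (1 - s * x)).
pose df s := y / den x y s.
have -> : atan (y / (1 - x)) = f 1 by rewrite /f !mul1r.
apply: (@primitive_series_cvg _ f df (1 - modC w)^-1 (modC w)) => //; first exact: modC_ge0.
- by rewrite /f !mul0r atan0.
- move=> s s01; have p0 := pos s01; have dd := affine_d s.
  have d0 := den_gt0 s01.
  have dv : is_derive s 1 (fun t => (1 - t * x)^-1) (- (1 - s * x) ^- 2 *: (- x)).
    by apply: is_deriveV; rewrite ?gt_eqF.
  pose g : R -> R := fun t => t * y / (1 - t * x).
  have dg : is_derive s 1 g (y / (1 - s * x) + s * y * (x / (1 - s * x) ^+ 2)).
    have -> : g = (y *: (@id R)) * (fun t => (1 - t * x)^-1).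
      by apply/funext => t; congr (_ * _); exact: mulrC.
    apply: is_derive_eq; rewrite /GRing.scale /= -[y *: s]/(y * s).
  field.
    by rewrite gt_eqF.
  have -> : f = @atan R \o g by [].
  apply: is_derive_eq; rewrite /df /g /den.
  field.
  rewrite !gt_eqF //= ltr_pwDl ?ltr01 ?sqr_ge0 //.
- move=> n s s01; rewrite /df -Im_frac.
  apply: (remainder n _ _ s01) => [z|z t]; first exact: Im_le_modC.
  by have [] := scale_real z t.
Qed.

End Ray.

Lemma log_series_Re w : modC w < 1 ->
  series (fun k => complex.Re (w ^+ k.+1) / k.+1%:R) @ \oo --> - ln (modC (1 - w)).
Proof.
case: w => x y w1; suff -> : - ln (modC (1 - x +i* y)) = - 2^-1 * ln (den x y 1).
  exact: log_series_Re_aux.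
have d0 := modC_1sub_gt0 w1.
have -> : den x y 1 = modC (1 - x +i* y) ^+ 2.
  by rewrite modC_sqr /den /=; ring.
by rewrite lnXn // -mulr_natr; lra.
Qed.

End LogSeries.

Section Exponential.
Local Open Scope complex_scope.
Variable R : realType.
Implicit Types (w z : R[i]) (a : R).

Lemma expCD : {morph @expC R : z w / z + w >-> z * w}.
Proof.
move=> [x y] [x' y']; rewrite /expC /= expRD cosD sinD.
by apply/eqP; rewrite eq_complex /=; apply/andP; split; apply/eqP; ring.
Qed.

Lemma expC0 : expC 0 = 1 :> R[i].
Proof. by rewrite /expC /= expR0 cos0 sin0 mul1r. Qed.

Lemma expC_sum (I : Type) (s : seq I) (P : pred I) (g : I -> R[i]) :
  expC (\sum_(i <- s | P i) g i) = \prod_(i <- s | P i) expC (g i).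
Proof. exact: (big_morph _ expCD expC0). Qed.

Lemma expCMn z n : expC (z *+ n) = expC z ^+ n.
Proof. by elim: n => [|n ih]; rewrite ?expC0 // mulrS expCD ih exprS. Qed.

Lemma modC_expC z : modC (expC z) = expR (complex.Re z).
Proof.
rewrite modCM modC_real ger0_norm ?expR_ge0 //.
suff -> : modC (cos (complex.Im z) +i* sin (complex.Im z)) = 1 by rewrite mulr1.
by rewrite /modC normc_def /= cos2Dsin2 sqrtr1.
Qed.

Lemma expC_neq0 z : expC z != 0.
Proof. by rewrite -modC_eq0 modC_expC gt_eqF // expR_gt0. Qed.

Lemma expCN z : expC (- z) = (expC z)^-1.
Proof.
by apply: (mulfI (expC_neq0 z)); rewrite -expCD subrr expC0 mulfV // expC_neq0.
Qed.

(** The power series of -log(1 - w). *)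
Definition log_sum w : R[i] := series_sum (fun k => w ^+ k.+1 / k.+1%:R).

Let term_ReIm w k :
  complex.Re (w ^+ k.+1 / k.+1%:R) = complex.Re (w ^+ k.+1) / k.+1%:R /\
  complex.Im (w ^+ k.+1 / k.+1%:R) = complex.Im (w ^+ k.+1) / k.+1%:R.
Proof.
have -> : (k.+1%:R : R[i])^-1 = (k.+1%:R^-1)%:C by rewrite fmorphV rmorph_nat.
by case: (w ^+ k.+1) => x y /=; split; ring.
Qed.

Lemma log_term_le w k : modC (w ^+ k.+1 / k.+1%:R) <= modC w * modC w ^+ k.
Proof.
have -> : (k.+1%:R : R[i])^-1 = (k.+1%:R^-1)%:C by rewrite fmorphV rmorph_nat.
rewrite modCM modCX modC_real ger0_norm ?invr_ge0 // -exprS.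
by rewrite ler_piMr ?exprn_ge0 ?modC_ge0 // invf_le1 ?ltr0n // ler1n.
Qed.

Lemma log_sum_cvg w : modC w < 1 -> series_cvg (fun k => w ^+ k.+1 / k.+1%:R).
Proof.
by move=> w1; have [] := complex_series_geo (modC_ge0 w) w1 (log_term_le w).
Qed.

Lemma log_sum_Re w : modC w < 1 -> complex.Re (log_sum w) = - ln (modC (1 - w)).
Proof.
move=> w1; have [_ [h _]] := complex_series_geo (modC_ge0 w) w1 (log_term_le w).
have tE : (fun k => complex.Re (w ^+ k.+1 / k.+1%:R)) =
    (fun k => complex.Re (w ^+ k.+1) / k.+1%:R).
  by apply/funext => k; have [] := term_ReIm w k.
rewrite tE in h; exact: (cvg_unique _ h (log_series_Re w1)).
Qed.

Lemma log_sum_Im w : modC w < 1 -> complex.Im (log_sum w) = - argC (1 - w).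
Proof.
move=> w1; have [_ [_ h]] := complex_series_geo (modC_ge0 w) w1 (log_term_le w).
suff -> : - argC (1 - w) = atan (complex.Im w / (1 - complex.Re w)).
  have tE : (fun k => complex.Im (w ^+ k.+1 / k.+1%:R)) =
      (fun k => complex.Im (w ^+ k.+1) / k.+1%:R).
    by apply/funext => k; have [] := term_ReIm w k.
  rewrite tE in h; have := @log_series_Im_aux R (complex.Re w) (complex.Im w).
  have -> : complex.Re w +i* complex.Im w = w by case: (w).
  by move=> /(_ w1); exact: (cvg_unique _ h).
case: w w1 {h} => x y w1 /=.
have x1 : 0 < 1 - x.
  rewrite subr_gt0; apply: le_lt_trans w1; apply: le_trans (Re_le_modC (x +i* y)).
  exact: ler_norm.
set th := atan _.
(* [argC] is an arccosine with a sign, so [th] is recovered from its cosine: it lies in ]-pi/2,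
   pi/2[, where acos (cos th) = |th|. *)
have cth : cos th = (1 - x) / modC (1 - x +i* y).
  rewrite cos_atan; have -> : 1 + (y / (1 - x)) ^+ 2 = (modC (1 - x +i* y) / (1 - x)) ^+ 2.
    by rewrite [RHS]expr_div_n modC_sqr /=; field; rewrite gt_eqF.
  by rewrite sqrtr_sqr ger0_norm ?invf_div // divr_ge0 ?modC_ge0 // ltW.
have thp := atan_ltpi2 (y / (1 - x)); have thn := atan_gtNpi2 (y / (1 - x)).
rewrite -/th in thp thn; have pi0 := pi_gt0 R.
have -> : argC (1 - x +i* y) = if y <= 0 then acos (cos th) else - acos (cos th).
  by rewrite cth /argC /= sub0r oppr_ge0.
have [y0|y0] := leP y 0.
  have t0 : th <= 0.
    rewrite -atan0 /th; have [<-|yx] := eqVneq 0 (y / (1 - x)); first by [].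
    apply/ltW/lt_atan; rewrite lt_neqAle eq_sym yx /=.
    by rewrite mulr_le0_ge0 // invr_ge0 ltW.
  by rewrite cosKN ?opprK // t0 andbT; lra.
have t0 : 0 < th by rewrite -atan0 /th; apply: lt_atan; rewrite divr_gt0.
by rewrite opprK cosK // in_itv /= ltW //=; lra.
Qed.

Lemma powC_log_sum w a : modC w < 1 -> powC (1 - w) a = expC (- a%:C * log_sum w).
Proof.
move=> w1; have d0 := modC_1sub_gt0 w1.
rewrite /powC /expC /powR gt_eqF //.
have -> : complex.Re (- a%:C * log_sum w) = a * ln (modC (1 - w)).
  have <- : - complex.Re (log_sum w) = ln (modC (1 - w)) by rewrite log_sum_Re // opprK.
  by case: (log_sum w) => x y /=; ring.
have -> // : complex.Im (- a%:C * log_sum w) = a * argC (1 - w).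
have <- : - complex.Im (log_sum w) = argC (1 - w) by rewrite log_sum_Im // opprK.
by case: (log_sum w) => x y /=; ring.
Qed.

(** The case a = 1 of [powC_log_sum]; the rest checks that [modC] and [argC] are polar coordinates
    of 1 - w. *)
Lemma expC_log_sum w : modC w < 1 -> expC (- log_sum w) = 1 - w.
Proof.
move=> w1; have -> : - log_sum w = - 1%:C * log_sum w by rewrite mulN1r.
have d0 := modC_1sub_gt0 w1.
rewrite -powC_log_sum // /powC powRr1 ?ltW // mul1r.
set z := 1 - w in d0 *.
have cz : `|complex.Re z / modC z| <= 1.
  rewrite normrM normfV [X in _ / X]gtr0_norm // ler_pdivrMr // mul1r.
  exact: Re_le_modC.
have ac : acos (complex.Re z / modC z) \in `[0, pi].
  by rewrite in_itv /= acos_ge0 ?acos_lepi // -ler_norml.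
have cosA : cos (argC z) = complex.Re z / modC z.
  rewrite /argC; case: ifP => _; rewrite ?cosN acosK // in_itv /= -ler_norml //.
have sinA : sin (argC z) = complex.Im z / modC z.
  have s2 : sin (acos (complex.Re z / modC z)) = `|complex.Im z| / modC z.
    rewrite sin_acos -?ler_norml // -[RHS]ger0_norm ?divr_ge0 ?modC_ge0 // -sqrtr_sqr.
    congr Num.sqrt.
    rewrite !expr_div_n real_normK ?num_real // -(divff (lt0r_neq0 (exprn_gt0 2 d0))).
    by rewrite modC_sqr; ring.
  rewrite /argC; case: ifP => [h|/negbT]; first by rewrite s2 ger0_norm.
  by rewrite -ltNge => h; rewrite sinN s2 ltr0_norm // mulNr opprK.
rewrite cosA sinA; case: (z) d0 => x y /= d0.
by apply/eqP; rewrite eq_complex /=; apply/andP; split; apply/eqP; field; rewrite gt_eqF.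
Qed.

End Exponential.

(** * Roots of unity of order p^e are dense in the unit circle *)

Section UnitCircle.
Local Open Scope complex_scope.
Variable R : realType.
Implicit Types (t : R) (z u : R[i]).

Definition cis t : R[i] := cos t +i* sin t.

Lemma cisD : {morph cis : t t' / t + t' >-> t * t'}.
Proof.
move=> t t'; rewrite /cis cosD sinD.
by apply/eqP; rewrite eq_complex /=; apply/andP; split; apply/eqP; ring.
Qed.

Lemma cis0 : cis 0 = 1.
Proof. by rewrite /cis cos0 sin0. Qed.

Lemma cisX t n : cis t ^+ n = cis (n%:R * t).
Proof.
elim: n => [|n ih]; first by rewrite mul0r cis0.
by rewrite exprS ih -cisD -natr1 mulrDl mul1r addrC.
Qed.

Lemma cis2pi : cis (2 * pi) = 1.
Proof. by rewrite mulr_natl /cis cos2pi sin2pi. Qed.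

Lemma modC_cis t : modC (cis t) = 1.
Proof. by rewrite /modC normc_def /= cos2Dsin2 sqrtr1. Qed.

Lemma cis_arg u : modC u = 1 -> exists t, u = cis t.
Proof.
case: u => x y u1; have := modC_sqr (x +i* y); rewrite u1 expr1n /= => xy.
have x1 : -1 <= x <= 1.
  by rewrite -ler_norml -u1; exact: (Re_le_modC (x +i* y)).
have sx : sin (acos x) = `|y|.
  by rewrite sin_acos // -sqrtr_sqr; congr Num.sqrt; lra.
have [y0|y0] := leP 0 y.
  by exists (acos x); rewrite /cis acosK ?in_itv // sx ger0_norm.
by exists (- acos x); rewrite /cis cosN sinN acosK ?in_itv // sx ltr0_norm // opprK.
Qed.

Lemma cis_near1 (eps : R) : 0 < eps ->
  exists2 d, 0 < d & forall t, `|t| < d -> modC (cis t - 1) < eps.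
Proof.
move=> e0; have e2 : 0 < eps / 2 by rewrite divr_gt0.
have /cvgrPdist_lt/(_ _ e2) := @continuous_cos R 0.
move=> /nbhs_ballP[d1 /= d10 h1].
have /cvgrPdist_lt/(_ _ e2) := @continuous_sin R 0.
move=> /nbhs_ballP[d2 /= d20 h2].
exists (Num.min d1 d2); first by rewrite lt_min d10.
move=> t; rewrite lt_min => /andP[t1 t2].
have := h1 t; rewrite -ball_normE /= sub0r normrN cos0 => /(_ t1) c1.
have := h2 t; rewrite -ball_normE /= sub0r normrN sin0 sub0r normrN => /(_ t2) s1.
have -> : cis t - 1 = (cos t - 1)%:C + (sin t)%:C * 'i.
  by apply/eqP; rewrite eq_complex /=; apply/andP; split; apply/eqP; ring.
apply: le_lt_trans (modCD _ _) _; rewrite modCM !modC_real modC_i.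
by rewrite mulr1 distrC; lra.
Qed.

Lemma cis_root_neq1 n : (1 < n)%N -> cis (2 * pi / n%:R) != 1.
Proof.
move=> n1; apply/eqP => -[/eqP + _]; rewrite -[X in _ == X]cos0.
have n0 : (0 : R) < n%:R by rewrite ltr0n ltnW.
have pi0 := pi_gt0 R.
rewrite -subr_eq0 => /eqP h.
have : 2 * pi / n%:R = 0 :> R.
  apply: cos_inj; last by apply/eqP; rewrite -subr_eq0 h.
  - rewrite in_itv /= ler_pdivrMr // mulr_ge0 ?invr_ge0 ?ler0n ?mulr_ge0 ?pi_ge0 //=.
    by rewrite [2 * _]mulrC ler_pM2l // ler_nat.
  - by rewrite in_itv /= lexx pi_ge0.
by move/eqP; rewrite mulf_eq0 invr_eq0 !gt_eqF // mulr_gt0.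
Qed.

Lemma cis_root n : (0 < n)%N -> cis (2 * pi / n%:R) ^+ n = 1.
Proof. by move=> n0; rewrite cisX mulrCA mulfV ?mulr1 ?cis2pi // pnatr_eq0 -lt0n. Qed.

Variable p : nat.
Hypothesis p_prime : prime p.

Lemma prime_power_order z e : z ^+ (p ^ e) = 1 ->
  exists2 k, (k <= e)%N & (p ^ k).-primitive_root z.
Proof.
move=> ze; have [|m mz] := prim_order_exists _ ze; first by rewrite expn_gt0 prime_gt0.
by move/(dvdn_pfactor _ _ p_prime)=> [k ke mE]; exists k; rewrite -?mE.
Qed.

Lemma dense_roots u (eps : R) : modC u = 1 -> 0 < eps ->
  exists z e, (p ^ e.+1).-primitive_root z /\ modC (z - u) < eps.
Proof.
move=> u1 e0; have [t0 ->] := cis_arg u1.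
have [d d0 hd] := cis_near1 e0.
have pi0 := pi_gt0 R.
(* Full turns make the argument nonnegative before it is truncated. *)
have [b hb] : exists b, 0 <= t0 + b%:R * (2 * pi).
  have pi2 : 0 < 2 * pi :> R by rewrite mulr_gt0.
  exists (Num.bound (`|t0| / (2 * pi))).
  have : `|t0| / (2 * pi) < (Num.bound (`|t0| / (2 * pi)))%:R.
    by apply: archi_boundP; rewrite divr_ge0 // ltW.
  rewrite ltr_pdivrMr // => h; have := ler_norm (- t0); rewrite normrN; lra.
pose t := t0 + b%:R * (2 * pi).
have ut : cis t0 = cis t by rewrite /t cisD -cisX cis2pi expr1n mulr1.
rewrite {}ut; rewrite -/t in hb.
pose e1 := (Num.bound (2 * pi / d)).+1; pose P := (p ^ e1)%N.
have P1 : (1 < P)%N by rewrite /P -{1}(expn0 p) ltn_exp2l // prime_gt1.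
have P0 : (0 : R) < P%:R by rewrite ltr0n ltnW.
have stepd : 2 * pi / P%:R < d.
  rewrite ltr_pdivrMr // [d * _]mulrC -ltr_pdivrMr //.
  apply: (@lt_le_trans _ _ (Num.bound (2 * pi / d))%:R).
    by apply: archi_boundP; rewrite divr_ge0 ?mulr_ge0 ?pi_ge0 // ltW.
  rewrite ler_nat /P; apply: leq_trans (ltnW (ltn_expl _ (prime_gt1 p_prime))).
  exact: leqnSn.
pose w := cis (2 * pi / P%:R).
have wP : w ^+ P = 1 by apply: cis_root; exact: ltnW.
pose k := Num.truncn (t / (2 * pi / P%:R)).
have step0 : 0 < 2 * pi / P%:R :> R by rewrite divr_gt0 // mulr_gt0.
have /andP[k1 k2] : k%:R <= t / (2 * pi / P%:R) < k.+1%:R.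
  by apply: truncn_itv; rewrite divr_ge0 // ltW.
rewrite ler_pdivlMr // in k1; rewrite ltr_pdivrMr // -natr1 in k2.
have close l : `|l%:R * (2 * pi / P%:R) - t| < d -> modC (w ^+ l - cis t) < eps.
  move=> /hd; have -> : w ^+ l = cis (l%:R * (2 * pi / P%:R) - t) * cis t.
    by rewrite -cisD subrK /w cisX.
  by rewrite -{2}[cis t]mul1r -mulrBl modCM modC_cis mulr1.
(* w^k and w^(k+1) both lie within one step of the target and cannot both be 1; avoiding 1 makes the
   exponent of p in the order positive. *)
have [l [wl hl]] : exists l, w ^+ l != 1 /\ modC (w ^+ l - cis t) < eps.
  have [wk|wk] := eqVneq (w ^+ k) 1; last first.
    by exists k; split=> //; apply: close; rewrite ler0_norm; lra.
  exists k.+1; split; first by rewrite exprS wk mulr1 cis_root_neq1.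
  by apply: close; rewrite -natr1 ger0_norm; lra.
have [|[|j] je zj] := @prime_power_order (w ^+ l) e1.
- by rewrite -exprM mulnC exprM wP expr1n.
- by move: wl; rewrite -(prim_expr_order zj) expn0 expr1 eqxx.
- by exists (w ^+ l), j.
Qed.

(** cis(2 pi / p^(D+1)) has exact order p^(D+1), since its power p^D is cis(2 pi / p), which is not
    1. *)
Lemma large_order_root D : exists z e, (p ^ e.+1).-primitive_root z /\ (D < p ^ e.+1)%N.
Proof.
pose w := cis (2 * pi / (p ^ D.+1)%:R); have p0 := prime_gt0 p_prime.
have wP : w ^+ (p ^ D.+1) = 1 by apply: cis_root; rewrite expn_gt0 p0.
have [k kD wk] := prime_power_order wP.
have Dp : (D < p ^ D.+1)%N.
  by apply: leq_trans (ltnW (ltn_expl _ (prime_gt1 p_prime))).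
move: kD; rewrite leq_eqVlt => /orP[/eqP kD|]; first by exists w, D; split=> //; rewrite -kD.
rewrite ltnS => kD; have : w ^+ (p ^ D) = 1.
  by rewrite -(subnKC kD) expnD exprM (prim_expr_order wk) expr1n.
rewrite /w cisX; have -> : (p ^ D)%:R * (2 * pi / (p ^ D.+1)%:R) = 2 * pi / p%:R :> R.
  have h1 : (p%:R : R) != 0 by rewrite pnatr_eq0 -lt0n.
  have h2 : ((p ^ D)%:R : R) != 0 by rewrite pnatr_eq0 -lt0n expn_gt0 p0.
  by rewrite expnS natrM invfM; field; rewrite h1 h2.
by move/eqP; rewrite (negPf (cis_root_neq1 (prime_gt1 p_prime))).
Qed.

End UnitCircle.

(** * Bounds for polynomials near a point *)

Section PolynomialEstimates.
Local Open Scope complex_scope.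
Variable R : realType.
Implicit Types (f : {poly R[i]}) (P : {poly {poly R[i]}}) (x z : R[i]).

Lemma poly_bounded f (rho : R) :
  exists2 C : R, 0 <= C & forall z, modC z <= rho -> modC f.[z] <= C.
Proof.
exists (\sum_(i < size f) modC f`_i * `|rho| ^+ i).
  by apply: sumr_ge0 => i _; rewrite mulr_ge0 ?modC_ge0 // exprn_ge0.
move=> z zr; rewrite horner_coef; apply: le_trans (modC_sum _ _ _) _.
apply: ler_sum => i _; rewrite modCM modCX ler_wpM2l ?modC_ge0 //.
by apply: lerXn2r; rewrite ?nnegrE ?modC_ge0 // (le_trans zr) // ler_norm.
Qed.

Lemma poly_lipschitz f x (rho : R) : exists2 C : R, 0 <= C &
  forall z, modC z <= rho -> modC (f.[z] - f.[x]) <= C * modC (z - x).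
Proof.
have /factor_theorem[g hg] : root (f - f.[x]%:P) x by rewrite rootE !hornerE subrr.
have [C C0 hC] := poly_bounded g rho; exists C => // z /hC zC.
have -> : f.[z] - f.[x] = g.[z] * (z - x).
  by have := congr1 (fun q : {poly R[i]} => q.[z]) hg; rewrite !hornerE.
by rewrite modCM ler_wpM2r ?modC_ge0.
Qed.

(** h is the multiplicity of the root 0, and the cofactor g stays above |g(0)|/2 near 0. *)
Lemma poly_lower_bound f : f != 0 -> exists h : nat, exists c d : R,
  [/\ (h < size f)%N, 0 < c, 0 < d &
      forall y, modC y < d -> c * modC y ^+ h <= modC f.[y]].
Proof.
move=> f0; have [h [g]] := multiplicity_XsubC f 0; rewrite f0 /= => g0 fE.
rewrite polyC0 subr0 in fE.
have gn0 : g != 0 by apply: contraNneq f0 => g00; rewrite fE g00 mul0r.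
have g00 : 0 < modC g.[0] by rewrite lt_neqAle modC_ge0 andbT eq_sym modC_eq0.
have [C C0 hC] := poly_lipschitz g 0 1.
exists h, (modC g.[0] / 2), (Num.min 1 (modC g.[0] / 2 / (C + 1))).
have C1 : 0 < C + 1 by rewrite ltr_wpDl.
split.
- by rewrite fE size_mulXn // -[X in (X < _)%N]addn0 ltn_add2l lt0n size_poly_eq0.
- by rewrite divr_gt0.
- by rewrite lt_min ltr01 !divr_gt0.
move=> y; rewrite lt_min => /andP[y1 yC].
have := hC _ (ltW y1); rewrite subr0 => h1.
rewrite fE hornerM hornerXn modCM modCX ler_wpM2r ?exprn_ge0 ?modC_ge0 //.
have : modC y * (C + 1) < modC g.[0] / 2 by rewrite -ltr_pdivlMr.
have := modCD g.[y] (g.[0] - g.[y]); rewrite addrC subrK modC_dist.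
by rewrite mulrDr mulr1 [_ * C]mulrC; have := modC_ge0 y; lra.
Qed.

(** A relation could vanish identically at z = x. Removing the highest power of z - x common to its
    coefficients leaves a nonzero specialization there. *)
Lemma split_off_factor P x : P != 0 -> exists P' k,
  [/\ P = (('X - x%:P) ^+ k)%:P * P', map_poly (horner_eval x) P' != 0 &
      size P' = size P].
Proof.
move=> P0; have [k [Q]] := multiplicity_XsubC (swapXY P) x%:P.
rewrite swapXY_eq0 P0 /= => Q0 PE; exists (swapXY Q), k.
have PE' : P = (('X - x%:P) ^+ k)%:P * swapXY Q.
  rewrite -[LHS]swapXYK PE rmorphM rmorphXn rmorphB /= swapXY_X swapXY_polyC map_polyC.
  by rewrite mulrC -polyCB -polyC_exp.
have c0 : ('X - x%:P) ^+ k != 0 by rewrite expf_neq0 // polyXsubC_eq0.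
split=> //; first by rewrite -horner_swapXY swapXYK.
have Q'0 : swapXY Q != 0 by apply: contraNneq P0 => Q'0; rewrite PE' Q'0 mulr0.
by rewrite [in RHS]PE' size_mul ?polyC_eq0 // size_polyC c0.
Qed.

Lemma horner2E P (y z : R[i]) : P.[y%:P].[z] = \sum_(i < size P) (P`_i).[z] * y ^+ i.
Proof.
rewrite (horner_coef P) horner_sum; apply: eq_bigr => i _.
by rewrite hornerM horner_exp hornerC.
Qed.

Lemma horner2_lipschitz P x (rho : R) : exists2 C : R, 0 <= C & forall y z,
  modC y <= 1 -> modC z <= rho ->
  modC (P.[y%:P].[z] - P.[y%:P].[x]) <= C * modC (z - x).
Proof.
have h i : exists C : R, 0 <= C /\
    forall z, modC z <= rho -> modC ((P`_i).[z] - (P`_i).[x]) <= C * modC (z - x).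
  by have [C C0 hC] := poly_lipschitz P`_i x rho; exists C.
have [C hC] := choice h; exists (\sum_(i < size P) C i).
  by apply: sumr_ge0 => i _; have [] := hC i.
move=> y z y1 zr; rewrite !horner2E -sumrB mulr_suml.
apply: le_trans (modC_sum _ _ _) _; apply: ler_sum => i _.
rewrite -mulrBl modCM modCX; have [C0 /(_ z zr) h1] := hC i.
apply: le_trans h1; rewrite ler_piMr ?modC_ge0 // exprn_ile1 ?modC_ge0 //.
Qed.

End PolynomialEstimates.


(** * Behaviour of the two series near the boundary *)

Section Weighted.
Variables (R : realType) (b w : nat -> R) (alpha kap B : R).
Hypothesis partial_bounds :
  forall l, - (alpha * l%:R) - B <= \sum_(k < l) b k <= - (kap * l%:R) + B.
Hypothesis w_ge0 : forall k, 0 <= w k.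
Hypothesis w_decr : forall k, w k.+1 <= w k.

(** Abel summation for b + kap and -b - alpha, whose partial sums are at most B. *)
Lemma weighted_partial_bounds n :
  - (alpha * \sum_(k < n) w k) - B * w 0%N <= \sum_(k < n) b k * w k <=
  - (kap * \sum_(k < n) w k) + B * w 0%N.
Proof.
apply/andP; split.
  have := @abel_le _ (fun k => - b k - alpha) w B n w_ge0 w_decr.
  have h l : \sum_(k < l) (- b k - alpha) <= B.
    have /andP[] := partial_bounds l.
    rewrite big_split /= sumrN sumr_const card_ord -mulr_natr; lra.
  move/(_ h); under eq_bigr do rewrite mulrBl mulNr.
  rewrite big_split /= !sumrN -mulr_sumr; lra.
have := @abel_le _ (fun k => b k + kap) w B n w_ge0 w_decr.
have h l : \sum_(k < l) (b k + kap) <= B.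
  have /andP[_] := partial_bounds l.
  rewrite big_split /= sumr_const card_ord -mulr_natr; lra.
move/(_ h); under eq_bigr do rewrite mulrDl.
rewrite big_split /= -mulr_sumr; lra.
Qed.

Lemma weighted_limit_bounds (l W : R) :
  series (fun k => b k * w k) @ \oo --> l -> series w @ \oo --> W ->
  - (alpha * W) - B * w 0%N <= l <= - (kap * W) + B * w 0%N.
Proof.
move=> hl hW; apply/andP; split.
  apply: (@ler_cvg_to _ _ _ _ (fun n => - (alpha * series w n) - B * w 0%N) _ _ _ _ hl).
    by apply: cvgB; [apply: cvgN; apply: cvgMr|exact: cvg_cst].
  apply: nearW => n; have /andP[+ _] := weighted_partial_bounds n.
  by rewrite /series /= !big_mkord.
apply: (@ler_cvg_to _ _ _ _ _ (fun n => - (kap * series w n) + B * w 0%N) _ _ hl).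
  by apply: cvgD; [apply: cvgN; apply: cvgMr|exact: cvg_cst].
apply: nearW => n; have /andP[_] := weighted_partial_bounds n.
by rewrite /series /= !big_mkord.
Qed.

End Weighted.

Section CountingSeries.
Local Open Scope complex_scope.
Variables (R : realType) (cnt : nat -> nat) (a : nat -> R) (r : R).
Hypothesis r_gt0 : 0 < r.
Hypothesis a_bounds : forall k, 0 <= a k <= 1.
Hypothesis cntE : forall k, (0 < k)%N -> (cnt k)%:R = r ^+ k * a k.

Let F_term (z : R[i]) k : R[i] := (cnt k.+1)%:R * z ^+ k.+1.
Let Z_term (z : R[i]) k : R[i] := (cnt k.+1)%:R / k.+1%:R * z ^+ k.+1.

Let cntC k : ((cnt k.+1)%:R : R[i]) = (r ^+ k.+1 * a k.+1)%:C.
Proof. by rewrite -cntE // rmorph_nat. Qed.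

Let F_term_le z k : modC (F_term z k) <= (r * modC z) * (r * modC z) ^+ k.
Proof.
have /andP[a0 a1] := a_bounds k.+1.
have r0 := ltW r_gt0.
rewrite -exprS exprMn modCM modCX cntC modC_real ger0_norm ?mulr_ge0 ?exprn_ge0 //.
rewrite -mulrA ler_wpM2l ?exprn_ge0 //.
by rewrite ler_piMl ?exprn_ge0 ?modC_ge0.
Qed.

Let Z_termE z k : Z_term z k = F_term z k * (k.+1%:R^-1)%:C.
Proof. by rewrite /Z_term fmorphV rmorph_nat mulrAC. Qed.

Let Z_term_le z k : modC (Z_term z k) <= (r * modC z) * (r * modC z) ^+ k.
Proof.
apply: le_trans (F_term_le z k); rewrite Z_termE modCM modC_real ger0_norm ?invr_ge0 //.
by rewrite ler_piMr ?modC_ge0 // invf_le1 ?ltr0n // ler1n.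
Qed.

Let disk z : open_disk (r^-1)%:C z -> 0 <= r * modC z < 1.
Proof.
rewrite /open_disk /= modCE ltcR => h; rewrite mulr_ge0 ?modC_ge0 ?(ltW r_gt0) //=.
by rewrite mulrC -ltr_pdivlMr // mul1r.
Qed.

Lemma counting_series_cvg z : open_disk (r^-1)%:C z ->
  series_cvg (F_term z) /\ series_cvg (Z_term z).
Proof.
move=> /disk/andP[q0 q1].
have [h1 _] := complex_series_geo q0 q1 (F_term_le z).
by have [h2 _] := complex_series_geo q0 q1 (Z_term_le z).
Qed.

Variables (xi : R[i]) (q : nat) (kap B : R).
Hypothesis xi1 : modC xi = 1.
Hypothesis q_gt0 : (0 < q)%N.
Hypothesis kap_gt0 : 0 < kap.
Hypothesis B_ge0 : 0 <= B.
Hypothesis partial_bounds : forall l, - (l%:R / q%:R) - B <=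
  \sum_(k < l) a k.+1 * complex.Re (xi ^+ k.+1) <= - (kap * l%:R) + B.

Let F z : R[i] := series_sum (F_term z).
Let Z z : R[i] := expC (series_sum (Z_term z)).

(** The boundary point, approached radially by [pt s] as s -> 1. *)
Let W := (r^-1)%:C * xi.
Let pt (s : R) : R[i] := s%:C * W.

Let modC_W : modC W = r^-1.
Proof. by rewrite modCM xi1 mulr1 modC_real gtr0_norm ?invr_gt0. Qed.

Lemma pt_disk s : 0 <= s < 1 -> open_disk (r^-1)%:C (pt s).
Proof.
move=> /andP[s0 s1]; rewrite /open_disk /= modCE ltcR modCM modC_W modC_real ger0_norm //.
by rewrite gtr_pMl // invr_gt0.
Qed.

Lemma pt_dist s : s <= 1 -> modC (pt s - W) = (1 - s) / r.
Proof.
move=> s1; rewrite modC_dist /pt -{1}[W]mul1r -mulrBl modCM modC_W.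
by rewrite -[1]/(1%:C) -rmorphB modC_real ger0_norm ?subr_ge0.
Qed.

Let F_term_Re s k :
  complex.Re (F_term (pt s) k) = a k.+1 * complex.Re (xi ^+ k.+1) * s ^+ k.+1.
Proof.
have -> : F_term (pt s) k = (a k.+1 * s ^+ k.+1)%:C * xi ^+ k.+1.
  have rk : r ^+ k.+1 * (r^-1) ^+ k.+1 = 1 by rewrite -exprMn mulfV ?expr1n // gt_eqF.
  have -> : a k.+1 * s ^+ k.+1 = r ^+ k.+1 * a k.+1 * (s ^+ k.+1 * (r^-1) ^+ k.+1).
    by rewrite -[LHS]mul1r -rk; ring.
  by rewrite /F_term cntC /pt /W !exprMn !rmorphM !rmorphXn; ring.
by case: (xi ^+ _) => x y /=; ring.
Qed.

Let Z_term_Re s k : complex.Re (Z_term (pt s) k) =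
  a k.+1 * complex.Re (xi ^+ k.+1) * (s ^+ k.+1 / k.+1%:R).
Proof.
rewrite Z_termE mulrA -F_term_Re; case: (F_term _ _) => x y /=; ring.
Qed.

Let bounds' l : - (q%:R^-1 * l%:R) - B <=
  \sum_(k < l) a k.+1 * complex.Re (xi ^+ k.+1) <= - (kap * l%:R) + B.
Proof. by rewrite [q%:R^-1 * _]mulrC. Qed.

Lemma counting_sum_Re_le s : 0 < s < 1 -> complex.Re (F (pt s)) <= - (kap * (s / (1 - s))) + B.
Proof.
move=> /andP[s0 s1]; have /disk/andP[q0 q1] : open_disk (r^-1)%:C (pt s).
  by apply: pt_disk; rewrite ltW.
have [_ [h _]] := complex_series_geo q0 q1 (F_term_le (pt s)).
rewrite (_ : (fun k => complex.Re (F_term (pt s) k)) =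
  (fun k => a k.+1 * complex.Re (xi ^+ k.+1) * s ^+ k.+1)) in h; last first.
  by apply/funext => k; rewrite F_term_Re.
have hW : series (fun k => s ^+ k.+1) @ \oo --> s / (1 - s).
  have := @cvg_geometric_series R s s; rewrite ger0_norm ?ltW // => /(_ s1).
  by rewrite (_ : geometric s s = (fun k => s ^+ k.+1)) //; apply/funext => k; rewrite exprS.
have /andP[_ h2] := weighted_limit_bounds (w := fun k => s ^+ k.+1) bounds'
  (fun k => exprn_ge0 _ (ltW s0)) (fun k => ler_wiXn2l (ltW s0) (ltW s1) (leqnSn _)) h hW.
apply: le_trans h2 _; by rewrite lerD2l expr1 ler_piMr // ltW.
Qed.

(** The weights s^(k+1)/(k+1) have the sum -ln(1 - s), so after exponentiation |zeta| lies between
    multiples of (1 - s)^(1/q) and (1 - s)^kap. *)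
Lemma log_zeta_Re_bounds s : 0 < s < 1 ->
  q%:R^-1 * ln (1 - s) - B <= complex.Re (series_sum (Z_term (pt s))) <=
  kap * ln (1 - s) + B.
Proof.
move=> /andP[s0 s1]; have /disk/andP[q0 q1] : open_disk (r^-1)%:C (pt s).
  by apply: pt_disk; rewrite ltW.
have [_ [h _]] := complex_series_geo q0 q1 (Z_term_le (pt s)).
rewrite (_ : (fun k => complex.Re (Z_term (pt s) k)) =
  (fun k => a k.+1 * complex.Re (xi ^+ k.+1) * (s ^+ k.+1 / k.+1%:R))) in h; last first.
  by apply/funext => k; rewrite Z_term_Re.
have hW : series (fun k => s ^+ k.+1 / k.+1%:R) @ \oo --> - ln (1 - s).
  have := @log_series_Re R s%:C; rewrite modC_real gtr0_norm // => /(_ s1).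
  have -> : modC (1 - s%:C) = 1 - s.
    by rewrite -[1]/(1%:C) -rmorphB modC_real ger0_norm // subr_ge0 ltW.
  rewrite (_ : (fun k => complex.Re (s%:C ^+ k.+1) / k.+1%:R) = (fun k => s ^+ k.+1 / k.+1%:R)) //.
  by apply/funext => k; rewrite -rmorphXn.
have w0 k : 0 <= s ^+ k.+1 / k.+1%:R by rewrite divr_ge0 ?exprn_ge0 ?ltW.
have wS k : s ^+ k.+2 / k.+2%:R <= s ^+ k.+1 / k.+1%:R.
  apply: ler_pM; rewrite ?exprn_ge0 ?invr_ge0 ?(ltW s0) //.
    by apply: ler_wiXn2l; rewrite ?ltW.
  by rewrite lef_pV2 ?posrE ?ltr0n // ler_nat.
have := weighted_limit_bounds bounds' w0 wS h hW.
rewrite !mulrN !opprK expr1 divr1 => /andP[h1 h2].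
have Bs : B * s <= B by rewrite ler_piMr // ltW.
by apply/andP; split; lra.
Qed.

Lemma zeta_lower_bound s : 0 < s < 1 -> expR (- (B * q%:R)) * (1 - s) <= modC (Z (pt s)) ^+ q.
Proof.
move=> s01; have /andP[h _] := log_zeta_Re_bounds s01; have /andP[_ s1] := s01.
rewrite modC_expC -expRM_natl -[X in _ * X]lnK ?posrE ?subr_gt0 // -expRD ler_expR.
have q0 : (0 : R) < q%:R by rewrite ltr0n.
have : q%:R * (q%:R^-1 * ln (1 - s) - B) <= q%:R * complex.Re (series_sum (Z_term (pt s))).
  by rewrite ler_pM2l.
by rewrite mulrBr mulrA mulfV ?gt_eqF // mul1r -mulr_natl; lra.
Qed.

Lemma zeta_tends_to0 eps : 0 < eps -> exists2 d, 0 < d < 1 &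
  forall s, 1 - d < s < 1 -> modC (Z (pt s)) < eps.
Proof.
(* Chosen so that kap * ln d1 + B = ln eps - 1. *)
move=> e0; pose d1 := expR ((ln eps - B - 1) / kap).
have d10 : 0 < d1 by exact: expR_gt0.
exists (Num.min d1 2^-1); first by rewrite lt_min d10 gt_min; apply/andP; split; lra.
move=> s /andP[sd s1].
have [sd1 sd2] : 1 - s < d1 /\ 1 - s < 2^-1.
  have : 1 - s < Num.min d1 2^-1 by lra.
  by rewrite lt_min => /andP[].
have s01 : 0 < s < 1 by apply/andP; split; lra.
have /andP[_ h] := log_zeta_Re_bounds s01.
rewrite modC_expC -[eps]lnK ?posrE // ltr_expR; apply: le_lt_trans h _.
have : ln (1 - s) < (ln eps - B - 1) / kap.
  by rewrite -[X in _ < X]expRK ltr_ln ?posrE ?subr_gt0.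
by rewrite ltr_pdivlMr // mulrC; lra.
Qed.

(* |Z (pt s)| tends to 0 as s -> 1, but is at least a constant times the power
   1/q of 1 - s. *)
Lemma zeta_slow_decay h C d : (h < q)%N -> 0 < d ->
  (forall s, 0 < s < 1 -> 1 - d < s -> modC (Z (pt s)) ^+ h <= C * (1 - s)) -> False.
Proof.
move=> hq d0 hC; pose c := expR (- (B * q%:R)).
have c0 : 0 < c by exact: expR_gt0.
have C0 : 0 < `|C| + 1 by rewrite ltr_wpDl.
(* The bounds will give c <= (|C| + 1) y^(q-h) <= (|C| + 1) y, which this threshold for y
   contradicts. *)
have [|d2 /andP[d20 d21] hd2] := @zeta_tends_to0 (Num.min 1 (c / (`|C| + 1))).
  by rewrite lt_min ltr01 divr_gt0.
pose s := 1 - Num.min d d2 / 2.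
have m0 : 0 < Num.min d d2 by rewrite lt_min d0.
have md : Num.min d d2 <= d by rewrite ge_min lexx.
have md2 : Num.min d d2 <= d2 by rewrite ge_min lexx orbT.
have s01 : 0 < s < 1 by rewrite /s; apply/andP; split; lra.
have hs1 : 1 - d < s by rewrite /s; lra.
have hs2 : 1 - d2 < s < 1 by rewrite /s; apply/andP; split; lra.
have := hd2 _ hs2; rewrite lt_min; set y := modC _ => /andP[y1 yc].
have y0 : 0 < y by rewrite /y modC_expC expR_gt0.
have /andP[_ s1] := s01.
have h1 := hC _ s01 hs1; have h2 := zeta_lower_bound s01; rewrite -/y -/c in h1 h2.
have : c * y ^+ h <= (`|C| + 1) * y ^+ q.
  apply: (@le_trans _ _ (c * (C * (1 - s)))); first by rewrite ler_pM2l.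
  rewrite mulrCA; apply: (@le_trans _ _ ((`|C| + 1) * (c * (1 - s)))).
    rewrite ler_wpM2r // ?mulr_ge0 ?subr_ge0 ?ltW //.
    by apply: le_lt_trans (ler_norm C) _; rewrite ltrDl.
  by rewrite ler_pM2l.
apply/negP; rewrite -ltNge.
have -> : q = (q - h + h)%N by rewrite subnK // ltnW.
rewrite exprD mulrA ltr_pM2r ?exprn_gt0 //.
have yq : y ^+ (q - h) <= y.
  by rewrite -[leRHS]expr1; apply: ler_wiXn2l; rewrite ?ltW // subn_gt0.
apply: le_lt_trans (ler_wpM2l (ltW C0) yq) _.
by rewrite mulrC -ltr_pdivlMr.
Qed.

(** By continuity g W = 0, so the Lipschitz bound reads |Z (pt s)| <= (L/r) (1 - s): the case h = 1
    of [zeta_slow_decay]. *)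
Lemma zeta_no_continuation (g : R[i] -> R[i]) (d : R) : (1 < q)%N -> 0 < d ->
  (forall z, modC (z - W) < d -> open_disk (r^-1)%:C z -> g z = Z z) ->
  ~ analytic_at g W.
Proof.
move=> q1 d0 gZ /analytic_at_lipschitz[L [d' [L0 d'0 hL]]].
pose d1 := Num.min d d' * r; have d10 : 0 < d1 by rewrite mulr_gt0 // lt_min d0.
have near s : 0 < s < 1 -> 1 - d1 < s -> modC (pt s - W) < Num.min d d'.
  by move=> /andP[s0 s1] sd; rewrite (pt_dist (ltW s1)) ltr_pdivrMr // -/d1; lra.
have lip s : 0 < s < 1 -> 1 - d1 < s -> modC (Z (pt s) - g W) <= L * ((1 - s) / r).
  move=> s01 /(near _ s01); rewrite lt_min => /andP[h1 h2].
  have /andP[s0 s1] := s01.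
  rewrite -(pt_dist (ltW s1)) -gZ //; first exact: hL.
  by apply: pt_disk; rewrite ltW.
have gW : g W = 0.
  apply/eqP; rewrite -modC_eq0 eq_le modC_ge0 andbT; apply/ler_addgt0Pr => eps eps0.
  have e2 : 0 < eps / 2 by rewrite divr_gt0.
  have [d2 /andP[d20 d21] hd2] := zeta_tends_to0 e2.
  pose d3 := Num.min (Num.min d1 d2) (eps / 2 / L * r).
  have d30 : 0 < d3 by rewrite !lt_min d10 d20 mulr_gt0 // divr_gt0.
  pose s := 1 - d3 / 2.
  have [m1 m2 m3] : [/\ d3 <= d1, d3 <= d2 & d3 <= eps / 2 / L * r].
    by rewrite /d3 !ge_min !lexx !orbT.
  have s01 : 0 < s < 1 by rewrite /s; apply/andP; split; lra.
  have hs1 : 1 - d1 < s by rewrite /s; lra.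
  have hs2 : 1 - d2 < s < 1 by rewrite /s; apply/andP; split; lra.
  have l1 := lip _ s01 hs1; have l2 := hd2 _ hs2.
  have l3 : L * ((1 - s) / r) <= eps / 2.
    rewrite mulrA ler_pdivrMr // mulrC -ler_pdivlMr //.
    by rewrite mulrAC; apply: le_trans m3; rewrite /s; lra.
  have -> : g W = Z (pt s) - (Z (pt s) - g W) by ring.
  by have := modCD (Z (pt s)) (- (Z (pt s) - g W)); rewrite modCN add0r; lra.
apply: (@zeta_slow_decay 1 (L / r) d1) => // s s01 sd.
by rewrite expr1 -[Z _]subr0 -gW mulrAC -mulrA; exact: lip.
Qed.

(** g is bounded near W, whereas the real part of the series is at most -kap s/(1 - s) + B. *)
Lemma counting_sum_no_continuation (g : R[i] -> R[i]) (d : R) : 0 < d ->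
  (forall z, modC (z - W) < d -> open_disk (r^-1)%:C z -> g z = F z) ->
  ~ analytic_at g W.
Proof.
move=> d0 gF /analytic_at_lipschitz[L [d' [L0 d'0 hL]]].
pose d1 := Num.min d d' * r; have d10 : 0 < d1 by rewrite mulr_gt0 // lt_min d0.
pose D := modC (g W) + L / r + B + 1.
have D0 : 0 < D by rewrite ltr_wpDl // !addr_ge0 ?modC_ge0 // divr_ge0 // ltW.
(* With s >= 1/2 and 1 - s <= kap/(2 D), the quantity kap s/(1 - s) is at least D, which exceeds the
   bound for |F| by B + 1. *)
pose d2 := Num.min (Num.min d1 1) (kap / D) / 2.
have d20 : 0 < d2 by rewrite divr_gt0 // !lt_min d10 ltr01 divr_gt0.
pose s := 1 - d2.
have [m1 m2 m3] : [/\ d2 * 2 <= d1, d2 * 2 <= 1 & d2 * 2 <= kap / D].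
  by rewrite /d2 divfK ?pnatr_eq0 // !ge_min !lexx !orbT.
have s01 : 0 < s < 1 by rewrite /s; apply/andP; split; lra.
have /andP[s0 s1] := s01.
have : modC (pt s - W) < Num.min d d'.
  by rewrite (pt_dist (ltW s1)) ltr_pdivrMr // -/d1 /s; lra.
rewrite lt_min => /andP[h1 h2].
have gE : g (pt s) = F (pt s) by apply: gF => //; apply: pt_disk; rewrite ltW.
have := hL _ h2; rewrite (pt_dist (ltW s1)) gE => l1.
have l2 : L * ((1 - s) / r) <= L / r.
  by rewrite ler_pM2l // ler_piMl ?invr_ge0 ?(ltW r_gt0) //; lra.
have l3 : modC (F (pt s)) <= modC (g W) + L / r.
  have -> : F (pt s) = (F (pt s) - g W) + g W by rewrite subrK.
  by have := modCD (F (pt s) - g W) (g W); lra.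
have l4 := counting_sum_Re_le s01.
have l5 := Re_le_modC (F (pt s)); rewrite ler_norml in l5; case/andP: l5 => l5 _.
have l6 : D <= kap * (s / (1 - s)).
  have -> : 1 - s = d2 by rewrite /s; ring.
  rewrite ler_pdivlMr // in m3; rewrite mulrA ler_pdivlMr //.
  have : kap * 2^-1 <= kap * s by rewrite ler_pM2l // /s; lra.
  lra.
rewrite /D in l6; lra.
Qed.

(* Near W, P(W, y) has the order of y^h with h < size P, whereas
   P(W, y) - P(z, y) = O(z - W). *)
Lemma zeta_not_root (P : {poly {poly R[i]}}) : P != 0 -> (size P <= q)%N ->
  ~ forall z, open_disk (r^-1)%:C z -> P.[(Z z)%:P].[z] = 0.
Proof.
move=> P0 Pq PZ; have [P' [k [PE H0 sP']]] := split_off_factor W P0.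
have [h [c [d [hH c0 d0 hc]]]] := poly_lower_bound H0.
have {}hH : (h < q)%N.
  by apply: leq_trans hH _; apply: leq_trans Pq; rewrite -sP'; exact: size_poly.
have [C C0 hC] := horner2_lipschitz P' W r^-1.
(* The 1 is for [horner2_lipschitz], the [d] for the lower bound [hc]. *)
have m0 : 0 < Num.min 1 d by rewrite lt_min ltr01.
have [d2 /andP[d20 d21] hd2] := zeta_tends_to0 m0.
apply: (zeta_slow_decay (h := h) (C := C / r / c) (d := d2)) => // s s01 sd.
have /andP[s0 s1] := s01.
have := hd2 s; rewrite sd s1 lt_min => /(_ isT).
set z := pt s; set y := Z z => /andP[y1 yd].
have zdisk : open_disk (r^-1)%:C z by apply: pt_disk; rewrite ltW.
have zW : z - W != 0.
  rewrite -modC_eq0 /z (pt_dist (ltW s1)) mulf_neq0 ?invr_eq0 ?gt_eqF //.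
  by rewrite subr_gt0.
have P'0 : P'.[y%:P].[z] = 0.
  have := PZ _ zdisk; rewrite -/y PE hornerM hornerC hornerM horner_exp hornerXsubC.
  by move/eqP; rewrite mulf_eq0 expf_eq0 (negPf zW) andbF => /eqP.
have HE : (map_poly (horner_eval W) P').[y] = P'.[y%:P].[W].
  by rewrite -[RHS](horner_evalE W) -horner_map /= horner_evalE hornerC.
have zr : modC z <= r^-1.
  by move: zdisk; rewrite /open_disk /= modCE ltcR => /ltW.
have := hC y z (ltW y1) zr; rewrite P'0 sub0r modCN -HE => h1.
have h2 := le_trans (hc _ yd) h1.
rewrite /z (pt_dist (ltW s1)) mulrC -ler_pdivlMr // in h2.
apply: le_trans h2 _; rewrite le_eqVlt; apply/orP; left; apply/eqP; ring.
Qed.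

End CountingSeries.

(** * The algebraic case *)

Section NumFieldLimitsAlgebra.
Variable C : numFieldType.
Implicit Types (u v : nat -> C) (l c : C).

Lemma climD u v l l' : clim u l -> clim v l' -> clim (fun n => u n + v n) (l + l').
Proof. by move=> /climP h /climP h'; apply/climP; exact: cvgD. Qed.

Lemma climMl c u l : clim u l -> clim (fun n => c * u n) (c * l).
Proof. by move=> /climP h; apply/climP; exact: cvgMr. Qed.

Lemma clim_sum (I : Type) (s : seq I) (P : pred I) (u : I -> nat -> C) (l : I -> C) :
  (forall i, P i -> clim (u i) (l i)) ->
  clim (fun n => \sum_(i <- s | P i) u i n) (\sum_(i <- s | P i) l i).
Proof.
move=> h; elim: s => [|i s ih].
  by apply/climP; rewrite big_nil; under eq_fun do rewrite big_nil; exact: cvg_cst.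
rewrite big_cons; under eq_fun do rewrite big_cons.
case: ifP => // Pi; exact: climD (h i Pi) ih.
Qed.

End NumFieldLimitsAlgebra.

Section LogSubseries.
Local Open Scope complex_scope.
Variable R : realType.
Implicit Types w z : R[i].

(** Only the terms w^(L l)/(L l) survive, so the partial sum up to n is 1/L times the one up to
    [n %/ L] of the series at w^L. *)
Lemma log_subseries w (L : nat) : modC w < 1 -> (0 < L)%N ->
  clim (series (fun k => (L %| k.+1)%N%:R * (w ^+ k.+1 / k.+1%:R)))
    (L%:R^-1 * log_sum (w ^+ L)).
Proof.
move=> w1 L0.
have wL : modC (w ^+ L) < 1 by rewrite modCX exprn_ilt1 ?modC_ge0 // -lt0n.
have partialE n : series (fun k => (L %| k.+1)%N%:R * (w ^+ k.+1 / k.+1%:R)) n =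
    L%:R^-1 * series (fun k => (w ^+ L) ^+ k.+1 / k.+1%:R) (n %/ L)%N.
  elim: n => [|n ih]; first by rewrite div0n /series /= !big_geq // mulr0.
  rewrite {1}/series /= big_nat_recr //= -[X in X + _]/(series _ n) ih divnS //.
  have [Ln|_] := boolP (L %| n.+1)%N; last by rewrite mul0r addr0 add0n.
  rewrite add1n /series /= big_nat_recr //= mulrDr mul1r; congr (_ + _).
  have nE : n.+1 = (L * (n %/ L).+1)%N.
    by rewrite -{1}(divnK Ln) divnS // Ln add1n mulnC.
  by rewrite {1 2}nE exprM natrM invfM mulrCA.
apply/clim_modP => e e0.
have /clim_modP/(_ _ e0)[n0 hn] :=
  climMl L%:R^-1 (series_cvg_clim (log_sum_cvg wL)).
by exists (n0 * L)%N => n nn; rewrite partialE; apply: (hn _); rewrite leq_divRL.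
Qed.

End LogSubseries.

Section RationalCase.
Local Open Scope complex_scope.
Variables (R : realType) (cnt : nat -> nat) (r : R) (M : nat) (m : 'I_M -> nat).
Hypothesis r_gt0 : 0 < r.
Hypothesis m_gt0 : forall i, (0 < m i)%N.
Hypothesis cntE : forall k, (0 < k)%N ->
  (cnt k)%:R = r ^+ k * \prod_i (~~ (m i %| k)%N)%:R.

Let L (I : {set 'I_M}) := \big[lcmn/1%N]_(i in I) m i.

Let L_gt0 I : (0 < L I)%N.
Proof. by rewrite /L; elim/big_ind: _ => // x y; rewrite lcmn_gt0 => -> ->. Qed.

Let L_dvd I k : (L I %| k)%N = [forall i in I, (m i %| k)%N].
Proof. by apply/dvdn_biglcmP/forall_inP => h i /h. Qed.

Lemma inclusion_exclusion k : \prod_i (~~ (m i %| k)%N)%:R =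
  \sum_(I : {set 'I_M}) (-1) ^+ #|I| * (L I %| k)%N%:R :> R[i].
Proof.
transitivity (\prod_i (- (m i %| k)%N%:R + 1) : R[i]).
  by apply: eq_bigr => i _; case: (_ %| _)%N; rewrite ?addNr ?oppr0 ?add0r.
rewrite bigA_distr; apply: eq_bigr => I _.
rewrite (bigID (mem I)) /= [X in _ * X]big1 ?mulr1; last by move=> i /negPf->.
rewrite (eq_bigr (fun i => - 1 * (m i %| k)%N%:R)); last by move=> i ->; rewrite mulN1r.
rewrite big_split /= prodr_const; congr (_ * _).
rewrite L_dvd -big_andE; elim/big_rec2: _ => // i b x _ ->.
by case: (_ %| _)%N; case: b; rewrite ?mulr0 ?mul0r ?mulr1.
Qed.

(** The exponent of 1 - (r z)^(L I) in zeta is [- expo I], because [log_sum] is minus a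
    logarithm. *)
Let expo (I : {set 'I_M}) : R := (-1) ^+ #|I| / (L I)%:R.

Let Z (z : R[i]) : R[i] :=
  expC (series_sum (fun k => (cnt k.+1)%:R / k.+1%:R * z ^+ k.+1)).

Let disk z : open_disk (r^-1)%:C z -> modC (r%:C * z) < 1.
Proof.
rewrite /open_disk /= modCE ltcR modCM modC_real gtr0_norm //.
by rewrite mulrC -ltr_pdivlMr // mul1r.
Qed.

Lemma zeta_clim z : open_disk (r^-1)%:C z ->
  clim (series (fun k => (cnt k.+1)%:R / k.+1%:R * z ^+ k.+1))
    (\sum_(I : {set 'I_M}) (expo I)%:C * log_sum ((r%:C * z) ^+ L I)).
Proof.
move=> /disk; set w := r%:C * z => w1.
have -> : series (fun k => (cnt k.+1)%:R / k.+1%:R * z ^+ k.+1) = fun n =>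
    \sum_(I : {set 'I_M}) (-1) ^+ #|I| *
      series (fun k => (L I %| k.+1)%N%:R * (w ^+ k.+1 / k.+1%:R)) n.
  apply/funext => n; rewrite /series /=; under [RHS]eq_bigr do rewrite mulr_sumr.
  rewrite exchange_big /=; apply: eq_bigr => k _.
  have -> : ((cnt k.+1)%:R : R[i]) = r%:C ^+ k.+1 * \prod_i (~~ (m i %| k.+1)%N)%:R.
    rewrite -(rmorph_nat (real_complex R)) cntE // rmorphM rmorphXn rmorph_prod.
    by congr (_ * _); apply: eq_bigr => i _; rewrite rmorph_nat.
  rewrite inclusion_exclusion mulr_sumr !mulr_suml; apply: eq_bigr => I _.
  by rewrite exprMn; ring.
apply: clim_sum => I _.
have -> : (expo I)%:C * log_sum (w ^+ L I) =
    (-1) ^+ #|I| * ((L I)%:R^-1 * log_sum (w ^+ L I)).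
  by rewrite rmorphM rmorphXn rmorphN1 fmorphV rmorph_nat mulrA.
exact/climMl/log_subseries.
Qed.

Let factor (I : {set 'I_M}) z := expC ((expo I)%:C * log_sum ((r%:C * z) ^+ L I)).

Let Z_factor z : open_disk (r^-1)%:C z -> Z z = \prod_(I : {set 'I_M}) factor I z.
Proof. by move=> /zeta_clim/series_climP[_ zE]; rewrite /Z zE expC_sum. Qed.

Let disk_pow z I : open_disk (r^-1)%:C z -> modC ((r%:C * z) ^+ L I) < 1.
Proof. by move=> /disk h; rewrite modCX exprn_ilt1 ?modC_ge0 // -lt0n. Qed.

Lemma zeta_product z : open_disk (r^-1)%:C z ->
  Z z = (1 - r%:C * z)^-1 * \prod_(1 <= l < M.+1) \prod_(I : {set 'I_M} | #|I| == l)
    powC (1 - (r%:C * z) ^+ L I) ((-1) ^+ l.+1 / (L I)%:R).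
Proof.
move=> zd; rewrite Z_factor //.
rewrite (partition_big (fun I : {set 'I_M} => inord #|I| : 'I_M.+1) predT) //=.
have cardM (I : {set 'I_M}) : (#|I| < M.+1)%N by rewrite ltnS -[X in (_ <= X)%N]card_ord max_card.
(* Cardinality 0 is the empty set alone, with lcm 1: it gives (1 - r z)^-1. *)
rewrite big_ord_recl /=; congr (_ * _).
  rewrite (big_pred1 finset.set0) => [|I]; last first.
    by rewrite -val_eqE /= inordK // cards_eq0.
  rewrite /factor /expo /L cards0 big_set0 expr0 divr1 mul1r expr1.
  by rewrite -[log_sum _]opprK expCN expC_log_sum // disk.
rewrite big_add1 big_mkord; apply: eq_bigr => l _.
apply: eq_big => [I|I]; first by rewrite -val_eqE /= inordK.
rewrite -val_eqE /= inordK // => /eqP cI.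
rewrite powC_log_sum; last exact: disk_pow.
rewrite /factor.
suff -> : expo I = - ((-1) ^+ l.+2 / (L I)%:R) by rewrite rmorphN.
by rewrite /expo cI /bump leq0n add1n [in RHS]exprS mulN1r mulNr opprK.
Qed.

(* Functions with a power in C(z), a class closed under products. *)
Let radical (f : R[i] -> R[i]) := exists n (U V : {poly R[i]}),
  [/\ (0 < n)%N, U != 0 & forall z, open_disk (r^-1)%:C z -> f z ^+ n * U.[z] = V.[z]].

Let radicalM f g : radical f -> radical g -> radical (fun z => f z * g z).
Proof.
move=> [n [U [V [n0 U0 h]]]] [n' [U' [V' [n'0 U'0 h']]]].
exists (n * n')%N, (U ^+ n' * U' ^+ n), (V ^+ n' * V' ^+ n); split.
- by rewrite muln_gt0 n0.
- by rewrite mulf_neq0 // expf_neq0.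
move=> z zd; rewrite !hornerM !horner_exp -(h _ zd) -(h' _ zd) !exprMn -!exprM.
by rewrite [(n' * n)%N]mulnC; ring.
Qed.

(** The power [L I] clears the denominator of [expo I], leaving 1 - (r z)^(L I) or its inverse
    according to the parity of the cardinality. *)
Let radical_factor I : radical (factor I).
Proof.
pose Q : {poly R[i]} := 1 - (r%:C ^+ L I) *: 'X^(L I).
have QE z : Q.[z] = 1 - (r%:C * z) ^+ L I.
  by rewrite /Q hornerD hornerN hornerZ hornerXn hornerC exprMn.
have Q0 : Q != 0.
  apply/eqP => /(congr1 (fun q : {poly R[i]} => q.[0])).
  by rewrite QE mulr0 expr0n gtn_eqF // subr0 horner0 => /eqP; rewrite oner_eq0.
have fE z : factor I z ^+ L I = expC ((-1) ^+ #|I| * log_sum ((r%:C * z) ^+ L I)).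
  have Le : (L I)%:R * (expo I)%:C = (-1) ^+ #|I|.
    rewrite /expo rmorphM rmorphXn rmorphN1 fmorphV rmorph_nat mulrC divfK //.
    by rewrite pnatr_eq0 -lt0n.
  by rewrite /factor -expCMn -mulr_natl mulrA Le.
have := fE; rewrite -signr_odd; case: (odd _) => {}fE.
  exists (L I), 1, Q; split=> [//||z zd]; first exact: oner_neq0.
  by rewrite hornerC mulr1 fE expr1 mulN1r expC_log_sum ?QE // disk_pow.
exists (L I), Q, 1; split=> // z zd.
rewrite fE expr0 mul1r QE -expC_log_sum ?disk_pow // -expCD subrr expC0.
by rewrite hornerC.
Qed.

Lemma zeta_algebraic : algebraic_on (open_disk (r^-1)%:C) Z.
Proof.
have [n [U [V [n0 U0 h]]]] : radical (fun z => \prod_(I : {set 'I_M}) factor I z).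
  elim: (index_enum _) => [|I s ih].
    exists 1%N, 1, 1; split=> // [|z _]; first exact: oner_neq0.
    by rewrite big_nil expr1n mul1r.
  have [n [U [V [n0 U0 h]]]] := radicalM (radical_factor I) ih.
  by exists n, U, V; split=> // z zd; rewrite big_cons h.
exists (U%:P * 'X^n - V%:P).
  apply/eqP => /(congr1 (fun P : {poly {poly R[i]}} => P`_n)).
  have Vn : (V%:P)`_n = 0 by rewrite coefC gtn_eqF.
  have Un : (U%:P * 'X^n)`_n = U by rewrite coefMXn ltnn subnn coefC.
  by rewrite coefB Vn Un subr0 coef0 => /eqP; rewrite (negPf U0).
move=> z zd; rewrite hornerD hornerN hornerM !hornerC hornerXn.
rewrite hornerD hornerN hornerM horner_exp hornerC mulrC Z_factor // h //.
by rewrite subrr.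
Qed.

End RationalCase.

(** * Natural boundaries from dense singular points, and the theorem *)

Section NaturalBoundary.
Local Open Scope complex_scope.
Variable R : realType.

(** The open set of a continuation at any boundary point contains one of the dense points xi / r,
    where the continuation would be analytic. *)
Lemma natural_boundary_dense (f : R[i] -> R[i]) (r : R) : 0 < r ->
  (forall u eps, modC u = 1 -> 0 < eps -> exists xi : R[i], [/\ modC xi = 1,
     modC (xi - u) < eps &
     forall g d, 0 < d -> (forall z, modC (z - (r^-1)%:C * xi) < d ->
       open_disk (r^-1)%:C z -> g z = f z) -> ~ analytic_at g ((r^-1)%:C * xi)]) ->
  natural_boundary (r^-1)%:C f.
Proof.
move=> r0 dense w; rewrite modCE => /complexI wr [U [g [oU Uw gU gf]]].
have [d' d'0 dU] := open_ball_sub oU Uw.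
have [d dE] : exists d, d' = d%:C by apply/complex_realP/gtr0_real.
rewrite {}dE ltcR in d'0 dU.
have u1 : modC (r%:C * w) = 1.
  by rewrite modCM modC_real gtr0_norm // wr mulfV // gt_eqF.
have e0 : 0 < d / 2 * r by rewrite mulr_gt0 // divr_gt0.
have [xi [xi1 xiu sing]] := dense _ _ u1 e0.
have Ww : modC ((r^-1)%:C * xi - w) < d / 2.
  have -> : (r^-1)%:C * xi - w = (r^-1)%:C * (xi - r%:C * w).
    by rewrite mulrBr mulrA -rmorphM mulVf ?gt_eqF // mul1r.
  by rewrite modCM modC_real gtr0_norm ?invr_gt0 // mulrC ltr_pdivrMr.
have WU z : modC (z - (r^-1)%:C * xi) < d / 2 -> U z.
  move=> zW; apply: dU; rewrite modCE ltcR.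
  have -> : z - w = (z - (r^-1)%:C * xi) + ((r^-1)%:C * xi - w) by ring.
  by apply: le_lt_trans (modCD _ _) _; lra.
have d20 : 0 < d / 2 by rewrite divr_gt0.
apply: (sing g (d / 2) d20); last by apply/gU/WU; rewrite subrr modC0.
by move=> z /WU Uz zd; exact: gf.
Qed.

End NaturalBoundary.

Section OrderProperties.
Variables (R : realType) (F : finFieldType) (K : closedFieldType).
Variables (iota : {rmorphism laurent F -> K}) (absK : K -> R).
Hypothesis K_algebraic : forall a : K, algebraicOver iota a.
Hypothesis absK_av : is_absolute_value absK.
Hypothesis absK_extends : forall x : laurent F, absK (iota x) = absF x.

Lemma filtered_orders (p : nat) (lambda : seq K) (P : pred K) :
  p \in [pchar K] -> (forall l, P l -> absK l = 1) ->
  let s := [seq l <- lambda | P l] in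
  forall i : 'I_(size s),
    (0 < order_mod absK s`_i)%N /\ coprime p (order_mod absK s`_i).
Proof.
move=> pK P1 s i; have si : absK s`_i = 1.
  by apply: P1; have := mem_nth 0 (ltn_ord i); rewrite mem_filter => /andP[].
split; first exact: (order_mod_gt0 absK_av absK_extends (K_algebraic _)).
exact: (order_mod_coprime absK_av absK_extends (K_algebraic _)).
Qed.

Lemma non_root_of_unity_gap a : absK a = 1 -> ~~ is_root_of_unity a ->
  0 < absK (a ^+ order_mod absK a - 1) < 1.
Proof.
move=> a1 na; have [n0 an _] := order_modP absK_av absK_extends (K_algebraic a) a1.
rewrite an andbT lt_neqAle absK_ge0 // andbT eq_sym absK_eq0 //.
apply: contra na; rewrite subr_eq0 => /eqP an1; apply/asboolP.
by exists (order_mod absK a).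
Qed.

End OrderProperties.

Local Open Scope complex_scope.

Theorem theorem4p2 (R : realType) (F : finFieldType)
    (K : closedFieldType) (iota : {rmorphism laurent F -> K}) (absK : K -> R)
    (K_algebraic : forall a : K, algebraicOver iota a)
    (absK_av : is_absolute_value absK)
    (absK_extends : forall x : laurent F, absK (iota x) = absF x)
    (d : nat) (d_ge1 : (1 <= d)%N) (A : 'M[{poly F}]_d) :
  let lambda := eigenvalues (map_mx (iota \o @polyL F) A) in
  let r : R := \prod_(l <- lambda) Num.max 1 (absK l) in
  let mu := [seq l <- lambda | is_root_of_unity l] in
  let eta := [seq l <- lambda | (absK l == 1) && ~~ is_root_of_unity l] in
  let M := size mu in
  let N := size eta in
  let m (i : 'I_M) := order_mod absK mu`_i in
  let n (j : 'I_N) := order_mod absK eta`_j in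
  let f := @torus_mulmx F d A in
  let zeta : R[i] -> R[i] := @artin_mazur_zeta _ f R in
  let rho : R[i] := (r^-1)%:C in
  ((forall j : 'I_N, exists i : 'I_M, (m i %| n j)%N) ->
     algebraic_on (open_disk rho) zeta /\
     forall z : R[i], open_disk rho z ->
       series_cvg (zeta_term f z) /\
       zeta z = (1 - r%:C * z)^-1 *
         \prod_(1 <= l < M.+1) \prod_(I : {set 'I_M} | #|I| == l)
           let L := \big[lcmn/1%N]_(i in I) m i in
           powC (1 - (r%:C * z) ^+ L) ((-1) ^+ l.+1 / L%:R))
  /\
  ((exists j : 'I_N, forall i : 'I_M, ~~ (m i %| n j)%N) ->
     [/\ forall z : R[i], open_disk rho z ->
           series_cvg (fix_term f z) /\ series_cvg (zeta_term f z),
         natural_boundary rho (@fix_series _ f R),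
         natural_boundary rho zeta
       & transcendental_on (open_disk rho) zeta]).
Proof.
case: d d_ge1 A => // d' _ A lambda r mu eta M N m n f zeta rho.
have [p pp pK] := pcharK iota.
have r0 : 0 < r by apply: prodr_gt0 => l _; rewrite lt_max ltr01.
pose c (j : 'I_N) := absK (eta`_j ^+ n j - 1).
have cntE k : (0 < k)%N ->
    (num_isolated_fix f k)%:R = r ^+ k * gcoef p m n c k (logn p k).
  exact: (num_isolated_fix_formula K_algebraic absK_av absK_extends).
have mP (i : 'I_M) : (0 < m i)%N /\ coprime p (m i).
  by apply: (filtered_orders K_algebraic absK_av absK_extends pK) => l; exact: root_of_unity_abs.
have nP (j : 'I_N) : (0 < n j)%N /\ coprime p (n j).
  by apply: (filtered_orders K_algebraic absK_av absK_extends pK) => l /andP[/eqP].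
have cP (j : 'I_N) : 0 < c j < 1.
  have := mem_nth 0 (ltn_ord j); rewrite mem_filter => /andP[/andP[/eqP eta1 etaN] _].
  exact: (non_root_of_unity_gap K_algebraic absK_av absK_extends).
have m_gt0 i : (0 < m i)%N by have [] := mP i.
have n_gt0 j : (0 < n j)%N by have [] := nP j.
have m_cop i : coprime p (m i) by have [] := mP i.
have n_cop j : coprime p (n j) by have [] := nP j.
have c_gt0 j : 0 < c j by have /andP[] := cP j.
have c_lt1 j : c j < 1 by have /andP[] := cP j.
pose a k := gcoef p m n c k (logn p k).
have a_bounds k : 0 <= a k <= 1 by rewrite /a gcoef_ge0 // gcoef_le1.
split.
  move=> mn.
  have cntE' k : (0 < k)%N ->
      (num_isolated_fix f k)%:R = r ^+ k * \prod_i (~~ (m i %| k)%N)%:R.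
    move=> k0; rewrite cntE // /gcoef; congr (_ * _).
    (* If some m_i divides k, both sides vanish; otherwise no n_j divides k, since each n_j is a
       multiple of some m_i. *)
    have [[i mi]|nm] := pselect (exists i, (m i %| k)%N).
      by rewrite (bigD1 i) //= mi mul0r mul0r.
    rewrite [X in _ * X]big1 ?mulr1 // => j _; case: ifP => // nk.
    by have [i mi] := mn j; case: nm; exists i; exact: dvdn_trans nk.
  split; first exact: (zeta_algebraic r0 m_gt0 cntE').
  move=> z zd; split; last exact: (zeta_product r0 m_gt0 cntE').
  by have [] := counting_series_cvg r0 a_bounds cntE zd.
move=> [j0 j0P].
have bounds e (xi : R[i]) : (p ^ e.+1).-primitive_root xi -> modC xi = 1 /\
    exists kap B : R, [/\ 0 < kap, 0 <= B & forall l,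
      - (l%:R / (p ^ e.+1)%:R) - B <=
      \sum_(k < l) a k.+1 * complex.Re (xi ^+ k.+1) <= - (kap * l%:R) + B].
  move=> xiP; split; first exact: modC_prim_root xiP.
  exact: (partial_sum_bounds pp m_gt0 n_gt0 m_cop n_cop c_gt0 c_lt1 xiP j0P).
have p_gt1 e : (1 < p ^ e.+1)%N by rewrite -{1}(expn0 p) ltn_exp2l // prime_gt1.
split.
- by move=> z zd; exact: (counting_series_cvg r0 a_bounds cntE zd).
- apply: natural_boundary_dense => // u eps u1 eps0.
  have [xi [e [xiP xiu]]] := dense_roots pp u1 eps0.
  have [xi1 [kap [B [kap0 B0 hb]]]] := bounds e xi xiP.
  exists xi; split=> // g d d0 gf.
  exact: (counting_sum_no_continuation r0 a_bounds cntE xi1 kap0 B0 hb d0 gf).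
- apply: natural_boundary_dense => // u eps u1 eps0.
  have [xi [e [xiP xiu]]] := dense_roots pp u1 eps0.
  have [xi1 [kap [B [kap0 B0 hb]]]] := bounds e xi xiP.
  exists xi; split=> // g d d0 gf.
  exact: (zeta_no_continuation r0 a_bounds cntE xi1 (ltnW (p_gt1 e)) kap0 B0 hb (p_gt1 e) d0 gf).
- move=> [P P0 PZ].
  (* One boundary point suffices here, with p^e above the degree of P in zeta. *)
  have [xi [e [xiP De]]] := large_order_root R pp (size P).
  have [xi1 [kap [B [kap0 B0 hb]]]] := bounds e xi xiP.
  exact: (zeta_not_root r0 a_bounds cntE xi1 (ltnW (p_gt1 e)) kap0 B0 hb P0 (ltnW De) PZ).
Qed.
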